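(* Let $V$ be a $C_2$-cofinite simple vertex operator algebra of CFT-type and let $\sigma\in\mathrm{Aut}(V)$ be an automorphism of finite order $p$. Then the fixed point vertex operator subalgebra $V^{\sigma}=\{v\in V\mid \sigma(v)=v\}$ is also $C_2$-cofinite.
   Context: A vertex operator algebra (VOA) is a quadruple $(V,Y,\mathbf 1,\omega)$ over $\mathbb C$ in the usual sense, with grading $V=\bigoplus_n V_n$ by $L(0)$-weights, vertex operators $Y(v,z)=\sum_{m\in\mathbb Z}v_mz^{-m-1}$, vacuum $\mathbf 1\in V_0$ and Virasoro element $\omega\in V_2$, $Y(\omega,z)=\sum_{n}L(n)z^{-n-2}$; $\mathrm{wt}(v)=n$ for $v\in V_n$. $V$ is of CFT-type if $V=\bigoplus_{n\ge 0}V_n$ and $V_0=\mathbb C\mathbf 1$. Automorphisms fix $\mathbf 1$ and $\omega$. For a VOA $V$ and a $V$-module $W$ put $C_2(W)=\mathrm{Span}_{\mathbb C}\{v_{-2}u\mid v\in V,\ u\in W,\ \mathrm{wt}(v)>0\}$ ($v$ homogeneous); $W$ is called $C_2$-cofinite if $\dim W/C_2(W)<\infty$. A VOA is $C_2$-cofinite if it is $C_2$-cofinite as a module over itself. *)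

(* Defs.v *)
From HB Require Import structures.
From mathcomp Require Import all_boot all_order all_algebra.
From mathcomp Require Import all_classical all_reals.
From mathcomp Require Import complex.

Set Implicit Arguments.
Unset Strict Implicit.
Unset Printing Implicit Defensive.
Import Order.TTheory GRing.Theory Num.Theory.
Local Open Scope classical_set_scope.
Local Open Scope ring_scope.

(** The ground field is [R[i]] for an arbitrary [R : realType], i.e. the field
    of complex numbers. *)

Section Subspaces.
Context {K : fieldType} {V : lmodType K}.
Implicit Types (U S : set V) (s : seq V).

Definition is_subspace U : Prop :=
  U 0 /\ forall (a : K) u v, U u -> U v -> U (a *: u + v).

Definition span S : set V := smallest is_subspace S.

Definition finite_dim U : Prop := exists s, U = span [set` s].

(** [dim (V / U) < oo]: the classes of finitely many vectors span the
    quotient. *)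
Definition finite_codim U : Prop :=
  exists s, forall w, exists2 u, U u & span [set` s] (w - u).

End Subspaces.

(** Generalized binomial coefficient [m (m - 1) ... (m - i + 1) / i!]. *)
Definition zbinom {K : fieldType} (m : int) (i : nat) : K :=
  (\prod_(j < i) (m - j%:Z)%:~R) / i`!%:R.

Section VoaDef.
Context {R : realType} {V : lmodType R[i]}.
(** [Y u m v] is [u_m v], where [Y(u, z) = \sum_m u_m z^(-m-1)]. *)
Variables (Y : V -> int -> V -> V) (one omega : V) (c : R[i]).

(** [L(n) = omega_(n+1)], from [Y(omega, z) = \sum_n L(n) z^(-n-2)]. *)
Definition L_op (n : int) (v : V) : V := Y omega (n + 1) v.

Definition L0_eigenspace (n : int) : set V :=
  [set v | L_op 0 v = n%:~R *: v].

(** Component form of the Jacobi identity. Both sums are sums of finitely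
    supported families as soon as the truncation condition holds. *)
Definition borcherds_identity : Prop :=
  forall (u v w : V) (l m n : int),
    \sum_(i \in [set: nat])
      zbinom m i *: Y (Y u (l + i%:Z) v) (m + n - i%:Z) w =
    \sum_(i \in [set: nat])
      ((-1) ^+ i * zbinom l i) *:
        (Y u (l + m - i%:Z) (Y v (n + i%:Z) w)
         - (-1) ^ l *: Y v (l + n - i%:Z) (Y u (m + i%:Z) w)).

(** The decomposition [V = \bigoplus_n V_n] is only required to exist: the sum
    of eigenspaces of [L(0)] is automatically direct
    (see [L0_eigenspace_direct]). *)
Record is_voa : Prop := IsVOA {
  voa_linearl : forall m v, linear (fun u => Y u m v);
  voa_linearr : forall u m, linear (Y u m);
  voa_truncation : forall u v,
    exists N : int, forall m, N <= m -> Y u m v = 0;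
  voa_vacuum : forall m v, Y one m v = if m == -1 then v else 0;
  voa_creation : forall v, Y v (-1) one = v;
  voa_creation_ge0 : forall v (m : int), 0 <= m -> Y v m one = 0;
  voa_borcherds : borcherds_identity;
  voa_virasoro : forall (m n : int) v,
    L_op m (L_op n v) - L_op n (L_op m v) =
      (m - n)%:~R *: L_op (m + n) v
      + (if m + n == 0 then ((m ^+ 3 - m)%:~R / 12%:R * c) *: v else 0);
  voa_derivative : forall (u : V) m v,
    Y (L_op (-1) u) m v = - (m%:~R *: Y u (m - 1) v);
  voa_one_weight : L0_eigenspace 0 one;
  voa_omega_weight : L0_eigenspace 2 omega;
  voa_grading : forall v, exists (s : seq int) (f : int -> V),
    [/\ uniq s, forall n, L0_eigenspace n (f n) & v = \sum_(n <- s) f n];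
  voa_grading_fin : forall n, finite_dim (L0_eigenspace n);
  voa_grading_lb : exists N : int,
    forall n, n < N -> L0_eigenspace n `<=` [set 0] }.

End VoaDef.

Record voa (R : realType) := VOA {
  voa_sort :> lmodType R[i];
  mode : voa_sort -> int -> voa_sort -> voa_sort;
  vacuum : voa_sort;
  conformal : voa_sort;
  central_charge : R[i];
  voaP : is_voa mode vacuum conformal central_charge }.

Arguments mode {R v}.
Arguments vacuum {R v}.
Arguments conformal {R v}.
Arguments central_charge {R} v.

Section Notions.
Context {R : realType} (V : voa R).

Definition weight_space (n : int) : set V := L0_eigenspace mode conformal n.

Definition cft_type : Prop :=
  (forall n, n < 0 -> weight_space n `<=` [set 0]) /\
  weight_space 0 = span [set vacuum].

Definition is_ideal (I : set V) : Prop :=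
  is_subspace I /\
  forall v m u, I u -> I (mode v m u) /\ I (mode u m v).

Definition voa_simple : Prop :=
  [set: V] <> [set 0] /\
  forall I, is_ideal I -> I = [set 0] \/ I = [set: V].

Definition C2 : set V :=
  span [set x | exists (n : int) (v u : V),
    [/\ 0 < n, weight_space n v & x = mode v (-2) u]].

Definition C2_cofinite : Prop := finite_codim C2.

Record voa_aut := VOAAut {
  aut_fun :> {linear V -> V};
  aut_bij : bijective aut_fun;
  aut_mode : forall u m v,
    aut_fun (mode u m v) = mode (aut_fun u) m (aut_fun v);
  aut_vacuum : aut_fun vacuum = vacuum;
  aut_conformal : aut_fun conformal = conformal }.

Definition aut_has_order (sigma : voa_aut) (p : nat) : Prop :=
  [/\ (0 < p)%N, iter p sigma =1 id &
      forall k, (0 < k < p)%N -> ~ (iter k sigma =1 id)].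

End Notions.

Arguments weight_space {R} V n.
Arguments C2 {R} V.

Section SubspaceFacts.
Context {K : fieldType} {V : lmodType K}.
Implicit Types (U S : set V) (s : seq V).

Lemma span_subspace S : is_subspace (span S).
Proof.
split; first by move=> U [[U0 _] _].
move=> a u v Su Sv U USU; have [[_ UD] _] := USU.
by apply: UD; [apply: Su | apply: Sv].
Qed.

Lemma span_incl S : S `<=` span S.
Proof. by move=> x Sx U [_ SU]; apply: SU. Qed.

Lemma span_min S U : is_subspace U -> S `<=` U -> span S `<=` U.
Proof. by move=> Usub SU x; apply. Qed.

Lemma subspaceD U u v : is_subspace U -> U u -> U v -> U (u + v).
Proof. by move=> [_ UD] Uu Uv; rewrite -(scale1r u); apply: UD. Qed.

Lemma subspaceZ U a u : is_subspace U -> U u -> U (a *: u).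
Proof. by move=> [U0 UD] Uu; rewrite -(addr0 (_ *: _)); apply: UD. Qed.

Lemma subspaceB U u v : is_subspace U -> U u -> U v -> U (u - v).
Proof. by move=> [_ UD] Uu Uv; rewrite addrC -scaleN1r; apply: UD. Qed.

Lemma span_nil : span [set` [::]] = [set 0 : V].
Proof.
apply/seteqP; split=> [|x ->]; last by case: (span_subspace [set` [::]]).
apply: span_min => [|//]; split=> // a u v /= -> ->.
by rewrite scaler0 addr0.
Qed.

Lemma span_cons x s v :
  span [set` (x :: s)] v -> exists a y, span [set` s] y /\ v = a *: x + y.
Proof.
have [S0 SD] := span_subspace [set` s].
apply: (@span_min _ [set v | exists a y, span [set` s] y /\ v = a *: x + y]).
  split; first by exists 0, 0; rewrite scale0r addr0.
  move=> a _ _ [b [y [Sy ->]]] [b' [y' [Sy' ->]]].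
  exists (a * b + b'), (a *: y + y'); split; first exact: SD.
  by rewrite scalerDr scalerA addrACA scalerDl.
move=> y /=; rewrite inE => /orP[/eqP ->|ys].
  by exists 1, 0; rewrite scale1r addr0.
by exists 0, y; rewrite scale0r add0r; split=> //; apply: span_incl.
Qed.

Lemma span_seqS x s : span [set` s] `<=` span [set` (x :: s)].
Proof.
apply: span_min; first exact: span_subspace.
by move=> y ys; apply: span_incl; rewrite /= inE ys orbT.
Qed.

Lemma finite_dim_sub s U :
  is_subspace U -> U `<=` span [set` s] -> finite_dim U.
Proof.
elim: s U => [|x s IHs] U Usub Us.
  exists [::]; apply/seteqP; split=> //.
  by rewrite span_nil => _ ->; case: Usub.
have [t tE] : finite_dim (U `&` span [set` s]).
  apply: IHs => [|y []//]; split.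
    by split; [case: Usub | case: (span_subspace [set` s])].
  move=> a u v [Uu Su] [Uv Sv].
  by split; [apply: Usub.2 | apply: (span_subspace [set` s]).2].
have [[u [Uu [a [y [Sy [a0 uE]]]]]] | noU] := pselect (exists u, U u /\
    exists a y, span [set` s] y /\ a != 0 /\ u = a *: x + y); last first.
  exists t; rewrite -tE; apply/seteqP; split=> [v Uv|v []//]; split=> //.
  have [a [y [Sy vE]]] := span_cons (Us _ Uv).
  have [a0|a0] := eqVneq a 0; first by rewrite vE a0 scale0r add0r.
  by exfalso; apply: noU; exists v; split=> //; exists a, y.
exists (u :: t); apply/seteqP; split; last first.
  apply: span_min => // z /=; rewrite inE => /orP[/eqP -> //|zt].
  have : (U `&` span [set` s]) z by rewrite tE; apply: span_incl.
  by case.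
move=> w Uw; have [b [z [Sz wE]]] := span_cons (Us _ Uw).
have : (U `&` span [set` s]) (w - (b / a) *: u).
  split; first by apply: (subspaceB Usub) => //; apply: (subspaceZ _ Usub).
  rewrite wE uE scalerDr scalerA divfK// opprD addrACA subrr add0r.
  have Ssub := span_subspace [set` s].
  by apply: (subspaceB Ssub) => //; apply: (subspaceZ _ Ssub).
rewrite tE => Tw; rewrite -(subrK ((b / a) *: u) w).
have Tsub := span_subspace [set` u :: t].
apply: (subspaceD Tsub); first exact: span_seqS.
apply: (subspaceZ _ Tsub).
by apply: span_incl; rewrite /= inE eqxx.
Qed.

End SubspaceFacts.

Lemma finite_dim_inj (K : fieldType) (V W : lmodType K)
    (f : {linear W -> V}) (U : set V) (U' : set W) :
  injective f -> is_subspace U' -> (forall x, U' x -> U (f x)) ->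
  finite_dim U -> finite_dim U'.
Proof.
move=> f_inj U'sub U'U [s sE].
have fUsub : is_subspace (f @` U').
  split; first by exists 0; [case: U'sub | rewrite linear0].
  move=> a _ _ [u Uu <-] [v Uv <-]; exists (a *: u + v); last by rewrite linearP.
  exact: U'sub.2.
have [t tE] : finite_dim (f @` U').
  apply: (@finite_dim_sub _ _ s) => // _ [x U'x <-].
  by rewrite -sE; apply: U'U.
have [t' tt'] : exists t', t = map f t'.
  have : forall y, y \in t -> exists x, f x = y.
    move=> y yt; have : (f @` U') y by rewrite tE; apply: span_incl.
    by case=> x _ <-; exists x.
  elim: (t) => [_|y r IHr yP]; first by exists [::].
  have [|r' ->] := IHr; first by move=> z zr; apply: yP; rewrite inE zr orbT.
  have [|x <-] := yP y; first by rewrite inE eqxx.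
  by exists (x :: r').
exists t'; apply/seteqP; split.
  move=> x U'x.
  have : span [set` t] (f x) by rewrite -tE; exists x.
  move=> tx; suff : (f @` span [set` t']) (f x) by case=> y ty /f_inj <-.
  apply: (span_min _ _ tx).
    have [S0 SD] := span_subspace [set` t'].
    split; first by exists 0 => //; rewrite linear0.
    move=> a _ _ [u Su <-] [v Sv <-]; exists (a *: u + v); last by rewrite linearP.
    exact: SD.
  move=> y /=; rewrite tt' => /mapP[z zt' ->].
  by exists z => //; apply: span_incl.
apply: span_min => // x xt'.
have : (f @` U') (f x).
  by rewrite tE; apply: span_incl; rewrite /= tt'; apply: map_f.
by case=> y U'y /f_inj <-.
Qed.

Lemma raddf_fsum (U V : zmodType) (f : {additive U -> V}) (I : choiceType)
    (F : I -> U) :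
  injective f ->
  f (\sum_(i \in [set: I]) F i) = \sum_(i \in [set: I]) f (F i).
Proof.
move=> f_inj; rewrite raddf_sum.
suff -> : finite_support 0 [set: I] F = finite_support 0 [set: I] (f \o F).
  by [].
rewrite /finite_support !unlock; do 2 f_equal.
apply/seteqP; split=> i [_ /= Fi]; split=> //= Fi0; apply: Fi.
  by apply: f_inj; rewrite Fi0 raddf0.
by rewrite Fi0 raddf0.
Qed.

Section GradingFacts.
Context {R : realType} (V : voa R).

Lemma L_op_linear n : linear (L_op mode (conformal : V) n).
Proof. by move=> a u v; apply: (voa_linearr (voaP V)). Qed.

Lemma weight_space_subspace n : is_subspace (weight_space V n).
Proof.
have L0 : L_op mode (conformal : V) 0 0 = 0.
  have := L_op_linear 0 (-1) 0 0.
  by rewrite scaler0 addr0 scaleN1r addNr.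
split; rewrite /weight_space /L0_eigenspace /=; first by rewrite L0 scaler0.
move=> a u v Lu Lv; rewrite L_op_linear Lu Lv scalerDr !scalerA.
by rewrite [a * _]mulrC.
Qed.

Lemma L0_eigenspace_direct (s : seq int) (f : int -> V) :
  uniq s -> (forall n, weight_space V n (f n)) -> \sum_(n <- s) f n = 0 ->
  forall n, n \in s -> f n = 0.
Proof.
elim: s f => [//|m s IHs] f /= /andP[ms us] fP; rewrite big_cons => sum0.
have Ladd := L_op_linear 0.
pose L : {linear V -> V} :=
  HB.pack (L_op mode (conformal : V) 0) (GRing.isLinear.Build _ _ _ _ _ Ladd).
have LE n : L (f n) = n%:~R *: f n by apply: fP.
have s0 n : n \in s -> f n = 0.
  move=> ns.
  have gP k : weight_space V k ((k - m)%:~R *: f k).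
    by apply: (subspaceZ _ (weight_space_subspace _)).
  have := IHs (fun k => (k - m)%:~R *: f k) us gP _ n ns.
  move=> /(_ _)/eqP; rewrite scaler_eq0 intr_eq0 subr_eq0.
  have -> : (n == m) = false by apply: contraNF ms => /eqP <-.
  move=> /= H; apply/eqP/H.
  have := congr1 L sum0; rewrite linear0 linearD linear_sum LE.
  move: sum0 => /eqP; rewrite addr_eq0 => /eqP ->.
  rewrite scalerN scaler_sumr addrC -sumrB => sum0.
  rewrite -[RHS]sum0; apply: eq_bigr => k _.
  by rewrite LE -scalerBl intrB.
move=> n; rewrite inE => /orP[/eqP ->|]; last exact: s0.
by move: sum0; rewrite big_seq big1 ?addr0.
Qed.

End GradingFacts.

Section FixedPoints.
Context {R : realType} {V : voa R}.
Variable sigma : voa_aut V.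

Definition fixed_pred : {pred V} := fun v => sigma v == v.

Fact fixed_submod_closed : submod_closed fixed_pred.
Proof.
split; first by rewrite unfold_in linear0.
move=> a u v; rewrite !unfold_in => /eqP su /eqP sv.
by rewrite linearP su sv.
Qed.

HB.instance Definition _ :=
  GRing.isSubmodClosed.Build R[i] V fixed_pred fixed_submod_closed.

Record fixed_points := FixedPoint {
  fixed_val :> V;
  fixed_valP : fixed_val \in fixed_pred }.

HB.instance Definition _ := [isSub for fixed_val].
HB.instance Definition _ := [Choice of fixed_points by <:].
HB.instance Definition _ := [SubChoice_isSubLmodule of fixed_points by <:].

Lemma fixedE (x : fixed_points) : sigma (fixed_val x) = fixed_val x.
Proof. exact/eqP/(fixed_valP x). Qed.

Fact fixed_mode_subproof (u : fixed_points) (m : int) (v : fixed_points) :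
  mode (fixed_val u) m (fixed_val v) \in fixed_pred.
Proof. by rewrite unfold_in aut_mode !fixedE. Qed.

Fact fixed_vacuum_subproof : vacuum \in fixed_pred.
Proof. by rewrite unfold_in aut_vacuum. Qed.

Fact fixed_conformal_subproof : conformal \in fixed_pred.
Proof. by rewrite unfold_in aut_conformal. Qed.

Definition fixed_mode (u : fixed_points) (m : int) (v : fixed_points) :
  fixed_points := FixedPoint (fixed_mode_subproof u m v).
Definition fixed_vacuum : fixed_points := FixedPoint fixed_vacuum_subproof.
Definition fixed_conformal : fixed_points :=
  FixedPoint fixed_conformal_subproof.

Lemma fixed_val_inj : injective fixed_val.
Proof. exact: val_inj. Qed.

Lemma fixed_L_op n (x : fixed_points) :
  fixed_val (L_op fixed_mode fixed_conformal n x) =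
  L_op mode conformal n (fixed_val x).
Proof. by []. Qed.

Lemma fixed_weightP n (x : fixed_points) :
  L0_eigenspace fixed_mode fixed_conformal n x <->
  weight_space V n (fixed_val x).
Proof.
split=> [/(congr1 fixed_val)//|Vx].
exact: fixed_val_inj.
Qed.

Lemma aut_weight n v : weight_space V n v -> weight_space V n (sigma v).
Proof.
rewrite /weight_space /L0_eigenspace /L_op /= => vn.
by rewrite -{1}(aut_conformal sigma) -aut_mode vn linearZ.
Qed.

Fact fixed_is_voa :
  is_voa fixed_mode fixed_vacuum fixed_conformal (central_charge V).
Proof.
have VP := voaP V.
split.
- move=> m v a u u'; apply: fixed_val_inj.
  exact: (voa_linearl VP).
- move=> u m a v v'; apply: fixed_val_inj.
  exact: (voa_linearr VP).
- move=> u v; have [N NP] := voa_truncation VP (fixed_val u) (fixed_val v).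
  by exists N => m Nm; apply: fixed_val_inj; apply: NP.
- move=> m v; apply: fixed_val_inj; rewrite [LHS](voa_vacuum VP).
  by case: eqP.
- by move=> v; apply: fixed_val_inj; apply: (voa_creation VP).
- by move=> v m m0; apply: fixed_val_inj; apply: (voa_creation_ge0 VP).
- move=> u v w l m n; apply: fixed_val_inj.
  pose fv : {additive fixed_points -> V} := \val.
  rewrite -[LHS]/(fv _) -[RHS]/(fv _) !raddf_fsum; try exact: val_inj.
  exact: (voa_borcherds VP).
- move=> m n v; apply: fixed_val_inj.
  rewrite [LHS](voa_virasoro VP) /=.
  by case: eqP.
- by move=> u m v; apply: fixed_val_inj; apply: (voa_derivative VP).
- by apply/fixed_weightP; apply: (voa_one_weight VP).
- by apply/fixed_weightP; apply: (voa_omega_weight VP).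
- move=> v; have [s [f [us fP vE]]] := voa_grading VP (fixed_val v).
  have gP n : weight_space V n (sigma (f n) - f n).
    apply: (subspaceB (weight_space_subspace V n)); last exact: fP.
    exact/aut_weight/fP.
  have g0 : \sum_(n <- s) (sigma (f n) - f n) = 0.
    by rewrite sumrB -linear_sum -vE fixedE subrr.
  have fixf n : n \in s -> f n \in fixed_pred.
    move=> ns; rewrite unfold_in -subr_eq0.
    by rewrite (L0_eigenspace_direct us gP g0 ns).
  exists s, (fun n => insubd (0 : fixed_points) (f n)); split=> //.
    move=> n; apply/fixed_weightP; rewrite -[fixed_val _]/(\val _) val_insubd.
    by case: ifP => _; [apply: fP | case: (weight_space_subspace V n)].
  apply: fixed_val_inj; rewrite [LHS]vE -[RHS]/(\val _) raddf_sum.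
  by rewrite !big_seq; apply: eq_bigr => n ns; rewrite /= insubdK// fixf.
- move=> n.
  apply: (@finite_dim_inj _ _ _ (\val : fixed_points -> V)
    (weight_space V n)); last exact: (voa_grading_fin VP).
  + exact: val_inj.
  + have [W0 WD] := weight_space_subspace V n.
    split; first by apply/fixed_weightP.
    move=> a u v /fixed_weightP Wu /fixed_weightP Wv; apply/fixed_weightP.
    exact: WD.
  + by move=> x /fixed_weightP.
- have [N NP] := voa_grading_lb VP.
  exists N => n nN x /fixed_weightP Wx; apply: fixed_val_inj.
  exact: (NP n nN _ Wx).
Qed.

Definition fixed_voa : voa R := VOA fixed_is_voa.

End FixedPoints.

(* Main.v *)
Require Import Defs.
From HB Require Import structures.
From mathcomp Require Import all_boot all_order all_algebra.
From mathcomp Require Import all_classical all_reals.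
From mathcomp Require Import complex cyclic separable cyclotomic.
From mathcomp Require Import zify ring.
(* [Defs] again, so that [span] is not the one of mathcomp's vector library. *)
Require Import Defs.

Set Implicit Arguments.
Unset Strict Implicit.
Unset Printing Implicit Defensive.
Import Order.TTheory GRing.Theory Num.Theory.
Local Open Scope classical_set_scope.
Local Open Scope ring_scope.

(** Let [T] be the fixed-point algebra and [V^mu] the eigenspaces of [sigma].

    Given vectors [u_1, ..., u_r] of eigenvalues [chi_1, ..., chi_r], multiply
    [Y(u_1, z_1) ... Y(u_r, z_r) 1] by a product of powers of the [z_i - z_j]
    to obtain a power series [P], symmetric in the order of the factors. If
    [chi] has product [1] over a set [I] of labels, the fields of [I] can be
    fused into a field [Y(a, z)] with [a] in [T]; as [a_n] with [n <= -2] maps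
    into [C_2], the degree of [P] modulo [C_2] along the direction in which the
    [z_i], [i] in [I], move together is bounded: a power of
    [\sum_(i in I) d/dz_i] kills [P] modulo [C_2]. If enough labels are
    present, these directions span, and [P] is a polynomial modulo [C_2].
    Simplicity allows one to add labels at no cost, since the vacuum is of the
    form [a_m u] for every homogeneous eigenvector [u <> 0]. It follows that,
    for fixed [u_i], the vectors [(u_1)_(n_1) ... (u_r)_(n_r) 1] span a finite
    dimensional space modulo [C_2].

    Among [p] eigenvalues there is a block with product [1]; with the
    [C_2]-cofiniteness of [V] this makes each [V^mu] a [C_1]-cofinite
    [T]-module. By induction on weights the finiteness above then becomes
    uniform: for some [n], [u_(-n) v] lies in [C_2(T)] for all [u] in [V^lam]
    and [v] in [V^(lam^-1)]. Finally [V] is [C_n]-cofinite, and the component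
    in [T] of [C_n(V)] is contained in [C_2(T)]. *)

(** * Subspaces, modes and the Borcherds identity *)

(** The obstacle is that [T] itself is not under control: finiteness has to come from products of
    fields of [V] that land in [T]. The degree bound along a block rests on two facts. A power
    series is determined by the restrictions of its derivatives to [z_a = z_b], so nothing is lost
    by fusing two labels. And fusing never raises the total exponent [E] of the monomial factors,
    whichever derivative is restricted, so that [E + 1] derivatives suffice for all fused fields at
    once.

    Coordinate directions are recovered from blocks as follows. Let [I] consist of [p] labels of
    eigenvalue [x], let [i] have eigenvalue [x] and [j] eigenvalue [x^-1]. Then [I] and all pairs
    [{i, j}], [{q, j}] have product [1], and [p e_i = e_I + \sum_(q in I) (e_{i,j} - e_{q,j})] for
    the indicator vectors. Hence [p] spare pairs of labels are added for every vector.

    The bounds so obtained depend on the chosen vectors. They become uniform because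
    [C_1]-cofiniteness expresses all vectors through finitely many of small weight, and each such
    reduction only makes mode indices more negative. *)

Section Subspace.
Context {K : fieldType} {V : lmodType K}.
Implicit Types (U S : set V) (s : seq V).

Lemma subspace0 U : is_subspace U -> U 0. Proof. by case. Qed.

Lemma subspaceN U u : is_subspace U -> U u -> U (- u).
Proof. by move=> sU Uu; rewrite -scaleN1r; apply: (subspaceZ _ sU). Qed.

Lemma subspace_sum U (I : Type) (r : seq I) (P : pred I) (F : I -> V) :
  is_subspace U -> (forall i, P i -> U (F i)) -> U (\sum_(i <- r | P i) F i).
Proof.
move=> sU UF; elim/big_rec: _ => [|i x Pi Ux]; first exact: (subspace0 sU).
by apply: (subspaceD sU) => //; apply: UF.
Qed.

Arguments subspace_sum {U I r P F} _ _.

Lemma subspace_sum_seq U (I : eqType) (r : seq I) (F : I -> V) :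
  is_subspace U -> (forall i, i \in r -> U (F i)) -> U (\sum_(i <- r) F i).
Proof. by move=> sU UF; rewrite big_seq; apply: subspace_sum. Qed.

Lemma span_mono S S' : S `<=` S' -> span S `<=` span S'.
Proof.
move=> SS'; apply: span_min; first exact: span_subspace.
by move=> x /SS' S'x; apply: span_incl.
Qed.

(** [finite_codim U] says that some [plus_span U s] is the whole space. *)
Definition plus_span U s : set V :=
  [set x | exists2 y, U y & span [set` s] (x - y)].

Lemma plus_span_subspace U s : is_subspace U -> is_subspace (plus_span U s).
Proof.
move=> sU; have sS := span_subspace [set` s]; split.
  by exists 0; [exact: (subspace0 sU) | rewrite subr0; exact: (subspace0 sS)].
move=> a u v [y Uy Sy] [z Uz Sz]; exists (a *: y + z); first exact: sU.2.
have -> : a *: u + v - (a *: y + z) = a *: (u - y) + (v - z).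
  by rewrite scalerBr opprD addrACA.
exact: sS.2.
Qed.

Lemma plus_spanl U s x : U x -> plus_span U s x.
Proof. by exists x => //; rewrite subrr; exact: (subspace0 (span_subspace _)). Qed.

Lemma plus_spanr U s x : is_subspace U -> span [set` s] x -> plus_span U s x.
Proof. by move=> sU sx; exists 0; [exact: (subspace0 sU) | rewrite subr0]. Qed.

Lemma plus_span_mono U U' s s' :
  U `<=` U' -> {subset s <= s'} -> plus_span U s `<=` plus_span U' s'.
Proof.
move=> UU' ss' x [y Uy sxy]; exists y; first exact: UU'.
exact: span_mono sxy.
Qed.

End Subspace.

Arguments subspace_sum {K V U I r P F} _ _.

Section Preimage.
Context {K : fieldType} {V W : lmodType K}.
Implicit Types (U : set W) (S : set V).

Lemma preim_subspace (f : {linear V -> W}) U :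
  is_subspace U -> is_subspace (f @^-1` U).
Proof.
move=> sU; split=> [|a u v]; first by have := subspace0 sU; rewrite -(linear0 f).
by rewrite /preimage /= => Uu Uv; rewrite linearP; exact: (sU.2 a).
Qed.

Lemma span_image (f : {linear V -> W}) U S :
  is_subspace U -> (forall x, S x -> U (f x)) -> forall x, span S x -> U (f x).
Proof.
by move=> sU SU; apply: span_min => //; apply: (preim_subspace f sU).
Qed.

End Preimage.

Section Zbinom.
Context {K : numFieldType}.
Implicit Types (m : int) (i k : nat).

Lemma zbinom0 m : zbinom m 0 = 1 :> K.
Proof. by rewrite /zbinom big_ord0 fact0 divr1. Qed.

Lemma fact_unit i : (i`!%:R : K) != 0.
Proof. by rewrite pnatr_eq0 -lt0n fact_gt0. Qed.

Lemma zbinomS m i :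
  i.+1%:R * zbinom m i.+1 = (m - i%:Z)%:~R * zbinom m i :> K.
Proof.
rewrite /zbinom big_ord_recr /= factS natrM invfM.
have i0 : (i.+1%:R : K) != 0 by rewrite pnatr_eq0.
move: (i.+1%:R : K) i0 (i`!%:R : K) (fact_unit i) => x x0 y y0.
by field; rewrite x0 y0.
Qed.

Lemma zbinom_nat k i : zbinom k%:Z i = 'C(k, i)%:R :> K.
Proof.
elim: i => [|i IHi]; first by rewrite zbinom0 bin0.
have i0 : (i.+1%:R : K) != 0 by rewrite pnatr_eq0.
apply: (mulfI i0); rewrite zbinomS IHi -natrM mul_bin_left.
have [ik|ki] := leqP i k; first by rewrite subzn // natrM.
by rewrite bin_small // muln0 mulr0.
Qed.

Lemma zbinom0l i : zbinom 0 i = (i == 0%N)%:R :> K.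
Proof. by rewrite -[RHS]/((i == 0)%N%:R) -bin0n -zbinom_nat. Qed.

(** These are the coefficients of [(1 - x)^(-k-1)]; they become the weights in [fuse_op] when the
    Borcherds identity is used with [l = -k-1]. *)
Lemma zbinom_neg k i :
  (-1) ^+ i * zbinom (- k.+1%:Z) i = 'C(k + i, i)%:R :> K.
Proof.
elim: i => [|i IHi]; first by rewrite expr0 mul1r zbinom0 bin0.
have i0 : (i.+1%:R : K) != 0 by rewrite pnatr_eq0.
apply: (mulfI i0).
transitivity ((k + i).+1%:R * ((-1) ^+ i * zbinom (- k.+1%:Z) i) : K).
  rewrite mulrCA zbinomS exprS.
  have -> : (- k.+1%:Z - i%:Z)%:~R = - (k + i).+1%:R :> K.
    by rewrite pmulrn -mulrNz; congr (_%:~R); lia.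
  by ring.
by rewrite IHi -!natrM addnS -mul_bin_diag.
Qed.

Lemma zbinom_pascal m i :
  zbinom (m + 1) i.+1 = zbinom m i.+1 + zbinom m i :> K.
Proof.
have i0 k : (k.+1%:R : K) != 0 by rewrite pnatr_eq0.
have z1 m' : zbinom m' 1 = m'%:~R :> K.
  by have := zbinomS m' 0; rewrite mul1r subr0 zbinom0 mulr1.
elim: i => [|i IHi]; first by rewrite !z1 zbinom0 intrD.
apply: (mulfI (i0 i.+1)); rewrite mulrDr !zbinomS IHi mulrDr.
have -> : (m + 1 - i.+1%:Z)%:~R = (m - i%:Z)%:~R :> K by congr (_%:~R); lia.
rewrite -(zbinomS m i) -!mulrDl; congr (_ * _).
have -> : (m - i.+1%:Z)%:~R = (m - i%:Z)%:~R - 1 :> K.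
  by rewrite (_ : m - i.+1%:Z = m - i%:Z - 1) ?[LHS]intrB //; lia.
by rewrite -[i.+2]addn1 natrD; ring.
Qed.

End Zbinom.

Lemma fsum_ord (V : zmodType) (F : nat -> V) (k : nat) :
  (forall i, (k <= i)%N -> F i = 0) ->
  \sum_(i \in [set: nat]) F i = \sum_(i < k) F i.
Proof.
move=> F0; rewrite (fsbig_ord _ k F); symmetry; apply: fsbig_widen => //.
move=> i [_ /= ik]; apply: F0; rewrite leqNgt; apply/negP => h; exact: ik.
Qed.

Lemma sum_ord_trunc (V : zmodType) (F : nat -> V) (m k : nat) :
  (m <= k)%N -> (forall i, (m <= i)%N -> F i = 0) ->
  \sum_(i < k) F i = \sum_(i < m) F i.
Proof.
move=> mk F0; rewrite -!(big_mkord xpredT F) (@big_cat_nat _ _ _ m) //=.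
by rewrite [X in _ + X]big_nat_cond [X in _ + X]big1 ?addr0 // => i /andP[/andP[/F0]].
Qed.

Section Modes.
Context {R : realType} {V : voa R}.
Local Notation K := (R[i]).
Implicit Types (u v w : V) (n m l : int) (a : K).

HB.instance Definition _ u n :=
  GRing.isLinear.Build K V V _ (@mode R V u n) (voa_linearr (voaP V) u n).

(** The mode as a function of its left vector: in this order of arguments, linearity in [u] can be
    declared as an instance. *)
Definition model n v u : V := mode u n v.
HB.instance Definition _ n v :=
  GRing.isLinear.Build K V V _ (model n v) (voa_linearl (voaP V) n v).

Lemma modeZl a u n w : mode (a *: u) n w = a *: mode u n w.
Proof. exact: (linearZ_LR (model n w)). Qed.

Lemma mode0l n w : mode (0 : V) n w = 0.
Proof. exact: (linear0 (model n w)). Qed.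

Lemma mode0r u n : mode u n (0 : V) = 0.
Proof. exact: linear0. Qed.

Lemma mode_suml (I : Type) (r : seq I) (P : pred I) (F : I -> V) n w :
  mode (\sum_(i <- r | P i) F i) n w = \sum_(i <- r | P i) mode (F i) n w.
Proof. exact: (linear_sum (model n w)). Qed.

Lemma span_model (S U : set V) n v : is_subspace U ->
  (forall x, S x -> U (mode x n v)) -> forall x, span S x -> U (mode x n v).
Proof. exact: (span_image (f := model n v)). Qed.

Lemma span_moder (S U : set V) u n : is_subspace U ->
  (forall x, S x -> U (mode u n x)) -> forall x, span S x -> U (mode u n x).
Proof. exact: (span_image (f := mode u n)). Qed.

Lemma mode_trunc u v : exists k : nat, forall n, k%:Z <= n -> mode u n v = 0.
Proof.
have [k kP] := voa_truncation (voaP V) u v; exists `|k|%N => n kn.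
by apply: kP; lia.
Qed.

Lemma mode_vacuum n v : mode (vacuum : V) n v = if n == -1 then v else 0.
Proof. exact: (voa_vacuum (voaP V)). Qed.

Lemma mode_creation u : mode u (-1) vacuum = u.
Proof. exact: (voa_creation (voaP V)). Qed.

Lemma mode_creation_ge0 u n : 0 <= n -> mode u n vacuum = 0.
Proof. exact: (voa_creation_ge0 (voaP V)). Qed.

(** Truncation makes both sums finite. Any large enough [k] is allowed, so that several identities
    can be given the same bound. *)
Lemma borcherds u v w l m n : exists k0 : nat, forall k, (k0 <= k)%N ->
  \sum_(i < k) zbinom m i *: mode (mode u (l + i%:Z) v) (m + n - i%:Z) w =
  \sum_(i < k) ((-1) ^+ i * zbinom l i) *:
    (mode u (l + m - i%:Z) (mode v (n + i%:Z) w)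
     - (-1) ^ l *: mode v (l + n - i%:Z) (mode u (m + i%:Z) w)).
Proof.
have [k1 k1P] := mode_trunc u v.
have [k2 k2P] := mode_trunc u w.
have [k3 k3P] := mode_trunc v w.
exists (k1 + k2 + k3 + `|l| + `|m| + `|n|)%N => k Mk; have := voa_borcherds (voaP V) u v w l m n.
rewrite (@fsum_ord _ _ k); last first.
  by move=> i ki; rewrite k1P ?mode0l ?scaler0 //; lia.
rewrite (@fsum_ord _ _ k) // => i ki.
by rewrite k2P ?k3P ?mode0r ?scaler0 ?subr0 ?scaler0 //; lia.
Qed.

(** Case [l = 0]: [zbinom 0 i] leaves only the term [i = 0] on the right. *)
Lemma borcherds_commutator u v w m n : exists k0 : nat, forall k, (k0 <= k)%N ->
  mode u m (mode v n w) - mode v n (mode u m w) =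
  \sum_(i < k) zbinom m i *: mode (mode u i%:Z v) (m + n - i%:Z) w.
Proof.
have [k0 k0P] := borcherds u v w 0 m n; exists k0.+1 => k k0k.
have := k0P k (ltnW k0k); under eq_bigr do rewrite add0r.
move=> ->; case: k k0k => // k _; rewrite big_ord_recl big1 ?addr0.
  rewrite /= expr0 mul1r zbinom0 scale1r expr0z scale1r.
  by rewrite !add0r.
by move=> i _; rewrite zbinom0l mulr0 scale0r.
Qed.

(** Case [m = 0]: [zbinom 0 i] leaves only the term [i = 0] on the left. *)
Lemma borcherds_iterate u v w l n : exists k0 : nat, forall k, (k0 <= k)%N ->
  mode (mode u l v) n w = \sum_(i < k) ((-1) ^+ i * zbinom l i) *:
    (mode u (l - i%:Z) (mode v (n + i%:Z) w)
     - (-1) ^ l *: mode v (l + n - i%:Z) (mode u i%:Z w)).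
Proof.
have [k0 k0P] := borcherds u v w l 0 n; exists k0.+1 => k k0k.
have := k0P k (ltnW k0k).
under [X in _ = X -> _]eq_bigr do rewrite addr0 add0r.
move=> <-; case: k k0k => // k _; rewrite big_ord_recl big1 ?addr0.
  by rewrite /= zbinom0 scale1r ?add0r ?addr0 ?subr0.
by move=> i _; rewrite zbinom0l scale0r.
Qed.

End Modes.

(** * Formal series in several variables *)

Section Arrays.
Context {K : numFieldType} {V : lmodType K} {L : eqType}.
Implicit Types (n : L -> int) (i j a b : L) (l I : seq L) (U : set V).
Implicit Types (c : (L -> int) -> V) (al be : L -> K).

Definition upd (T : Type) (n : L -> T) i (x : T) : L -> T :=
  fun j => if j == i then x else n j.

Lemma upd_id (T : Type) (n : L -> T) i : upd n i (n i) = n.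
Proof. by apply/funext => j; rewrite /upd; case: eqP => [->|]. Qed.

Lemma updE (T : Type) (n : L -> T) i x : upd n i x i = x.
Proof. by rewrite /upd eqxx. Qed.

Lemma upd_neq (T : Type) (n : L -> T) i x j : j != i -> upd n i x j = n j.
Proof. by rewrite /upd => /negbTE ->. Qed.

Lemma updK (T : Type) (n : L -> T) i x y : upd (upd n i x) i y = upd n i y.
Proof. by apply/funext => j; rewrite /upd; case: eqP. Qed.

Lemma updC (T : Type) (n : L -> T) i j x y : i != j -> upd (upd n i x) j y = upd (upd n j y) i x.
Proof.
move=> ij; apply/funext => h; rewrite /upd; case: (eqVneq h j) => // ->.
by rewrite eq_sym (negbTE ij).
Qed.

(** The array [c] stands for the formal series [\sum_n c n z^(-n-1)]; the
    operator [\sum_i al i d/dz_i] acts on it, up to sign, as follows. *)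
Definition diffop al l c : (L -> int) -> V := fun n =>
  \sum_(i <- l) (al i * (n i)%:~R) *: c (upd n i (n i - 1)).

Lemma diffop_cons al i l c n : diffop al (i :: l) c n =
  (al i * (n i)%:~R) *: c (upd n i (n i - 1)) + diffop al l c n.
Proof. exact: big_cons. Qed.

(** Absence of negative powers: [z^(-n-1)] has a negative exponent exactly when [n >= 0]. *)
Definition regular l c := forall n i, i \in l -> 0 <= n i -> c n = 0.

(** The only index that could leave the range [n i >= 0] is [n i = 0], and there the factor [n i]
    vanishes. *)
Lemma diffop_regular al l l' c : regular l c -> regular l (diffop al l' c).
Proof.
move=> rc n i il ni; rewrite /diffop big1_seq // => j /andP[_ jl'].
have [->|ij] := eqVneq j i; last first.
  by rewrite (rc _ i) ?scaler0 // upd_neq // eq_sym.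
have [->|n0] := eqVneq (n i) 0; first by rewrite mulr0 scale0r.
by rewrite (rc _ i) ?scaler0 // updE; lia.
Qed.

Lemma diffop_sub U al l c : is_subspace U ->
  (forall n, U (c n)) -> forall n, U (diffop al l c n).
Proof.
move=> sU Uc n; rewrite /diffop; apply: subspace_sum => // i _; exact: (subspaceZ _ sU).
Qed.

Lemma diffop_comm al be l c :
  diffop al l (diffop be l c) = diffop be l (diffop al l c).
Proof.
apply/funext => n; rewrite /diffop.
under eq_bigr do rewrite scaler_sumr.
under [in RHS]eq_bigr do rewrite scaler_sumr.
rewrite exchange_big /=; apply: eq_bigr => j _; apply: eq_bigr => i _.
rewrite !scalerA; have [->|ij] := eqVneq i j.
  by congr (_ *: _); ring.
have ji : j != i by rewrite eq_sym.
rewrite !upd_neq // updC // ; congr (_ *: _); ring.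
Qed.

Lemma diffopD al be l c :
  diffop (fun i => al i + be i) l c = (fun n => diffop al l c n + diffop be l c n).
Proof.
apply/funext => n; rewrite /diffop -big_split; apply: eq_bigr => i _ /=.
by rewrite mulrDl scalerDl.
Qed.

Lemma diffopZ x al l c :
  diffop (fun i => x * al i) l c = (fun n => x *: diffop al l c n).
Proof.
apply/funext => n; rewrite /diffop scaler_sumr; apply: eq_bigr => i _.
by rewrite scalerA mulrA.
Qed.

Lemma diffop_addr al l c c' :
  diffop al l (fun n => c n + c' n) = (fun n => diffop al l c n + diffop al l c' n).
Proof.
apply/funext => n; rewrite /diffop -big_split; apply: eq_bigr => i _ /=.
by rewrite scalerDr.
Qed.

Lemma diffop_scaler al l x c :
  diffop al l (fun n => x *: c n) = (fun n => x *: diffop al l c n).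
Proof.
apply/funext => n; rewrite /diffop scaler_sumr; apply: eq_bigr => i _ /=.
by rewrite !scalerA mulrC.
Qed.

(** The direction [al] comes last: for fixed [U] and [c] the nilpotent directions form a linear
    subspace, which is what the closure lemmas below exploit. *)
Definition nilpotent U l c al :=
  exists r, forall n, U (iter r (diffop al l) c n).

Lemma iter_diffop_sub U al l c r : is_subspace U ->
  (forall n, U (c n)) -> forall n, U (iter r (diffop al l) c n).
Proof. by move=> sU Uc; elim: r => //= r; apply: diffop_sub. Qed.

Lemma iter_diffop_regular al l l' c r :
  regular l c -> regular l (iter r (diffop al l') c).
Proof. by move=> rc; elim: r => //= r; apply: diffop_regular. Qed.

Lemma iter_diffop_comm al be l c r s :
  iter r (diffop al l) (iter s (diffop be l) c) =
  iter s (diffop be l) (iter r (diffop al l) c).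
Proof.
have E d c' : diffop be l (iter d (diffop al l) c') =
    iter d (diffop al l) (diffop be l c').
  by elim: d => //= d <-; rewrite diffop_comm.
by elim: s => //= s <-; rewrite E.
Qed.

Lemma iter_diffop_addr al l c c' r :
  iter r (diffop al l) (fun n => c n + c' n) =
  (fun n => iter r (diffop al l) c n + iter r (diffop al l) c' n).
Proof. by elim: r => //= r ->; rewrite diffop_addr. Qed.

Lemma nilpotentD U l c al be : is_subspace U ->
  nilpotent U l c al -> nilpotent U l c be ->
  nilpotent U l c (fun i => al i + be i).
Proof.
move=> sU [r rP] [s sP]; exists (r + s)%N.
(* Binomial expansion of commuting operators: [k] factors are still to be expanded, and [p], [q]
   count the choices already made. At [k = 0] either [r <= p] or [s <= q]. *)
suff H k p q : (r + s <= p + q + k)%N -> forall n,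
    U (iter k (diffop (fun i => al i + be i) l)
        (iter p (diffop al l) (iter q (diffop be l) c)) n).
  exact: (H _ 0%N 0%N).
elim: k p q => [|k IHk] p q pqk.
  rewrite addn0 in pqk; have [rp|pr] := leqP r p.
    rewrite /= iter_diffop_comm -(subnK rp) iterD.
    by do 2 apply: iter_diffop_sub => //.
  have sq : (s <= q)%N by lia.
  by rewrite /= -(subnK sq) iterD; do 2 apply: iter_diffop_sub => //.
move=> n; rewrite iterSr diffopD iter_diffop_addr.
apply: (subspaceD sU); first by apply: (IHk p.+1 q); lia.
have -> : diffop be l (iter p (diffop al l) (iter q (diffop be l) c)) =
    iter p (diffop al l) (iter q.+1 (diffop be l) c).
  by rewrite (iter_diffop_comm al be l (iter q _ _) p 1).
by apply: (IHk p q.+1); lia.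
Qed.

Lemma nilpotentZ U l c al x : is_subspace U ->
  nilpotent U l c al -> nilpotent U l c (fun i => x * al i).
Proof.
move=> sU [r rP]; exists r.
suff -> : iter r (diffop (fun i => x * al i) l) c =
    (fun n => x ^+ r *: iter r (diffop al l) c n).
  by move=> n; apply: (subspaceZ _ sU).
elim: r {rP} => [|r IHr]; first by apply/funext => n; rewrite expr0 scale1r.
rewrite iterS IHr diffop_scaler diffopZ; apply/funext => n.
by rewrite scalerA exprSr.
Qed.

Lemma nilpotent_sum U l c (J : seq L) (al : L -> L -> K) : is_subspace U ->
  (forall j, j \in J -> nilpotent U l c (al j)) ->
  nilpotent U l c (fun i => \sum_(j <- J) al j i).
Proof.
move=> sU; elim: J => [|j J IHJ] nJ.
  exists 1%N => n; rewrite /= /diffop big1; first exact: (subspace0 sU).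
  move=> i _.
  by rewrite big_nil mul0r scale0r.
have -> : (fun i => \sum_(j0 <- j :: J) al j0 i) =
    (fun i => al j i + \sum_(j0 <- J) al j0 i).
  by apply/funext => i; rewrite big_cons.
apply: (nilpotentD sU); first by apply: nJ; rewrite mem_head.
by apply: IHJ => h hJ; apply: nJ; rewrite inE hJ orbT.
Qed.

Lemma eq_diffop al be l c : {in l, al =1 be} -> diffop al l c = diffop be l c.
Proof.
by move=> E; apply/funext => n; apply: eq_big_seq => i il; rewrite E.
Qed.

Lemma eq_nilpotent U l c al be : {in l, al =1 be} ->
  nilpotent U l c al -> nilpotent U l c be.
Proof.
move=> E [r rP]; exists r => n.
rewrite (_ : iter _ _ _ = iter r (diffop al l) c) //.
by elim: (r) => //= s ->; rewrite (eq_diffop _ E).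
Qed.

Definition indic I : L -> K := fun i => (i \in I)%:R.

Lemma diffop_indic l I c : uniq l -> uniq I -> {subset I <= l} ->
  diffop (indic I) l c = diffop (fun=> 1) I c.
Proof.
move=> ul uI Il; apply/funext => n; rewrite /diffop.
have -> : \sum_(i <- I) (1 * (n i)%:~R) *: c (upd n i (n i - 1)) =
    \sum_(i <- l | i \in I) (1 * (n i)%:~R) *: c (upd n i (n i - 1)).
  rewrite -[RHS]big_filter; apply: perm_big; apply: uniq_perm => //.
    exact: filter_uniq.
  by move=> i; rewrite mem_filter; case iI: (i \in I) => //=; rewrite Il.
rewrite [RHS]big_mkcond; apply: eq_bigr => i _; rewrite /indic.
by case: (i \in I) => //; rewrite mul0r scale0r.
Qed.

(** [fuse_op a b k c] is [(1 / k!) (d/dz_a)^k c] restricted to [z_a = z_b]. *)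
Definition fuse_op a b (k : nat) c : (L -> int) -> V := fun n =>
  \sum_(j < `|n b|) 'C(k + j, j)%:R *:
    c (upd (upd n a (- (k + j).+1%:Z)) b (n b + j%:Z)).

(** For [j >= |n b|] the index [n b + j] is nonnegative and regularity kills the term. A common
    length [J] allows values at neighbouring [n] to be compared. *)
Lemma fuse_op_widen a b k c n (J : nat) : regular [:: a; b] c ->
  (`|n b| <= J)%N -> fuse_op a b k c n =
  \sum_(j < J) 'C(k + j, j)%:R *:
    c (upd (upd n a (- (k + j).+1%:Z)) b (n b + j%:Z)).
Proof.
move=> rc nJ; rewrite /fuse_op.
rewrite (big_ord_widen J (fun j : nat => 'C(k + j, j)%:R *:
    c (upd (upd n a (- (k + j).+1%:Z)) b (n b + j%:Z)))) //.
rewrite [RHS](bigID (fun j : 'I_J => (j < `|n b|)%N)) /= [X in _ + X]big1 ?addr0 //.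
move=> j nj; rewrite (rc _ b) ?scaler0 ?inE ?eqxx ?orbT // updE; lia.
Qed.

(** Chain rule: on the diagonal [z_a = z_b] the operator [d/dz_a + d/dz_b] becomes [d/dz_b], and it
    commutes with the [k]-fold derivative in [z_a]. *)
Lemma fuse_op_diffop a b l k c n :
  a != b -> a \notin l -> b \notin l -> regular [:: a; b] c ->
  fuse_op a b k (diffop (fun=> 1) [:: a, b & l] c) n =
  diffop (fun=> 1) (b :: l) (fuse_op a b k c) n.
Proof.
move=> ab al bl rc.
have ba : b != a by rewrite eq_sym.
pose J := (`|n b|).+2.
rewrite (@fuse_op_widen _ _ _ _ _ J) //; last by rewrite /J; lia.
  2: exact: diffop_regular.
rewrite diffop_cons mul1r (@fuse_op_widen _ _ _ _ _ J) ?updE //; last by rewrite /J; lia.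
have -> : diffop (fun=> 1) l (fuse_op a b k c) n = \sum_(j < J) 'C(k + j, j)%:R *:
    diffop (fun=> 1) l c (upd (upd n a (- (k + j).+1%:Z)) b (n b + j%:Z)).
  rewrite /diffop; under [RHS]eq_bigr do rewrite scaler_sumr.
  rewrite exchange_big /=; apply: eq_big_seq => i il.
  have ia : i != a by apply: contraNneq al => <-.
  have ib : i != b by apply: contraNneq bl => <-.
  rewrite (@fuse_op_widen _ _ _ _ _ J) //; last first.
    by rewrite upd_neq 1?eq_sym // /J; lia.
  rewrite scaler_sumr; apply: eq_bigr => j _.
  rewrite !upd_neq // 1?eq_sym // !mul1r !scalerA mulrC; congr (_ *: c _).
  by rewrite [RHS]updC 1?eq_sym // [in RHS](updC n) // eq_sym.
under eq_bigr do rewrite 2!diffop_cons !mul1r addrA scalerDr.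
rewrite big_split /=; congr (_ + _).
have E (j : nat) : upd (upd n a (- (k + j).+1%:Z)) b (n b + j%:Z) b = n b + j%:Z.
  by rewrite updE.
have E' (j : nat) : upd (upd n a (- (k + j).+1%:Z)) b (n b + j%:Z) a = - (k + j).+1%:Z.
  by rewrite upd_neq // updE.
under eq_bigr do rewrite E E' !updK [upd (upd (upd _ _ _) _ _) a _]updC // updK.
pose F (j : nat) := c (upd (upd n a (- (k + j).+1%:Z)) b (n b - 1 + j%:Z)).
under [in RHS]eq_bigr do rewrite [upd (upd n b _) a _]updC // updK.
transitivity (\sum_(j < J) 'C(k + j, j)%:R *: ((- (k + j).+1%:Z)%:~R *: F j.+1
   + (n b + j%:Z)%:~R *: F j)).
  apply: eq_bigr => j _; congr (_ *: (_ *: c _ + _ *: c _)).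
    by congr (upd (upd _ _ _) _ _); lia.
  by congr (upd _ _ _); lia.
under [in LHS]eq_bigr do rewrite scalerDr.
have FJ : F J = 0 by rewrite /F (rc _ b) ?inE ?eqxx ?orbT // updE /J; lia.
(* The two sides differ, up to sign, by the telescoping sum of [G]; [(j + 1) C(k + j + 1, j + 1) =
   (k + j + 1) C(k + j, j)] matches the coefficients. *)
pose G (j : nat) := (j * 'C(k + j, j))%:R *: F j.
have GJ : \sum_(j < J) (G j.+1 - G j) = 0.
  rewrite -(big_mkord xpredT (fun j : nat => G j.+1 - G j)) telescope_sumr //.
  by rewrite /G FJ scaler0 mul0n scale0r subr0.
apply/eqP; rewrite -subr_eq0 scaler_sumr -sumrB -[X in _ == X]oppr0 -[in X in _ == X]GJ.
rewrite -sumrN; apply/eqP/eq_bigr => j _.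
rewrite /G addnS -mul_bin_diag /= !scalerA -/(F j).
rewrite opprB -addrA -scalerBl addrC -scaleNr; congr (_ *: _ + _ *: _); last first.
  by rewrite mulrNz mulrN -natrM mulnC.
rewrite intrD mulrDr natrM; ring.
Qed.

(** A power series is determined by its Taylor coefficients along the diagonal. With [n a = -k-1],
    the term [j = 0] of [fuse_op] is [c n], and the others have an index at [b] closer to zero,
    whence the induction on [|n b|]. *)
Lemma fuse_op_mem U a b c : is_subspace U -> a != b -> regular [:: a; b] c ->
  (forall k n, U (fuse_op a b k c n)) -> forall n, U (c n).
Proof.
move=> sU ab rc Uf n.
elim/ltn_ind: {n}(`|n b|%N) {-2}n (erefl `|n b|%N) => N IHN n nN.
have [nb|nb] := leP 0 (n b).
  by rewrite (rc _ b) ?inE ?eqxx ?orbT //; exact: (subspace0 sU).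
have [na|na] := leP 0 (n a).
  by rewrite (rc _ a) ?mem_head //; exact: (subspace0 sU).
have [k nk] : exists k : nat, n a = - k.+1%:Z by exists `|n a|.-1; lia.
have := Uf k n; rewrite /fuse_op; case: N nN IHN => [|N] nN IHN; first by lia.
rewrite nN big_ord_recl /= addn0 bin0 scale1r addr0.
rewrite -nk !upd_id; set S := \sum_(i < N) _ => US.
rewrite -[c n](addrK S); apply: (subspaceB sU) => //; rewrite /S.
apply: subspace_sum => // i _; apply: (subspaceZ _ sU).
set n' := upd _ _ _.
have n'b : n' b = n b + i.+1%:Z by rewrite /n' updE.
have [n'0|n'0] := leP 0 (n' b).
  by rewrite (rc _ b) ?inE ?eqxx ?orbT //; exact: (subspace0 sU).
by apply: (IHN `|n' b|%N) => //; lia.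
Qed.

End Arrays.

Arguments upd {L T} n i x _ : simpl never.

(** * Words in the fields and the fusion of labels *)

Section Words.
Context {R : realType} {V : voa R} {L : eqType}.
Local Notation K := (R[i]).
Implicit Types (n : L -> int) (i j a b : L) (l : seq L) (u : L -> V).

Definition apply_word u l n (y : V) : V :=
  foldr (fun i => mode (u i) (n i)) y l.

Lemma apply_word_is_linear u l n : linear (apply_word u l n).
Proof.
elim: l => [//|i l IHl] x y z.
by rewrite /apply_word /= -!/(apply_word u l n _) IHl linearP.
Qed.

HB.instance Definition _ u l n :=
  GRing.isLinear.Build K V V _ (apply_word u l n) (apply_word_is_linear u l n).

Lemma apply_word_cat u l l' n y :
  apply_word u (l ++ l') n y = apply_word u l n (apply_word u l' n y).
Proof. exact: foldr_cat. Qed.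

Lemma eq_apply_word u u' l n n' y :
  {in l, u =1 u'} -> {in l, n =1 n'} -> apply_word u l n y = apply_word u' l n' y.
Proof.
elim: l => [//|i l IHl] uu nn; rewrite /apply_word /= uu ?nn ?mem_head //.
congr (mode _ _ _); apply: IHl.
  by move=> j jl; apply: uu; rewrite inE jl orbT.
by move=> j jl; apply: nn; rewrite inE jl orbT.
Qed.

(** The term [Term x e u] stands for the formal series
    [x z^e Y(u_1, z_1) ... Y(u_r, z_r) 1], [z^e] being a monomial. *)
Record term := Term { coef : K; expo : L -> nat; vecs : L -> V }.
HB.instance Definition _ := gen_eqMixin term.
Implicit Types (t : term) (ts : seq term).

(** The coefficient of [z^(-n-1)] in [z^e Y(u, z)] is [u_(n+e)], hence the shift by the exponent. *)
Definition tval t l n : V :=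
  coef t *: apply_word (vecs t) l (fun i => n i + (expo t i)%:Z) vacuum.

Definition tsval ts l n : V := \sum_(t <- ts) tval t l n.

(** The coefficient of [(z_a - z_b)^k] in the operator product expansion: [z_a^e] is expanded around
    [z_b], and its part [(z_a - z_b)^i] selects the product [(u_a)_(i-k-1) u_b]. *)
Definition fuse_term (k : nat) a b t : seq term :=
  [seq Term (coef t * 'C(expo t a, i)%:R)
            (upd (expo t) b (expo t a + expo t b - i)%N)
            (upd (vecs t) b (mode (vecs t a) (i%:Z - k.+1%:Z) (vecs t b)))
  | i : nat <- iota 0 (expo t a).+1].

Definition fuse k a b ts := flatten (map (fuse_term k a b) ts).

(** Borcherds identity for [u_a] and [u_b] with [l = -k-1] and [m] the exponent at [a]. The first
    sum is the desired [fuse_op]; the second has nonnegative indices at [a] and will disappear by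
    regularity. *)
Lemma fuse_term_val (k : nat) a b l0 l1 t n : a != b ->
  a \notin l0 ++ l1 -> b \notin l0 ++ l1 ->
  exists J0 : nat, forall J, (J0 <= J)%N ->
  tsval (fuse_term k a b t) (l0 ++ b :: l1) n =
  \sum_(j < J) 'C(k + j, j)%:R *:
    tval t (l0 ++ [:: a, b & l1]) (upd (upd n a (- (k + j).+1%:Z)) b (n b + j%:Z))
  - (-1) ^ (- k.+1%:Z) *: \sum_(j < J) 'C(k + j, j)%:R *:
    tval t (l0 ++ [:: b, a & l1]) (upd (upd n a j%:Z) b (n b - (k + j).+1%:Z)).
Proof.
move=> ab al bl; case: t => x e u.
pose w := apply_word u l1 (fun i => n i + (e i)%:Z) vacuum.
have ba : b != a by rewrite eq_sym.
have [J0 HJ] := borcherds (u a) (u b) w (- k.+1%:Z) (e a)%:Z (n b + (e b)%:Z).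
exists (J0 + (e a).+1)%N => J J0J.
pose W := apply_word u l0 (fun i => n i + (e i)%:Z).
have out i : i \in l0 ++ l1 -> (i == a = false) * (i == b = false).
  by move=> il; split; apply/eqP => E; rewrite -?E il in al bl.
have outl i : i \in l0 -> (i == a = false) * (i == b = false).
  by move=> il; apply: out; rewrite mem_cat il.
have outr i : i \in l1 -> (i == a = false) * (i == b = false).
  by move=> il; apply: out; rewrite mem_cat il orbT.
have WE u' n' y : {in l0, u' =1 u} -> {in l0, n' =1 (fun i => n i + (e i)%:Z)} ->
    apply_word u' l0 n' y = W y.
  exact: eq_apply_word.
have wE u' n' : {in l1, u' =1 u} -> {in l1, n' =1 (fun i => n i + (e i)%:Z)} ->
    apply_word u' l1 n' vacuum = w.
  exact: eq_apply_word.
have -> : tsval (fuse_term k a b (Term x e u)) (l0 ++ b :: l1) n =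
   x *: W (\sum_(i < J) zbinom (e a)%:Z i *:
     mode (mode (u a) (- k.+1%:Z + i%:Z) (u b)) ((e a)%:Z + (n b + (e b)%:Z) - i%:Z) w).
  pose G (i : nat) := zbinom (e a)%:Z i *:
     mode (mode (u a) (- k.+1%:Z + i%:Z) (u b)) ((e a)%:Z + (n b + (e b)%:Z) - i%:Z) w.
  (* The upper entry of the binomial is the natural number [e a], so finitely many fused terms
     remain, independently of [J]. *)
  rewrite (@sum_ord_trunc _ G (e a).+1); [|by lia|]; last first.
    by move=> i ei; rewrite /G zbinom_nat bin_small // scale0r.
  rewrite /W linear_sum /= scaler_sumr -/W.
  rewrite /tsval /fuse_term big_map -[iota _ _]/(index_iota 0 (e a).+1) big_mkord.
  apply: eq_bigr => i _; rewrite /tval /= apply_word_cat WE; last 2 first.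
  - by move=> h hl; rewrite upd_neq // outl.
  - by move=> h hl; rewrite upd_neq // outl.
  rewrite [apply_word _ (b :: l1) _ _]/= -/(apply_word _ _ _ _) wE; last 2 first.
  - by move=> h hl; rewrite upd_neq // outr.
  - by move=> h hl; rewrite upd_neq // outr.
  rewrite !updE /G /W linearZ /= scalerA zbinom_nat -/W.
  congr (_ *: W _); have ie := ltn_ord i.
  by congr (mode (mode _ _ _) _ _); lia.
have tvalE a' b' X Y : (a', b') = (a, b) \/ (a', b') = (b, a) ->
    tval (Term x e u) (l0 ++ [:: a', b' & l1]) (upd (upd n a X) b Y) =
    x *: W (mode (u a') (upd (upd n a X) b Y a' + (e a')%:Z)
          (mode (u b') (upd (upd n a X) b Y b' + (e b')%:Z) w)).
  move=> _; rewrite /tval /= apply_word_cat WE //; last first.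
    by move=> h hl; rewrite !upd_neq // outl.
  rewrite /apply_word /= -/(apply_word _ _ _ _) wE // => h hl.
  by rewrite !upd_neq // outr.
rewrite HJ; last by lia.
rewrite /W linear_sum /= scaler_sumr -/W [(-1) ^ _ *: _]scaler_sumr -sumrB.
apply: eq_bigr => j _; rewrite zbinom_neg /W linearZ linearB linearZ /= -/W.
rewrite !tvalE; [|by right|by left].
rewrite !updE !(upd_neq _ _ ab) !updE.
have WZ r y : W (r *: y) = r *: W y by rewrite /W linearZ.
rewrite WZ !scalerBr !scalerA; congr (_ *: W _ - _ *: W _).
- by congr (mode _ _ (mode _ _ _)); lia.
- by ring.
- by congr (mode _ _ (mode _ _ _)); lia.
Qed.

(** Regularity holds for the whole sum over [ts], not for single terms. The truncation bounds of all
    terms are therefore merged into one [J] before the sums are exchanged. *)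
Lemma fuse_val (k : nat) a b ts l0 l1 n : uniq (l0 ++ [:: a, b & l1]) ->
  regular [:: a; b] (tsval ts (l0 ++ [:: a, b & l1])) ->
  regular [:: a] (tsval ts (l0 ++ [:: b, a & l1])) ->
  tsval (fuse k a b ts) (l0 ++ b :: l1) n =
  fuse_op a b k (tsval ts (l0 ++ [:: a, b & l1])) n.
Proof.
rewrite uniq_catC /= inE mem_cat !negb_or => /and3P[/and3P[ab al1 al0] bl _].
move=> rab ra.
have [al bl'] : a \notin l0 ++ l1 /\ b \notin l0 ++ l1.
  by move: bl; rewrite !mem_cat !negb_or al0 al1 => /andP[-> ->].
pose J0 t := projT1 (cid (@fuse_term_val k a b l0 l1 t n ab al bl')).
pose J := (\sum_(t <- ts) J0 t + `|n b|)%N.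
have JP t : t \in ts -> (J0 t <= J)%N.
  by move=> tts; rewrite /J (big_rem t) //= -!addnA leq_addr.
rewrite (@fuse_op_widen _ _ _ _ _ _ _ _ J) //; last by rewrite /J leq_addl.
rewrite /tsval /fuse big_flatten big_map /=.
pose F t := \sum_(j < J) 'C(k + j, j)%:R *:
    tval t (l0 ++ [:: a, b & l1]) (upd (upd n a (- (k + j).+1%:Z)) b (n b + j%:Z)).
pose G t := \sum_(j < J) 'C(k + j, j)%:R *:
    tval t (l0 ++ [:: b, a & l1]) (upd (upd n a j%:Z) b (n b - (k + j).+1%:Z)).
transitivity (\sum_(t <- ts) (F t - (-1) ^ (- k.+1%:Z) *: G t)).
  apply: eq_big_seq => t tts.
  exact: (projT2 (cid (@fuse_term_val k a b l0 l1 t n ab al bl')) J (JP t tts)).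
rewrite sumrB -scaler_sumr [X in _ *: X](_ : _ = 0) ?scaler0 ?subr0.
  rewrite exchange_big /=; apply: eq_bigr => j _; by rewrite scaler_sumr.
rewrite exchange_big /= big1 // => j _; rewrite -scaler_sumr.
rewrite -/(tsval ts (l0 ++ [:: b, a & l1]) _) (ra _ a) ?scaler0 ?mem_head //.
by rewrite upd_neq // updE.
Qed.

(** Mutual locality of the fields makes the order of the labels irrelevant, and
    creation removes the negative powers of the variables. *)
Definition sys l ts := (forall l', perm_eq l' l -> tsval ts l' = tsval ts l)
  /\ regular l (tsval ts l).

(** Every arrangement of [b :: l] arises by fusing an arrangement in which [a] immediately precedes
    [b]; all of these have the same array. *)
Lemma sys_fuse (k : nat) a b l ts : uniq [:: a, b & l] -> sys [:: a, b & l] ts ->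
  sys (b :: l) (fuse k a b ts) /\
  tsval (fuse k a b ts) (b :: l) = fuse_op a b k (tsval ts [:: a, b & l]).
Proof.
move=> uabl [sperm sreg].
have [/andP[anb al] ubl] : (a != b) && (a \notin l) /\ uniq (b :: l).
  by move: uabl; rewrite /= inE negb_or -andbA => /and3P[-> -> ->].
have H l' : perm_eq l' (b :: l) ->
    tsval (fuse k a b ts) l' = fuse_op a b k (tsval ts [:: a, b & l]).
  move=> pl'; have bl' : b \in l' by rewrite (perm_mem pl') mem_head.
  case/splitPr: l' / bl' pl' => l0 l1 pl'.
  have pab : perm_eq (l0 ++ [:: a, b & l1]) [:: a, b & l].
    by rewrite perm_catC /= perm_cons -cat_cons perm_catC.
  have pba : perm_eq (l0 ++ [:: b, a & l1]) [:: a, b & l].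
    apply: perm_trans pab; rewrite perm_cat2l.
    by rewrite -[[:: b, a & l1]]/([:: b; a] ++ l1) perm_catC -[[:: a, b & l1]]/([:: a; b] ++ l1) perm_sym perm_catC perm_cat2l; apply/permP => p /=; lia.
  apply/funext => n; rewrite fuse_val ?sperm //.
  - by rewrite (perm_uniq pab).
  - by move=> m i; rewrite !inE => /orP[]/eqP ->; apply: sreg; rewrite !inE eqxx ?orbT.
  - by move=> m i; rewrite !inE => /eqP ->; apply: sreg; rewrite !inE eqxx.
split; last by apply: H.
split=> [l' pl'|]; first by rewrite !H.
rewrite H // => n i il ni; rewrite /fuse_op big1 // => j _.
rewrite (sreg _ i) ?scaler0 //; first by rewrite inE il orbT.
have [E|ib] := eqVneq i b; first by move: ni; rewrite E updE; lia.
rewrite !upd_neq //; apply: contraTneq il => ->.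
by rewrite inE negb_or anb.
Qed.

Context {sigma : voa_aut V}.

Lemma iter_fuse_diffop a b l (k r : nat) (c : (L -> int) -> V) :
  a != b -> a \notin l -> b \notin l -> regular [:: a; b] c ->
  fuse_op a b k (iter r (diffop (fun=> 1 : K) [:: a, b & l]) c) =
  iter r (diffop (fun=> 1) (b :: l)) (fuse_op a b k c).
Proof.
move=> ab al bl rc; elim: r => //= r IHr; rewrite -IHr.
apply/funext => n; rewrite fuse_op_diffop //.
exact: iter_diffop_regular.
Qed.

Lemma sigma_word u (chi : L -> K) l n :
  (forall i, i \in l -> sigma (u i) = chi i *: u i) ->
  sigma (apply_word u l n vacuum) =
  (\prod_(i <- l) chi i) *: apply_word u l n vacuum.
Proof.
elim: l => [|i l IHl] ul; first by rewrite big_nil scale1r /= aut_vacuum.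
rewrite big_cons /apply_word /= aut_mode -!/(apply_word u l n vacuum) IHl.
  by rewrite ul ?mem_head // modeZl linearZ scalerA.
by move=> j jl; apply: ul; rewrite inE jl orbT.
Qed.

Lemma iter_diffop1 a (c : (L -> int) -> V) n (r : nat) :
  iter r (diffop (fun=> 1 : K) [:: a]) c n =
  (\prod_(q < r) (n a - q%:Z))%:~R *: c (upd n a (n a - r%:Z)).
Proof.
elim: r n => [|r IHr] n; first by rewrite big_ord0 scale1r subr0 upd_id.
rewrite iterS {1}/diffop big_seq1 mul1r IHr scalerA big_ord_recl subr0 intrM.
rewrite updE updK; congr (_ *: c (upd _ _ _)); last by lia.
by congr (_ * _%:~R); apply: eq_bigr => q _; rewrite /= /bump /=; lia.
Qed.

(** The fields of [I] are fused one after the other, until a single field of a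
    vector fixed by [sigma] remains. *)
Theorem sys_nilpotent (U : set V) I J ts (chi : L -> K) (mu : K) (E : nat) :
  is_subspace U ->
  (forall x (n : int) y, sigma x = x -> sigma y = mu *: y ->
     n <= -2 -> U (mode x n y)) ->
  I != [::] -> uniq (I ++ J) -> sys (I ++ J) ts ->
  (forall t i, t \in ts -> i \in I ++ J -> sigma (vecs t i) = chi i *: vecs t i) ->
  \prod_(i <- I) chi i = 1 -> \prod_(i <- J) chi i = mu ->
  (forall t, t \in ts -> (\sum_(i <- I) expo t i <= E)%N) ->
  forall n, U (iter E.+1 (diffop (fun=> 1) I) (tsval ts (I ++ J)) n).
Proof.
move=> sU HU; elim: I ts chi => // a [|b I] IHI ts chi _ uIJ sts eigen prod1 prodJ expE.
  have chia : chi a = 1 by move: prod1; rewrite big_seq1.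
  move=> n; have [na|na] := leP 0 (n a).
    rewrite (iter_diffop_regular _ _ _ sts.2 (i := a)) ?mem_head //.
    exact: (subspace0 sU).
  rewrite iter_diffop1; apply: (subspaceZ _ sU).
  rewrite /tsval; apply: (subspace_sum_seq sU) => t tts.
  rewrite /tval; apply: (subspaceZ _ sU); rewrite /apply_word /= -/(apply_word _ _ _ _).
  apply: HU.
  - by rewrite eigen ?mem_head // chia scale1r.
  - rewrite -prodJ; apply: sigma_word => i iJ.
    by apply: eigen => //; rewrite inE iJ orbT.
  (* Here [n a <= -1] and the exponent is at most [E], so the index after [E + 1] derivatives is at
     most [-1 - (E + 1) + E = -2]. *)
  - by have := expE t tts; rewrite big_seq1 updE; lia.
have [sIJ sreg] := sts.
have uab : uniq [:: a, b & I ++ J] by [].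
have [ab [aI bI]] : a != b /\ a \notin I /\ b \notin I.
  move: uIJ; rewrite /= !inE !mem_cat !negb_or -!andbA.
  by move=> /and5P[-> -> _ ->].
have rab : regular [:: a; b] (tsval ts ((a :: b :: I) ++ J)).
  by move=> m i; rewrite !inE => /orP[]/eqP ->; apply: sreg; rewrite !inE eqxx ?orbT.
apply: (fuse_op_mem sU ab); first exact: iter_diffop_regular.
move=> k n; rewrite iter_fuse_diffop //.
have [sf fE] := sys_fuse k uab sts.
rewrite -fE; apply: (IHI _ (upd chi b (chi a * chi b))) => //.
- by have /andP[] := uab.
- move=> t i /flatten_mapP[t0 t0s /mapP[m _ ->]] /= ibIJ.
  have bIJ : b \notin I ++ J by move: uIJ => /= /and3P[].
  have aIJ : a \notin b :: I ++ J by move: uIJ => /= /andP[].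
  have [->|ib] := eqVneq i b.
    rewrite !updE aut_mode !eigen ?inE ?eqxx ?orbT //.
    by rewrite modeZl linearZ scalerA.
  by rewrite !upd_neq // eigen // inE ibIJ orbT.
- apply: etrans prod1; rewrite !big_cons updE mulrA; congr (_ * _).
  by apply: eq_big_seq => i iI; rewrite upd_neq //; apply: contraNneq bI => <-.
- rewrite -prodJ; apply: eq_big_seq => i iJ; rewrite upd_neq //.
  by apply: contraTneq iJ => ->; move: uIJ; rewrite /= !mem_cat !negb_or => /and3P[_ /andP[]].
(* The exponents at [a] and [b] are replaced by their sum minus [m]: the bound [E] survives for
   every [k]. *)
- move=> t /flatten_mapP[t0 t0s /mapP[m _ ->]] /=.
  rewrite big_cons updE; apply: leq_trans (expE _ t0s).
  rewrite !big_cons (eq_big_seq (expo t0)); last first.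
    by move=> i iI; rewrite upd_neq //; apply: contraNneq bI => <-.
  by rewrite addnA leq_add2r leq_subr.
Qed.

End Words.

(** * Locality and multiplication by powers of [z_i - z_j] *)

Section Locality.
Context {R : realType} {V : voa R}.
Implicit Types (u v w : V) (m n : int).

(** The coefficient of [x^(-m-1) y^(-n-1)] in [(x - y)^k [Y(u, x), Y(v, y)] w]. *)
Fixpoint dcomm u v (k : nat) m n w : V :=
  if k is k'.+1 then dcomm u v k' (m + 1) n w - dcomm u v k' m (n + 1) w
  else mode u m (mode v n w) - mode v n (mode u m w).

Lemma dcommE u v k m n w : exists J0 : nat, forall J, (J0 <= J)%N ->
  dcomm u v k m n w =
  \sum_(i < J) zbinom m i *: mode (mode u (k%:Z + i%:Z) v) (m + n - i%:Z) w.
Proof.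
elim: k m n => [|k IHk] m n.
  have [J0 H] := borcherds_commutator u v w m n; exists J0 => J /H /= ->.
  by apply: eq_bigr => i _; rewrite add0r.
have [J1 H1] := IHk (m + 1) n; have [J2 H2] := IHk m (n + 1).
exists (J1 + J2)%N => J J12; rewrite /= (H1 J.+1) ?(H2 J.+1); try lia.
rewrite -sumrB big_ord_recl !zbinom0 /=.
rewrite (_ : m + 1 + n = m + (n + 1)) ?subrr ?add0r; last by lia.
apply: eq_bigr => i _; rewrite -scalerBl /bump leq0n add1n zbinom_pascal.
rewrite addrC addKr; congr (_ *: mode (mode _ _ _) _ _); lia.
Qed.

Lemma dcomm_eq0 u v k m n w : (forall h : int, k%:Z <= h -> mode u h v = 0) ->
  dcomm u v k m n w = 0.
Proof.
move=> uv0; have [J H] := dcommE u v k m n w; rewrite (H J) //.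
by rewrite big1 // => i _; rewrite uv0 ?mode0l ?scaler0 //; lia.
Qed.

End Locality.

Section Delta.
Context {R : realType} {V : voa R} {L : eqType}.
Local Notation K := (R[i]).
Local Notation term := (@term R V L).
Implicit Types (n : L -> int) (i j a b : L) (l : seq L) (u : L -> V).
Implicit Types (t : term) (ts : seq term).

Definition mul_term i j t : seq term :=
  [:: Term (coef t) (upd (expo t) i (expo t i).+1) (vecs t);
      Term (- coef t) (upd (expo t) j (expo t j).+1) (vecs t)].

(** multiplication by [z_i - z_j] *)
Definition mul_diff i j ts := flatten (map (mul_term i j) ts).

Lemma upd_expoE (n : L -> int) (e : L -> nat) i :
  (fun h => n h + (upd e i (e i).+1 h)%:Z) =
  (fun h => upd n i (n i + 1) h + (e h)%:Z).
Proof.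
apply/funext => h; have [->|hi] := eqVneq h i; last by rewrite !upd_neq.
by rewrite !updE; lia.
Qed.

Lemma mul_diff_val i j ts l n : tsval (mul_diff i j ts) l n =
  tsval ts l (upd n i (n i + 1)) - tsval ts l (upd n j (n j + 1)).
Proof.
rewrite /tsval /mul_diff big_flatten big_map -sumrB; apply: eq_bigr => t _.
rewrite /mul_term big_cons big_seq1 /tval /= !upd_expoE.
by rewrite scaleNr.
Qed.

Definition all_vecs u ts := forall t, t \in ts -> vecs t = u.

Lemma all_vecs_mul u i j ts : all_vecs u ts -> all_vecs u (mul_diff i j ts).
Proof.
move=> uts t /flatten_mapP[t0 /uts <-].
by rewrite !inE => /orP[]/eqP ->.
Qed.

Definition local_at a b l ts := forall l0 l1,
  perm_eq (l0 ++ [:: a, b & l1]) l ->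
  tsval ts (l0 ++ [:: a, b & l1]) = tsval ts (l0 ++ [:: b, a & l1]).

Lemma local_at_mul a b l i j ts :
  local_at a b l ts -> local_at a b l (mul_diff i j ts).
Proof.
by move=> H l0 l1 pl; apply/funext => n; rewrite !mul_diff_val (H _ _ pl).
Qed.

Lemma local_at_mul_iter a b l i j ts k :
  local_at a b l ts -> local_at a b l (iter k (mul_diff i j) ts).
Proof. by move=> H; elim: k => //= k; apply: local_at_mul. Qed.

Lemma local_at_sym a b l ts : local_at a b l ts -> local_at b a l ts.
Proof.
move=> H l0 l1 pl; rewrite H //; apply: perm_trans pl; rewrite perm_cat2l.
by apply/permP => x /=; lia.
Qed.

Lemma mul_diff_comm u a b ts l0 l1 n k : all_vecs u ts ->
  a != b -> a \notin l0 ++ l1 -> b \notin l0 ++ l1 ->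
  tsval (iter k (mul_diff a b) ts) (l0 ++ [:: a, b & l1]) n -
  tsval (iter k (mul_diff a b) ts) (l0 ++ [:: b, a & l1]) n =
  \sum_(t <- ts) coef t *: apply_word u l0 (fun i => n i + (expo t i)%:Z)
    (dcomm (u a) (u b) k (n a + (expo t a)%:Z) (n b + (expo t b)%:Z)
      (apply_word u l1 (fun i => n i + (expo t i)%:Z) vacuum)).
Proof.
move=> uts ab al bl; elim: k n => [|k IHk] n.
  rewrite /tsval -sumrB; apply: eq_big_seq => t tts.
  by rewrite /tval uts // !apply_word_cat /= -scalerBr -linearB.
have ba : b != a by rewrite eq_sym.
have out i : i \in l0 ++ l1 -> (i != a) * (i != b).
  by move=> il; split; apply: contraTneq il => ->.
have [outl outr] : (forall i, i \in l0 -> (i != a) * (i != b)) /\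
    (forall i, i \in l1 -> (i != a) * (i != b)).
  by split=> i il; apply: out; rewrite mem_cat il ?orbT.
have E (x1 x2 y1 y2 : V) : x1 - x2 - (y1 - y2) = x1 - y1 - (x2 - y2).
  by rewrite !opprD !opprK addrACA.
rewrite iterS !mul_diff_val E !IHk -sumrB; apply: eq_bigr => t _.
rewrite -scalerBr; congr (_ *: _).
pose W := apply_word u l0 (fun i => n i + (expo t i)%:Z).
pose w := apply_word u l1 (fun i => n i + (expo t i)%:Z) vacuum.
have WE n' y : {in l0, n' =1 n} ->
    apply_word u l0 (fun i => n' i + (expo t i)%:Z) y = W y.
  by move=> nn'; apply: eq_apply_word => // i il; rewrite nn'.
have wE n' : {in l1, n' =1 n} ->
    apply_word u l1 (fun i => n' i + (expo t i)%:Z) vacuum = w.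
  by move=> nn'; apply: eq_apply_word => // i il; rewrite nn'.
rewrite !WE ?wE //;
  try by move=> i il; rewrite upd_neq //; (case: (outl i il) || case: (outr i il)).
rewrite !updE !upd_neq // /W -linearB /=; congr (apply_word _ _ _ (_ - _)).
  by congr (dcomm _ _ _ _ _ _); lia.
  by congr (dcomm _ _ _ _ _ _); lia.
Qed.

Lemma local_at_iter u a b l ts k : uniq l -> all_vecs u ts ->
  (forall h : int, k%:Z <= h -> mode (u a) h (u b) = 0) ->
  local_at a b l (iter k (mul_diff a b) ts).
Proof.
move=> ul uts uab0 l0 l1 pl; apply/funext => n.
have : uniq (l0 ++ [:: a, b & l1]) by rewrite (perm_uniq pl).
rewrite uniq_catC /= inE mem_cat !negb_or => /and3P[/and3P[ab al1 al0] bl _].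
apply/eqP; rewrite -subr_eq0 (@mul_diff_comm u) //.
- by rewrite big1 // => t _; rewrite dcomm_eq0 // linear0 scaler0.
- by rewrite mem_cat negb_or al0.
- by move: bl; rewrite !mem_cat orbC.
Qed.

Fixpoint ordered_pairs l : seq (L * L) :=
  if l is i :: l' then map (pair i) l' ++ ordered_pairs l' else [::].

(** Over [ordered_pairs l] this is multiplication by the [k]-th power of the Vandermonde product, up
    to sign. *)
Definition delta (k : nat) (ps : seq (L * L)) ts :=
  foldr (fun p => iter k (mul_diff p.1 p.2)) ts ps.

Lemma ordered_pairs_mem l a b : a \in l -> b \in l -> a != b ->
  ((a, b) \in ordered_pairs l) || ((b, a) \in ordered_pairs l).
Proof.
elim: l => // i l IHl; rewrite !inE /= !mem_cat.
have mp (j h : L) : ((j, h) \in map (pair i) l) = (j == i) && (h \in l).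
  apply/mapP/andP => [[h' hl [-> ->]]|[/eqP -> hl]]; first by rewrite eqxx.
  by exists h.
rewrite !mp; have [->|ai] := eqVneq a i; have [->|bi] := eqVneq b i => //=.
- by move=> _ ->.
- by move=> -> _ _; rewrite orbT.
Qed.

Lemma all_vecs_iter u i j ts k : all_vecs u ts -> all_vecs u (iter k (mul_diff i j) ts).
Proof. by move=> uts; elim: k => //= k; apply: all_vecs_mul. Qed.

Lemma all_vecs_delta u k ps ts : all_vecs u ts -> all_vecs u (delta k ps ts).
Proof. by move=> uts; elim: ps => //= p ps; apply: all_vecs_iter. Qed.

Lemma local_at_delta u a b l ts k : uniq l -> all_vecs u ts ->
  (forall i j (h : int), i \in l -> j \in l -> k%:Z <= h -> mode (u i) h (u j) = 0) ->
  a \in l -> b \in l -> a != b -> local_at a b l (delta k (ordered_pairs l) ts).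
Proof.
move=> ul uts u0 al bl ab.
have H ps c d : c \in l -> d \in l -> (c, d) \in ps -> local_at c d l (delta k ps ts).
  move=> cl dl; elim: ps => // p ps IHps; rewrite inE => /orP[/eqP <-|cdps] /=.
    apply: (@local_at_iter u) => //; first exact: all_vecs_delta.
    by move=> h; apply: u0.
  by apply: local_at_mul_iter; apply: IHps.
by have /orP[/H|/H] := ordered_pairs_mem al bl ab; [apply|move=> /(_ bl al)/local_at_sym].
Qed.

(** Adjacent transpositions generate all permutations; [front] carries one letter leftwards to its
    place. *)
Lemma perm_invariant (X : Type) (f : seq L -> X) l :
  (forall l0 a b l1, perm_eq (l0 ++ [:: a, b & l1]) l ->
     f (l0 ++ [:: a, b & l1]) = f (l0 ++ [:: b, a & l1])) ->
  forall l', perm_eq l' l -> f l' = f l.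
Proof.
move=> fswap.
have front l0 l1 x l2 : perm_eq (l0 ++ l1 ++ x :: l2) l ->
    f (l0 ++ l1 ++ x :: l2) = f (l0 ++ x :: l1 ++ l2).
  elim/last_ind: l1 l2 => // l1 y IHl1 l2; rewrite !cat_rcons => pl.
  have := fswap (l0 ++ l1) y x l2; rewrite -!catA => -> //.
  apply: IHl1; apply: perm_trans pl; rewrite !perm_cat2l.
  by apply/permP => p /=; lia.
have H s l0 s' : perm_eq s s' -> perm_eq (l0 ++ s') l -> f (l0 ++ s') = f (l0 ++ s).
  elim: s l0 s' => [|x s IHs] l0 s' ss' pl.
    by move: ss'; rewrite perm_sym => /perm_nilP ->.
  have xs' : x \in s' by rewrite -(perm_mem ss') mem_head.
  case/splitPr: s' / xs' ss' pl => s1 s2 ss' pl.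
  rewrite front // -!cat_rcons; apply: IHs.
    move: ss'; rewrite perm_sym perm_catC /= perm_cons perm_catC perm_sym.
    by [].
  apply: perm_trans pl; rewrite cat_rcons perm_cat2l perm_sym perm_catC /=.
  by rewrite perm_cons perm_catC.
by move=> l' pl'; apply: (H l [::]) => //; rewrite perm_sym.
Qed.

Lemma sys_delta u l k : uniq l ->
  (forall i j (h : int), i \in l -> j \in l -> k%:Z <= h -> mode (u i) h (u j) = 0) ->
  sys l (delta k (ordered_pairs l) [:: Term 1 (fun=> 0%N) u]).
Proof.
move=> ul u0; set ts := delta _ _ _.
have uts1 : all_vecs u [:: Term 1 (fun=> 0%N) u] by move=> t; rewrite inE => /eqP ->.
have uts : all_vecs u ts by apply: all_vecs_delta.
have pi l' : perm_eq l' l -> tsval ts l' = tsval ts l.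
  apply: (@perm_invariant _ (tsval ts)) => l0 a b l1 pl.
  have ul' : uniq (l0 ++ [:: a, b & l1]) by rewrite (perm_uniq pl).
  apply: (@local_at_delta u a b l _ k) => //.
  - by rewrite -(perm_mem pl) mem_cat mem_head orbT.
  - by rewrite -(perm_mem pl) mem_cat !inE eqxx !orbT.
  - by move: ul'; rewrite uniq_catC /= inE negb_or => /andP[/andP[]].
split=> // n i il ni.
(* By symmetry [i] may be the last label; its field then acts on the vacuum, where modes of
   nonnegative index vanish. *)
rewrite -(pi (rcons (rem i l) i)); last first.
  by rewrite perm_rcons perm_sym perm_to_rem.
rewrite /tsval big_seq big1 // => t tts; rewrite /tval -cats1 apply_word_cat /=.
by rewrite mode_creation_ge0 ?linear0 ?scaler0 // addr_ge0.
Qed.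

End Delta.

(** * Finiteness of words in given vectors *)

Section Finiteness.
Context {R : realType} {V : voa R} {L : eqType} {sigma : voa_aut V}.
Local Notation K := (R[i]).
Local Notation term := (@term R V L).
Implicit Types (n : L -> int) (i j a b : L) (l I J : seq L) (u : L -> V).
Implicit Types (t : term) (ts : seq term) (chi : L -> K) (mu : K) (U : set V).

Lemma sys_perm l l' ts : perm_eq l' l -> sys l ts -> sys l' ts.
Proof.
move=> pl [H rl]; split=> [l2 pl2|]; first by rewrite !H //; apply: perm_trans pl.
by move=> n i il; rewrite H //; apply: rl; rewrite -(perm_mem pl).
Qed.

(** What the argument uses of [C_2] of the [T]-module [V^mu], apart from its being a subspace. *)
Definition absorbing mu U := forall x (n : int) y,
  sigma x = x -> sigma y = mu *: y -> n <= -2 -> U (mode x n y).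

Lemma zero_sum_nilpotent U l I ts chi mu :
  is_subspace U -> absorbing mu U -> uniq l -> sys l ts ->
  (forall t i, t \in ts -> i \in l -> sigma (vecs t i) = chi i *: vecs t i) ->
  I != [::] -> uniq I -> {subset I <= l} ->
  \prod_(i <- I) chi i = 1 -> \prod_(i <- l) chi i = mu ->
  nilpotent U l (tsval ts l) (indic I).
Proof.
move=> sU HU ul sl eigen I0 uI Il prod1 prodl.
pose J := [seq i <- l | i \notin I].
have pl : perm_eq (I ++ J) l.
  apply: uniq_perm => //.
    rewrite cat_uniq uI filter_uniq // andbT; apply/hasPn => i.
    by rewrite mem_filter => /andP[].
  move=> i; rewrite mem_cat mem_filter; case iI: (i \in I) => //=.
  by rewrite Il.
pose E := (\sum_(t <- ts) \sum_(i <- I) expo t i)%N.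
exists E.+1 => n; rewrite (_ : diffop (indic I) l = diffop (fun=> 1) I); last first.
  by apply/funext => c; apply: diffop_indic.
rewrite -(sl.1 _ pl); apply: (@sys_nilpotent _ _ _ sigma _ _ _ _ chi mu) => //.
- by rewrite (perm_uniq pl).
- exact: sys_perm sl.
- by move=> t i tts; rewrite (perm_mem pl); apply: eigen.
- rewrite -prodl -(perm_big _ pl) big_cat /= prod1 mul1r //.
- by move=> t tts; rewrite /E (big_rem t) //= leq_addr.
Qed.

(** The indicator of [i], times [size I], is the indicator of [I] plus the sum over [q] in [I] of
    those of [{i, j}] minus [{q, j}]. All these sets have product [1], and [size I] is
    invertible. *)
Lemma single_nilpotent U l i j I ts chi mu x :
  is_subspace U -> absorbing mu U -> uniq l -> sys l ts ->
  (forall t i, t \in ts -> i \in l -> sigma (vecs t i) = chi i *: vecs t i) ->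
  \prod_(i <- l) chi i = mu ->
  I != [::] -> uniq I -> {subset I <= l} -> i \in l -> j \in l ->
  j \notin I -> j != i -> chi i = x -> {in I, forall h, chi h = x} ->
  chi j * x = 1 -> x ^+ (size I) = 1 ->
  nilpotent U l (tsval ts l) (indic [:: i]).
Proof.
move=> sU HU ul sl eigen prodl I0 uI Il il jl jI ji chii chiI chij xp.
have zs := @zero_sum_nilpotent U l _ ts chi mu sU HU ul sl eigen.
have pair h : h \in l -> j != h -> chi h = x ->
    nilpotent U l (tsval ts l) (indic [:: h; j]).
  move=> hl jh chih; apply: zs => //; first by rewrite /= inE eq_sym jh.
    by move=> q; rewrite !inE => /orP[]/eqP ->.
  by rewrite big_cons big_seq1 chih mulrC.
have p0 : ((size I)%:R : K) != 0 by rewrite pnatr_eq0 size_eq0.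
pose al h := (size I)%:R^-1 * (indic I h +
  \sum_(q <- I) (indic [:: i; j] h + (-1) * indic [:: q; j] h)) : K.
apply: (@eq_nilpotent _ _ _ _ _ _ al).
  move=> h hl; rewrite /al /indic.
  rewrite (eq_big_seq (fun q => (h == i)%:R - (h == q)%:R)); last first.
    move=> q qI; have jq : j != q by apply: contraNneq jI => ->.
    rewrite !inE; have [->|hi] := eqVneq h i; have [E|hq] := eqVneq _ q.
    - by subst q; rewrite /= mulN1r.
    - by rewrite eq_sym in ji; rewrite /= (negbTE ji) /= mulN1r.
    - by rewrite E eq_sym in jq *; rewrite (negbTE jq) /= mulN1r.
    - by rewrite /= mulN1r subrr addrN.
  rewrite sumrB big_const_seq count_predT iter_addr_0.
  have -> : \sum_(q <- I) (h == q)%:R = (h \in I)%:R :> K.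
    case hI: (h \in I); last first.
      by rewrite big_seq big1 // => q qI; case: eqP => // E; rewrite E qI in hI.
    rewrite (big_rem h) //= eqxx big_seq big1 ?addr0 // => q.
    by rewrite mem_rem_uniq // !inE eq_sym => /andP[/negbTE ->].
  rewrite addrC subrK mulrnAr -mulrnAl -[_^-1 *+ _]mulr_natr mulVf // mul1r.
  by rewrite inE.
apply: nilpotentZ => //; apply: nilpotentD => //.
  apply: zs => //; rewrite (eq_big_seq (fun=> x)) // big_const_seq count_predT.
  by rewrite -[RHS]xp -Monoid.iteropE.
apply: nilpotent_sum => // q qI; apply: nilpotentD => //.
  by apply: pair.
apply: nilpotentZ => //; apply: pair; rewrite ?Il ?chiI //.
by apply: contraNneq jI => ->.
Qed.

Lemma nilpotent_far U l i (c : (L -> int) -> V) :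
  is_subspace U -> uniq l -> i \in l -> nilpotent U l c (indic [:: i]) ->
  exists r : nat, forall n, n i < - r%:Z -> U (c n).
Proof.
move=> sU ul il [r rP]; exists r => n nr.
have := rP (upd n i (n i + r%:Z)).
rewrite (_ : diffop _ l = diffop (fun=> 1) [:: i]); last first.
  apply/funext => c'; apply: diffop_indic => //.
  by move=> q; rewrite inE => /eqP ->.
rewrite iter_diffop1 updE updK addrK upd_id.
(* The starting index [n i + r] is negative, so no factor of the product vanishes. *)
set x := (_)%:~R; have x0 : x != 0.
  rewrite intr_eq0; apply/prodf_neq0 => q _; have := ltn_ord q; lia.
by move=> /(subspaceZ x^-1 sU); rewrite scalerA mulVf // scale1r.
Qed.

(** Only indices in the box [-r <= n i < 0] can give values outside [U], and it is finite since [c]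
    depends only on the indices in [l]. One coordinate is fixed at a time. *)
Lemma finite_cover U l (r : nat) (c : (L -> int) -> V) : uniq l ->
  (forall n n', {in l, n =1 n'} -> c n = c n') ->
  (forall n i, i \in l -> (n i < - r%:Z) || (0 <= n i) -> U (c n)) ->
  exists F : seq V, forall n, U (c n) \/ c n \in F.
Proof.
elim: l c => [|i l IHl] c ul cl cU.
  by exists [:: c (fun=> 0)] => n; right; rewrite inE; apply/eqP/cl.
have [il ul'] := andP ul.
have H (k : nat) : exists F : seq V, forall n,
    U (c (upd n i (k%:Z - r%:Z))) \/ c (upd n i (k%:Z - r%:Z)) \in F.
  apply: IHl => // [n n' nn'|n j jl nj].
    apply: cl => h; rewrite inE; have [->|hi] := eqVneq h i.
      by rewrite !updE.
    by rewrite !upd_neq //= => /nn'.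
  apply: (cU _ j); rewrite ?inE ?jl ?orbT // upd_neq //.
  by apply: contraTneq jl => ->.
have [F FP] := choice H.
exists (flatten [seq F k | k <- iota 0 r]) => n.
have [|nin] := boolP ((n i < - r%:Z) || (0 <= n i)).
  by left; apply: (cU _ i); rewrite ?mem_head.
pose k := `|(n i + r%:Z)%R|%N.
have nik : n i = k%:Z - r%:Z by rewrite /k; lia.
have := FP k n; rewrite -nik upd_id => -[|cF]; [by left|right].
apply/flatten_mapP; exists k => //; rewrite mem_iota; lia.
Qed.

(** Modulo [Y], one unit can be moved from the index at [i] to that at [j] without changing the
    coefficient. As [j] stands to the right of [i], enough moves annihilate the word by
    truncation. *)
Lemma peel_diff (Y : set V) i j l0 l1 l2 ts : is_subspace Y ->
  uniq (l0 ++ i :: l1 ++ j :: l2) ->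
  (forall n, Y (tsval (mul_diff i j ts) (l0 ++ i :: l1 ++ j :: l2) n)) ->
  forall n, Y (tsval ts (l0 ++ i :: l1 ++ j :: l2) n).
Proof.
move=> sY; set l := l0 ++ _ => ul Ymul n.
have [ij [il2 jl2]] : i != j /\ i \notin l2 /\ j \notin l2.
  move: ul; rewrite /l cat_uniq /= mem_cat inE !negb_or => /and3P[_ _].
  rewrite cat_uniq /= => /andP[/andP[_ /andP[-> ->]]].
  by move=> /and3P[_ _ /andP[-> _]].
have ji : j != i by rewrite eq_sym.
pose shift (k : nat) := upd (upd n i (n i - k%:Z)) j (n j + k%:Z).
have shiftY k : Y (tsval ts l n - tsval ts l (shift k)).
  elim: k => [|k IHk].
    by rewrite /shift subr0 addr0 !upd_id subrr; exact: (subspace0 sY).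
  rewrite -(subrK (tsval ts l (shift k)) (tsval ts l n)) -addrA.
  apply: (subspaceD sY) => //.
  have := Ymul (upd (shift k) i (shift k i - 1)); rewrite mul_diff_val.
  rewrite !updE updK subrK upd_id; congr (Y (_ - tsval ts l _)).
  apply/funext => h; have [->|hj] := eqVneq h j.
    by rewrite !updE upd_neq // /shift !updE; lia.
  rewrite !(upd_neq _ _ hj); have [->|hi] := eqVneq h i.
    by rewrite !updE /shift !(upd_neq _ _ ij) !updE; lia.
  by rewrite /shift !upd_neq.
(* The shift leaves the labels of [l2] untouched, so the vector on which the mode at [j] acts, and
   its truncation bound, do not depend on [k]. *)
have [k k0] : exists k, tsval ts l (shift k) = 0.
  pose w t := apply_word (vecs t) l2 (fun h => n h + (expo t h)%:Z) vacuum.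
  have [tr trP] := choice (fun t => mode_trunc (vecs t j) (w t)).
  pose k := (\sum_(t <- ts) tr t + `|n j|)%N; exists k.
  rewrite /tsval big_seq big1 // => t tts.
  rewrite /tval /l -cat_cons catA apply_word_cat.
  rewrite [apply_word _ (j :: l2) _ _]/= -/(apply_word _ _ _ _).
  rewrite (_ : apply_word _ l2 _ _ = w t); last first.
    apply: eq_apply_word => // h hl2; rewrite /shift !upd_neq //.
      by apply: contraTneq hl2 => ->.
    by apply: contraTneq hl2 => ->.
  rewrite trP ?linear0 ?scaler0 // /shift updE /k (big_rem t) //=; lia.
by have := shiftY k; rewrite k0 subr0.
Qed.

Lemma ordered_pairs_split l i j : (i, j) \in ordered_pairs l ->
  exists l0 l1 l2, l = l0 ++ i :: l1 ++ j :: l2.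
Proof.
elim: l => // h l IHl; rewrite /= mem_cat => /orP[/mapP[h' + [-> ->]]|].
  by case/splitPr => l1 l2; exists [::], l1, l2.
by move=> /IHl[l0 [l1 [l2 ->]]]; exists (h :: l0), l1, l2.
Qed.

Lemma peel_delta (Y : set V) l ts k (ps : seq (L * L)) : is_subspace Y -> uniq l ->
  {subset ps <= ordered_pairs l} ->
  (forall n, Y (tsval (delta k ps ts) l n)) -> forall n, Y (tsval ts l n).
Proof.
move=> sY ul; elim: ps ts => //= [[i j]] ps IHps ts sub.
have [l0 [l1 [l2 El]]] : exists l0 l1 l2, l = l0 ++ i :: l1 ++ j :: l2.
  by apply: ordered_pairs_split; apply: sub; rewrite mem_head.
have peel ts' : (forall n, Y (tsval (iter k (mul_diff i j) ts') l n)) ->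
    forall n, Y (tsval ts' l n).
  elim: k {IHps} => //= k' IHk Yt; apply: IHk; rewrite El; apply: peel_diff => //.
    by rewrite -El.
  by rewrite -El.
move=> H; apply: IHps; last exact: (peel _ H).
by move=> p pps; apply: sub; rewrite inE pps orbT.
Qed.

(** The auxiliary [j] and [I] make every coordinate direction nilpotent, so the symmetric series has
    finitely many values [F] outside [U]. The factors [z_i - z_j] are then removed inside
    [plus_span U F], which costs no further vectors. *)
Lemma words_plus_span U l u chi mu : is_subspace U -> absorbing mu U -> uniq l ->
  {in l, forall i, sigma (u i) = chi i *: u i} -> \prod_(i <- l) chi i = mu ->
  {in l, forall i, exists j I, [/\ I != [::], uniq I, {subset I <= l} &
    [/\ j \in l, j \notin I, j != i & [/\ {in I, forall h, chi h = chi i},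
        chi j * chi i = 1 & chi i ^+ size I = 1]]]} ->
  exists F, forall n, plus_span U F (apply_word u l n vacuum).
Proof.
move=> sU HU ul eigen prodl H.
have [k kP] : exists k : nat, forall i j (h : int), i \in l -> j \in l ->
    k%:Z <= h -> mode (u i) h (u j) = 0.
  have [tr trP] := choice (fun p : L * L => mode_trunc (u p.1) (u p.2)).
  exists (\sum_(i <- l) \sum_(j <- l) tr (i, j))%N => i j h il jl kh.
  apply: (trP (i, j)); apply: le_trans kh; rewrite lez_nat.
  by rewrite (big_rem i) //= (big_rem j) //= -!addnA leq_addr.
pose ts := delta k (ordered_pairs l) [:: Term 1 (fun=> 0%N) u].
have sl : sys l ts by apply: sys_delta.
have uts : all_vecs u ts.
  by apply: all_vecs_delta => t; rewrite inE => /eqP ->.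
have nil i : i \in l -> nilpotent U l (tsval ts l) (indic [:: i]).
  move=> il; have [j [I [I0 uI Il [jl jI ji [chiI chij chip]]]]] := H i il.
  apply: (@single_nilpotent U l i j I ts chi mu (chi i)) => //.
  by move=> t h tts hl; rewrite uts //; apply: eigen.
have [r rP] : exists r : nat, forall n i, i \in l -> n i < - r%:Z -> U (tsval ts l n).
  have far i : exists r : nat, i \in l -> forall n, n i < - r%:Z -> U (tsval ts l n).
    have [il|il] := boolP (i \in l); last by exists 0%N.
    by have [r rP] := nilpotent_far sU ul il (nil i il); exists r.
  have [r rP] := choice far; exists (\sum_(i <- l) r i)%N => n i il ni.
  by apply: (rP i) => //; apply: lt_le_trans ni _; rewrite lerN2 lez_nat (big_rem i) //= leq_addr.
have [F FP] : exists F : seq V, forall n, U (tsval ts l n) \/ tsval ts l n \in F.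
  apply: (@finite_cover U l r) => // [n n' nn'|n i il /orP[ni|ni]].
  - rewrite /tsval; apply: eq_bigr => t _; congr (_ *: _).
    by apply: eq_apply_word => // i il; rewrite nn'.
  - exact: (rP n i).
  - by rewrite (sl.2 _ i) //; exact: (subspace0 sU).
exists F => n.
have sY := plus_span_subspace F sU.
have := @peel_delta _ l [:: Term 1 (fun=> 0%N) u] k (ordered_pairs l) sY ul (fun _ => id).
rewrite -/ts => /(_ _ n); rewrite /tsval big_seq1 /tval /= scale1r.
under eq_fun do rewrite addr0.
apply=> n'; have [Un|nF] := FP n'; first exact: plus_spanl.
by apply: plus_spanr => //; apply: span_incl.
Qed.

End Finiteness.

(** * Weights and eigenspaces *)

Section Weights.
Context {R : realType} {V : voa R}.
Local Notation K := (R[i]).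
Implicit Types (u v w : V) (h k m n : int) (x : K).

Lemma weightE n v :
  weight_space V n v <-> mode (conformal : V) 1 v = n%:~R *: v.
Proof. by []. Qed.

Definition Lm1 v : V := mode conformal 0 v.
HB.instance Definition _ :=
  GRing.isLinear.Build K V V _ Lm1 (voa_linearr (voaP V) conformal 0).

Lemma mode_Lm1 u n v : mode (Lm1 u) n v = - (n%:~R *: mode u (n - 1) v).
Proof. exact: (voa_derivative (voaP V)). Qed.

Lemma Lm1_mode u n v : Lm1 (mode u n v) = mode (Lm1 u) n v + mode u n (Lm1 v).
Proof.
have [J H] := borcherds_commutator conformal u v 0 n.
have := H J.+1 (leqnSn _); rewrite big_ord_recl big1 => [|i _].
  by rewrite zbinom0 scale1r /= subr0 add0r addr0 => /eqP; rewrite subr_eq => /eqP.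
by rewrite zbinom0l scale0r.
Qed.

Lemma Lm1_vacuum : Lm1 vacuum = 0.
Proof. exact: mode_creation_ge0. Qed.

Lemma mode_vacuum_Lm1 v (n : nat) :
  n.+1%:R *: mode v (- n.+2%:Z) vacuum = Lm1 (mode v (- n.+1%:Z) vacuum).
Proof.
rewrite Lm1_mode Lm1_vacuum mode0r addr0 mode_Lm1 mulrNz scaleNr opprK.
by congr (_ *: mode v _ _); lia.
Qed.

Lemma weight_mode u v h k n : weight_space V h u -> weight_space V k v ->
  weight_space V (h + k - n - 1) (mode u n v).
Proof.
move=> /weightE hu /weightE kv; apply/weightE.
have [J H] := borcherds_commutator conformal u v 1 n.
have := H J.+2; rewrite !big_ord_recl big1 => [|i _]; last first.
  by rewrite (zbinom_nat 1) bin_small ?scale0r.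
rewrite !(zbinom_nat 1) /= bin0 binn !scale1r !addr0 hu kv modeZl.
rewrite -/(Lm1 u) mode_Lm1 linearZ /= => /(_ _)/eqP; rewrite subr_eq => E.
rewrite (eqP (E _)); last by lia.
rewrite (_ : 1 + n - 1 = n) ?(_ : 1 + n - bump 0 0 = n); try by rewrite /bump; lia.
by rewrite -scaleNr -!scalerDl -mulrNz -!intrD; congr (_%:~R *: _); lia.
Qed.

Lemma weight_Lm1 h v : weight_space V h v -> weight_space V (h + 1) (Lm1 v).
Proof.
move=> hv; have := weight_mode 0 (voa_omega_weight (voaP V)) hv.
by rewrite (_ : 2 + h - 0 - 1 = h + 1) //; lia.
Qed.

Lemma weight_vacuum : weight_space V 0 vacuum.
Proof. exact: voa_one_weight (voaP V). Qed.

Lemma weight0 h : weight_space V h 0.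
Proof. by have [] := weight_space_subspace V h. Qed.

Definition graded_sum v (s : seq int) (f : int -> V) :=
  [/\ uniq s, forall n, weight_space V n (f n) & v = \sum_(n <- s) f n].

Lemma sum_if_mem (s S : seq int) (f : int -> V) : uniq s -> uniq S ->
  {subset s <= S} ->
  \sum_(n <- S) (if n \in s then f n else 0) = \sum_(n <- s) f n.
Proof.
move=> us uS sS; rewrite -big_mkcond -big_filter; apply: perm_big.
apply: uniq_perm => //; first exact: filter_uniq.
by move=> n; rewrite mem_filter; case ns: (n \in s) => //=; rewrite sS.
Qed.

Lemma graded_sum_uniq v s f s' f' n : graded_sum v s f -> graded_sum v s' f' ->
  (if n \in s then f n else 0) = (if n \in s' then f' n else 0).
Proof.
move=> [us hf Ef] [us' hf' Ef'].
pose S := undup (s ++ s').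
have sS : {subset s <= S} by move=> i si; rewrite mem_undup mem_cat si.
have s'S : {subset s' <= S} by move=> i si; rewrite mem_undup mem_cat si orbT.
have [nS|nS] := boolP (n \in S); last first.
  by move: nS; rewrite mem_undup mem_cat negb_or => /andP[/negbTE -> /negbTE ->].
pose g i := (if i \in s then f i else 0) - (if i \in s' then f' i else 0).
apply/eqP; rewrite -subr_eq0; apply/eqP.
apply: (@L0_eigenspace_direct R V S g (undup_uniq _)) => // [i|].
  by apply: (subspaceB (weight_space_subspace V i)); case: ifP => // _; apply: weight0.
by rewrite sumrB !sum_if_mem ?undup_uniq // -Ef -Ef' subrr.
Qed.

Lemma graded_sumP v : exists sf : seq int * (int -> V), graded_sum v sf.1 sf.2.
Proof.
by have [s [f H]] := voa_grading (voaP V) v; exists (s, f).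
Qed.

(** The grading only asserts that decompositions exist, so one is chosen; [graded_sum_uniq] shows
    that the choice does not matter. *)
Definition wproj n v : V :=
  let: (s, f) := projT1 (cid (graded_sumP v)) in if n \in s then f n else 0.

Lemma wprojE n v s f : graded_sum v s f -> wproj n v = if n \in s then f n else 0.
Proof.
rewrite /wproj; case: cid => -[s' f'] /= H H'; exact: graded_sum_uniq H H'.
Qed.

Lemma wproj_is_linear n : linear (wproj n).
Proof.
move=> a u v; have [[s f] /= Hu] := graded_sumP u.
have [[s' f'] /= Hv] := graded_sumP v.
rewrite (wprojE _ Hu) (wprojE _ Hv).
have [us hf Ef] := Hu; have [us' hf' Ef'] := Hv.
pose S := undup (s ++ s').
have sS : {subset s <= S} by move=> i si; rewrite mem_undup mem_cat si.
have s'S : {subset s' <= S} by move=> i si; rewrite mem_undup mem_cat si orbT.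
pose g i := a *: (if i \in s then f i else 0) + (if i \in s' then f' i else 0).
rewrite (@wprojE n _ S g); last first.
  split; first exact: undup_uniq.
    move=> i; apply: (weight_space_subspace V i).2; case: ifP => // _; exact: weight0.
  by rewrite big_split -scaler_sumr !sum_if_mem ?undup_uniq //= -Ef -Ef'.
case: ifP => //; rewrite mem_undup mem_cat => /norP[/negbTE -> /negbTE ->].
by rewrite scaler0 addr0.
Qed.

HB.instance Definition _ n :=
  GRing.isLinear.Build K V V _ (wproj n) (wproj_is_linear n).

Lemma wproj_weight n v : weight_space V n (wproj n v).
Proof.
have [[s f] /= H] := graded_sumP v; rewrite (wprojE _ H); case: ifP => _.
  by have [_ hf _] := H.
exact: weight0.
Qed.

Lemma wproj_hom n m v : weight_space V m v -> wproj n v = if n == m then v else 0.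
Proof.
move=> mv.
have H : graded_sum v [:: m] (fun i => if i == m then v else 0).
  split=> // [i|]; last by rewrite big_seq1 eqxx.
  by case: eqP => [->|_] //; apply: weight0.
by rewrite (wprojE _ H) inE; case: eqP.
Qed.

Lemma wproj_id n v : weight_space V n v -> wproj n v = v.
Proof. by move=> /wproj_hom ->; rewrite eqxx. Qed.

Lemma wproj_sum v : exists2 s, uniq s & v = \sum_(n <- s) wproj n v.
Proof.
have [[s f] /= H] := graded_sumP v; have [us _ Ef] := H; exists s => //.
by rewrite {1}Ef; apply: eq_big_seq => n ns; rewrite (wprojE _ H) ns.
Qed.

Lemma wproj_ext (W : lmodType K) (f g : {linear V -> W}) :
  (forall n v, weight_space V n v -> f v = g v) -> f =1 g.
Proof.
move=> fg v; have [s _ ->] := wproj_sum v; rewrite !linear_sum.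
by apply: eq_bigr => n _; apply: fg; apply: wproj_weight.
Qed.

Lemma wproj_mode h u n v m : weight_space V h u ->
  wproj m (mode u n v) = mode u n (wproj (m - h + n + 1) v).
Proof.
move=> hu.
apply: (@wproj_ext V (wproj m \o mode u n) (mode u n \o wproj (m - h + n + 1))).
move=> k {}v kv /=.
rewrite (wproj_hom _ (weight_mode n hu kv)) (wproj_hom _ kv).
have -> : (m == h + k - n - 1) = (m - h + n + 1 == k) by apply/eqP/eqP; lia.
by case: eqP => // _; rewrite mode0r.
Qed.

(** The projection [wproj n] fixes [v] and kills the generators of other weights. *)
Lemma weight_span (G : set V) n v :
  (forall g, G g -> exists m, weight_space V m g) -> weight_space V n v ->
  span G v -> span (G `&` weight_space V n) v.
Proof.
move=> Gh nv; rewrite -{2}(wproj_id nv); move: v {nv}.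
apply: span_image; first exact: span_subspace.
move=> g Gg /=; have [m mg] := Gh _ Gg; rewrite (wproj_hom _ mg).
case: eqP => [E|_]; last exact: (subspace0 (span_subspace _)).
by apply: span_incl; split=> //; rewrite E.
Qed.

End Weights.

Lemma closed_prim_root_exists (F : numClosedFieldType) (n : nat) : (0 < n)%N ->
  exists z : F, n.-primitive_root z.
Proof.
move=> n_gt0; pose q : {poly F} := 'X^n - 1.
have [r Dq] := closed_field_poly_normal q.
rewrite (monicP _) ?monicXnsubC // scale1r in Dq.
have rn1 : all n.-unity_root r by apply/allP=> z; rewrite -root_prod_XsubC -Dq.
have sz_r : (n < (size r).+1)%N by rewrite -(size_prod_XsubC r id) -Dq size_XnsubC.
have [|z] := hasP (has_prim_root n_gt0 rn1 _ sz_r); last by exists z.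
by rewrite -separable_prod_XsubC -Dq separable_Xn_sub_1 // pnatr_eq0 -lt0n.
Qed.

Lemma sum_unity_root (F : fieldType) (x : F) (n : nat) :
  x ^+ n = 1 -> x != 1 -> \sum_(i < n) x ^+ i = 0.
Proof.
move=> xn x1; have /eqP := subrX1 x n; rewrite xn subrr eq_sym mulf_eq0 subr_eq0.
by rewrite (negbTE x1) => /eqP.
Qed.

Section Eigen.
Context {R : realType} {V : voa R} {sigma : voa_aut V} {p : nat}.
Local Notation K := (R[i]).
Implicit Types (u v w : V) (h k m n : int) (x lam mu : K).

Definition hom h lam v := weight_space V h v /\ sigma v = lam *: v.

Lemma hom_subspace h lam : is_subspace (hom h lam).
Proof.
have [w0 wP] := weight_space_subspace V h.
split; first by split=> //; rewrite linear0 scaler0.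
move=> a u v [hu su] [hv sv]; split; first exact: wP.
by rewrite linearP su sv scalerDr !scalerA mulrC.
Qed.

Lemma sigma_mode u v n lam mu : sigma u = lam *: u -> sigma v = mu *: v ->
  sigma (mode u n v) = (lam * mu) *: mode u n v.
Proof.
by move=> su sv; rewrite aut_mode su sv modeZl linearZ scalerA.
Qed.

Lemma hom_mode h lam u k mu v n : hom h lam u -> hom k mu v ->
  hom (h + k - n - 1) (lam * mu) (mode u n v).
Proof. by move=> [hu su] [kv sv]; split; [apply: weight_mode|apply: sigma_mode]. Qed.

Lemma hom_Lm1 h lam u : hom h lam u -> hom (h + 1) lam (Lm1 u).
Proof.
move=> [hu su]; split; first exact: weight_Lm1.
by rewrite /Lm1 aut_mode aut_conformal su linearZ.
Qed.

Lemma hom_vacuum : hom 0 1 vacuum.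
Proof. by split; [apply: weight_vacuum|rewrite aut_vacuum scale1r]. Qed.

Lemma iter_sigma_is_linear (r : nat) : linear (iter r sigma).
Proof. by elim: r => [|r IHr] a u v //; rewrite !iterS IHr linearP. Qed.
HB.instance Definition _ r :=
  GRing.isLinear.Build K V V _ (iter r sigma) (iter_sigma_is_linear r).

(** Average over the cyclic group generated by [sigma]: the projector onto the eigenspace of a
    [p]-th root of unity [lam]. *)
Definition eproj lam v : V :=
  p%:R^-1 *: \sum_(k < p) lam^-1 ^+ k *: iter k sigma v.

Lemma eproj_is_linear lam : linear (eproj lam).
Proof.
move=> a u v; rewrite /eproj scalerA mulrC -scalerA -scalerDr; congr (_ *: _).
rewrite scaler_sumr -big_split; apply: eq_bigr => k _ /=.
by rewrite linearP scalerDr !scalerA mulrC.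
Qed.
HB.instance Definition _ lam :=
  GRing.isLinear.Build K V V _ (eproj lam) (eproj_is_linear lam).

Lemma iter_sigma_eigen (r : nat) mu v :
  sigma v = mu *: v -> iter r sigma v = mu ^+ r *: v.
Proof.
move=> sv; elim: r => [|r IHr]; first by rewrite expr0 scale1r.
by rewrite iterS IHr linearZ /= sv scalerA exprSr.
Qed.

Hypothesis p_gt0 : (0 < p)%N.
Hypothesis sigmap : iter p sigma =1 id.

Lemma p_neq0 : (p%:R : K) != 0. Proof. by rewrite pnatr_eq0 -lt0n. Qed.

Lemma root_neq0 lam : lam ^+ p = 1 -> lam != 0.
Proof.
move=> lp; apply/eqP => l0; move: lp; rewrite l0 expr0n eqn0Ngt p_gt0 /= => /eqP.
by rewrite eq_sym oner_eq0.
Qed.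

Lemma eproj_eigen lam v : lam ^+ p = 1 -> sigma (eproj lam v) = lam *: eproj lam v.
Proof.
move=> lp; have l0 := root_neq0 lp.
rewrite /eproj linearZ scalerA mulrC -scalerA; congr (_ *: _).
pose F (k : nat) := lam^-1 ^+ k *: iter k sigma v.
have E : \sum_(k < p) F k.+1 = \sum_(k < p) F k.
  apply: (addrI (F 0%N)); transitivity (\sum_(k < p.+1) F k).
    by rewrite big_ord_recl.
  rewrite big_ord_recr /= addrC; congr (_ + _).
  by rewrite /F exprVn lp sigmap expr0 invr1.
transitivity (lam *: \sum_(k < p) F k.+1); last by rewrite E.
rewrite linear_sum scaler_sumr; apply: eq_bigr => k _.
by rewrite /F linearZ /= scalerA exprS mulrA mulfV // mul1r.
Qed.

Lemma eproj_hom lam mu v : lam ^+ p = 1 -> mu ^+ p = 1 -> sigma v = mu *: v ->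
  eproj lam v = if mu == lam then v else 0.
Proof.
move=> lp mp sv; have l0 := root_neq0 lp; rewrite /eproj.
under eq_bigr do rewrite (iter_sigma_eigen _ sv) scalerA -exprMn.
rewrite -scaler_suml; have [->|ml] := eqVneq mu lam.
  rewrite mulVf //; under eq_bigr do rewrite expr1n.
  by rewrite sumr_const card_ord scalerA mulVf ?p_neq0 // scale1r.
rewrite sum_unity_root ?scale0r ?scaler0 //.
  by rewrite exprMn exprVn lp mp invr1 mulr1.
by apply: contra ml => /eqP E; rewrite -[mu]mul1r -(mulfV l0) -mulrA E mulr1.
Qed.

Lemma eproj_sum v : exists2 rs : seq K,
  (forall lam, lam \in rs -> lam ^+ p = 1) & v = \sum_(lam <- rs) eproj lam v.
Proof.
have [z zp] := closed_prim_root_exists (complex R) p_gt0.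
have zr (j : nat) : (z ^+ j) ^+ p = 1 by rewrite exprAC (prim_expr_order zp) expr1n.
exists [seq z ^+ j | j <- iota 0 p].
  by move=> lam /mapP[j _ ->].
rewrite big_map -[X in iota 0 X]subn0 -/(index_iota 0 p) big_mkord /eproj -scaler_sumr.
rewrite exchange_big /=.
have pE : p = p.-1.+1 by rewrite prednK.
(* Orthogonality of characters: the sum of [lam^-k] over all [p]-th roots of unity vanishes for
   [0 < k < p]. *)
rewrite (eq_bigr (fun k : 'I_p => if k == 0%N :> nat then p%:R *: v else 0)); last first.
  move=> k _; rewrite -scaler_suml.
  have -> : \sum_(i < p) (z ^+ i)^-1 ^+ k = \sum_(i < p) (z ^- k) ^+ i.
    by apply: eq_bigr => i _; rewrite -!exprVn exprAC.
  case: eqP => [->|/eqP k0].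
    under eq_bigr do rewrite expr0 invr1 expr1n.
    by rewrite sumr_const card_ord.
  rewrite sum_unity_root ?scale0r //.
    by rewrite -exprVn exprAC exprVn (prim_expr_order zp) invr1 expr1n.
  rewrite invr_eq1 -(prim_order_dvd zp); apply/negP => /dvdn_leq.
  by rewrite lt0n k0 leqNgt ltn_ord => /(_ isT).
rewrite -big_mkcond (big_pred1 (Ordinal p_gt0)) //.
by rewrite scalerA mulVf ?p_neq0 // scale1r.
Qed.

Lemma eproj_weight lam h v : weight_space V h v -> weight_space V h (eproj lam v).
Proof.
have sW := weight_space_subspace V h.
move=> hv; apply: (subspaceZ _ sW).
apply: (@subspace_sum _ _ _ _ _ _ _ sW) => k _.
apply: (subspaceZ _ sW); elim: (nat_of_ord k) => //= r; exact: aut_weight.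
Qed.

Lemma hom_span h v : weight_space V h v ->
  span [set x | exists2 lam, lam ^+ p = 1 & hom h lam x] v.
Proof.
move=> hv; have [rs rP ->] := eproj_sum v.
apply: (subspace_sum_seq (span_subspace _)) => lam /rP lp; apply: span_incl.
by exists lam => //; split; [apply: eproj_weight|apply: eproj_eigen].
Qed.

Lemma homs_span v :
  span [set x | exists h lam, lam ^+ p = 1 /\ hom h lam x] v.
Proof.
have [s _ ->] := wproj_sum v.
apply: (subspace_sum (span_subspace _)) => h _.
apply: span_mono (hom_span (wproj_weight h v)) => x [lam lp hx].
by exists h, lam.
Qed.

Lemma eigen_span (G : set V) lam v :
  (forall g, G g -> exists2 mu, mu ^+ p = 1 & sigma g = mu *: g) ->
  lam ^+ p = 1 -> sigma v = lam *: v -> span G v ->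
  span (G `&` [set x | sigma x = lam *: x]) v.
Proof.
move=> Gh lp sv Gv; have := eproj_hom lp lp sv; rewrite eqxx => <-.
move: v Gv {sv}; apply: span_image; first exact: span_subspace.
move=> g Gg /=; have [mu mp sg] := Gh _ Gg; rewrite (eproj_hom lp mp sg).
case: eqP => [E|_]; last exact: (subspace0 (span_subspace _)).
by apply: span_incl; split=> //=; rewrite sg E.
Qed.

Lemma eigen_homs_span lam v : lam ^+ p = 1 -> sigma v = lam *: v ->
  span [set x | exists h, hom h lam x] v.
Proof.
move=> lp sv.
have H := eigen_span _ lp sv (homs_span v).
apply: span_mono (H _) => [x [[h [mu [mp [hx _]]]] sx]|g [h [mu [mp [_ sg]]]]].
  by exists h.
by exists mu.
Qed.

End Eigen.

(** * Cofiniteness for all [C_n] *)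

Section CftType.
Context {R : realType} {V : voa R}.
Hypothesis cft : cft_type V.
Local Notation K := (R[i]).
Implicit Types (u v w x y : V) (h : int) (m n : nat).

Lemma weight_neg h v : h < 0 -> weight_space V h v -> v = 0.
Proof. by move=> h0 /(cft.1 h h0). Qed.

Lemma weight_zero v : weight_space V 0 v -> exists c, v = c *: vacuum.
Proof.
rewrite cft.2 => Sv.
apply: (@span_min _ _ _ [set v | exists c, v = c *: vacuum]) Sv.
  split=> [|a _ _ [b ->] [c ->]]; first by exists 0; rewrite scale0r.
  by exists (a * b + c); rewrite scalerDl scalerA.
by move=> _ ->; exists 1; rewrite scale1r.
Qed.

Lemma weight_uniq h k v : weight_space V h v -> weight_space V k v -> h != k -> v = 0.
Proof. by move=> hv kv hk; rewrite -(wproj_id hv) (wproj_hom _ kv) (negbTE hk). Qed.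

Definition Cn n : set V := span [set x | exists h u v,
  [/\ 0 < h, weight_space V h u & x = mode u (- n%:Z) v]].

Lemma Cn_subspace n : is_subspace (Cn n).
Proof. exact: span_subspace. Qed.

(** [(L(-1) x)_(-m) = m x_(-m-1)] lowers the index step by step. Weights at most [0] leave only
    multiples of the vacuum, whose sole nonzero mode has index [-1], excluded by [n >= 2]. *)
Lemma Cn_mode n m x y : (2 <= n)%N -> (n <= m)%N -> Cn n (mode x (- m%:Z) y).
Proof.
move=> n2 nm; have sC := Cn_subspace n.
have [s _ ->] := wproj_sum x; rewrite mode_suml; apply: (subspace_sum sC) => h _.
have := wproj_weight h x; move: (wproj h x) => {s}x hx.
rewrite -(subnK nm); elim: (m - n)%N h x hx => [|d IHd] h x hx.
  have [h0|h0|h0] := ltrgtP h 0.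
  - by rewrite (weight_neg h0 hx) mode0l; exact: (subspace0 sC).
  - by rewrite add0n; apply: span_incl; exists h, x, y.
  - rewrite h0 in hx; have [c ->] := weight_zero hx.
    rewrite modeZl mode_vacuum; case: eqP => [E|_]; first by lia.
    by rewrite scaler0; exact: (subspace0 sC).
have := IHd _ _ (weight_Lm1 hx); rewrite mode_Lm1 mulrNz scaleNr opprK.
rewrite (_ : - (d + n)%N%:Z - 1 = - (d.+1 + n)%N%:Z); last by lia.
have c0 : ((d + n)%N%:Z%:~R : K) != 0 by rewrite intr_eq0; lia.
by move=> /(subspaceZ ((d + n)%N%:Z%:~R)^-1 sC); rewrite scalerA mulVf // scale1r.
Qed.

(** In the commutator all indices are [k - m - i], hence at most [-m] as [k <= 0]. *)
Lemma Cn_mode2 n (k : int) m u v w : (2 <= n)%N -> (n <= m)%N -> k <= 0 ->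
  Cn n (mode u k (mode v (- m%:Z) w)).
Proof.
move=> n2 nm k0; have sC := Cn_subspace n.
have [J H] := borcherds_commutator u v w k (- m%:Z).
rewrite -(subrK (mode v (- m%:Z) (mode u k w)) (mode u k _)) (H J) //.
apply: (subspaceD sC); last exact: Cn_mode.
apply: (subspace_sum sC) => i _; apply: (subspaceZ _ sC).
rewrite (_ : k - m%:Z - i%:Z = - (m + `|k| + i)%N%:Z); last by lia.
by apply: Cn_mode => //; lia.
Qed.

(** All terms of [(u_{-1} v)_{-2n+1} w] but [u_{-n} v_{-n} w] have a mode of
    index at most [-n-1]. *)
Lemma Cn_square n u v w : (2 <= n)%N ->
  Cn n.+1 (mode u (- n%:Z) (mode v (- n%:Z) w)).
Proof.
move=> n2; have sC := Cn_subspace n.+1; have n3 : (2 <= n.+1)%N by lia.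
have [J H] := borcherds_iterate u v w (- 1%:Z) (- (2 * n - 1)%N%:Z).
pose A (i : nat) := mode u (- 1%:Z - i%:Z) (mode v (- (2 * n - 1)%N%:Z + i%:Z) w).
have AC : Cn n.+1 (\sum_(i < J + n) A i).
  have := H (J + n)%N (leq_addr _ _).
  under eq_bigr => i _ do rewrite zbinom_neg add0n binn scale1r.
  rewrite sumrB; set B := \sum_(i < _) (_ *: _) => E.
  have -> : \sum_(i < J + n) A i = mode (mode u (-1) v) (- (2 * n - 1)%N%:Z) w + B.
    by rewrite E subrK.
  apply: (subspaceD sC); first by apply: Cn_mode => //; lia.
  apply: (subspace_sum sC) => i _; apply: (subspaceZ _ sC).
  rewrite (_ : _ - _ - _ = - (2 * n + i)%N%:Z); last by lia.
  by apply: Cn_mode => //; lia.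
have n1 : (n.-1 < J + n)%N by lia.
rewrite (bigD1 (Ordinal n1)) //= {1}/A in AC.
rewrite (_ : - 1%:Z - n.-1%:Z = - n%:Z) in AC; last by lia.
rewrite (_ : - (2 * n - 1)%N%:Z + n.-1%:Z = - n%:Z) in AC; last by lia.
move: AC; set S := \sum_(i < _ | _) _ => AC.
have SC : Cn n.+1 S.
  apply: (subspace_sum sC) => i ni; rewrite /A.
  have {}ni : (i : nat) != n.-1 by [].
  have [il|il] := leqP n.-1 i.
    rewrite (_ : - 1%:Z - i%:Z = - (i + 1)%N%:Z); last by lia.
    by apply: Cn_mode => //; lia.
  rewrite (_ : - (2 * n - 1)%N%:Z + i%:Z = - (2 * n - 1 - i)%N%:Z); last by lia.
  by apply: Cn_mode2 => //; lia.
by rewrite -(addrK S (mode u _ _)); apply: (subspaceB sC).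
Qed.

Lemma Cn_homs n : Cn n `<=` span [set x | exists h k u v,
  [/\ 0 < h, weight_space V h u, weight_space V k v & x = mode u (- n%:Z) v]].
Proof.
have sS := @span_subspace K V.
apply: span_min => // _ [h [u [v [h0 hu ->]]]].
have [s _ ->] := wproj_sum v; rewrite linear_sum.
apply: (subspace_sum (sS _)) => k _; apply: span_incl.
by exists h, k, u, (wproj k v); split=> //; apply: wproj_weight.
Qed.

Lemma Cn_weight n h x : weight_space V h x -> Cn n x ->
  span [set x | exists k l u v, [/\ 0 < k, weight_space V k u, weight_space V l v,
    k + l + n%:Z - 1 = h & x = mode u (- n%:Z) v]] x.
Proof.
move=> hx /Cn_homs /(weight_span _ hx) H.
have sS := @span_subspace K V.
apply: (span_min (sS _) _ (H _)) => [_ [[k [l [u [v [k0 ku lv ->]]]]] hm]|].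
  have [E|E] := eqVneq (k + l + n%:Z - 1) h.
    by apply: span_incl; exists k, l, u, v.
  have mw := weight_mode (- n%:Z) ku lv.
  rewrite (weight_uniq mw hm); first exact: (subspace0 (sS _)).
  by apply: contraNneq E => <-; rewrite opprK.
by move=> _ [k [l [u [v [_ ku lv ->]]]]]; exists (k + l - - n%:Z - 1); apply: weight_mode.
Qed.

(** If [u_(-n) v] has weight above [2N + n], then [u] or [v] has weight above [N] and is itself a
    sum of products [a_(-n) b]. Two modes of index [-n] then meet, and [Cn_square] applies. *)
Lemma Cn_step n (N : nat) : (2 <= n)%N ->
  (forall h x, N%:Z < h -> weight_space V h x -> Cn n x) ->
  forall h x, (2 * N + n)%N%:Z < h -> weight_space V h x -> Cn n.+1 x.
Proof.
move=> n2 HN h x Nh hx; have sC := Cn_subspace n.+1.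
have := Cn_weight hx (HN h x _ hx) => /(_ ltac:(lia)).
apply: span_min => // _ [k [l [u [v [k0 ku lv E ->]]]]].
have [Nk|kN] := ltP N%:Z k.
  have := HN k u Nk ku; move: u {ku}.
  apply: (span_model sC) => _ [_ [a [b [_ _ ->]]]].
  have [J H] := borcherds_iterate a b v (- n%:Z) (- n%:Z).
  rewrite (H J) //; apply: (subspace_sum sC) => i _; apply: (subspaceZ _ sC).
  apply: (subspaceB sC); last first.
    apply: (subspaceZ _ sC).
    rewrite (_ : _ - _ - _ = - (n + n + i)%N%:Z); last by lia.
    by apply: Cn_mode => //; lia.
  case: (nat_of_ord i) => [|j].
    rewrite (_ : mode a _ (mode b _ v) = mode a (- n%:Z) (mode b (- n%:Z) v)).
      exact: Cn_square.
    by congr (mode _ _ (mode _ _ _)); lia.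
  rewrite (_ : - n%:Z - j.+1%:Z = - (n + j.+1)%N%:Z); last by lia.
  by apply: Cn_mode => //; lia.
have Nl : N%:Z < l by lia.
have := HN l v Nl lv; move: v {lv}.
apply: (span_moder sC) => _ [_ [a [b [_ _ ->]]]].
exact: Cn_square.
Qed.

Lemma wproj_far (s : seq V) : exists N : nat, forall h x, N%:Z < h ->
  span [set` s] x -> wproj h x = 0.
Proof.
have H v : exists N : nat, forall h, N%:Z < h -> wproj h v = 0.
  have [[s' f] /= Hs] := graded_sumP v.
  exists (\sum_(i <- s') `|i|)%N => h hN; rewrite (wprojE _ Hs).
  case: ifP => // hs; move: hN; rewrite (big_rem h) //=; lia.
have [N NP] := choice H; exists (\sum_(v <- s) N v)%N => h x hN sx.
have s0 : is_subspace [set 0 : V].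
  by split=> // a u v -> ->; rewrite scaler0 addr0.
suff : [set 0] (wproj h x) by [].
move: x sx; apply: span_image => // v /= vs; apply: NP.
by apply: le_lt_trans hN; rewrite lez_nat (big_rem v) //= leq_addr.
Qed.

Lemma wproj_Cn n h x : Cn n x -> Cn n (wproj h x).
Proof.
move: x; apply: span_image; first exact: Cn_subspace.
move=> _ [k [u [v [k0 ku ->]]]]; change (Cn n (wproj h (mode u (- n%:Z) v))).
rewrite (wproj_mode _ _ _ ku).
by apply: span_incl; eexists k, u, _.
Qed.

Hypothesis C2V : C2_cofinite V.

(** Cofiniteness is phrased as membership of all vectors of large weight, the form that [Cn_step]
    propagates. For [n = 2], a finite complement has bounded weight and [C_2] is graded. *)
Theorem Cn_cofinite n : (2 <= n)%N ->
  exists N : nat, forall h x, N%:Z < h -> weight_space V h x -> Cn n x.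
Proof.
elim: n => // n IHn; rewrite leq_eqVlt => /orP[/eqP <-|n2]; last first.
  by have [N HN] := IHn n2; eexists; apply: Cn_step HN.
have [s sP] := C2V; have [N NP] := wproj_far s; exists N => h x Nh hx.
have [u Uu su] := sP x.
have E : wproj h x = wproj h u + wproj h (x - u) by rewrite -linearD addrC subrK.
rewrite -(wproj_id hx) E (NP h _ Nh su) addr0.
by apply: wproj_Cn; exact: Uu.
Qed.

End CftType.

(** * Simplicity: recovering the vacuum from an eigenvector *)

Section VacuumPair.
Context {R : realType} {V : voa R} {sigma : voa_aut V} {p : nat}.
Hypotheses (cft : cft_type V) (simpleV : voa_simple V).
Local Notation K := (R[i]).
Implicit Types (u v w x y : V).

Lemma vacuum_neq0 : (vacuum : V) != 0.
Proof.
apply/negP => /eqP v0; apply: simpleV.1; apply/seteqP; split=> // v _ /=.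
by have := mode_vacuum (-1) v; rewrite v0 mode0l eqxx.
Qed.

Definition left_ideal u := span [set x | exists w n, x = mode w n u].

(** Choose [N] with [v_m u = 0] for [m >= N] and take [l = k - N], [m = N] in the Borcherds
    identity: the terms with [v] acting first on [u] vanish, and [v_k w_n u] is expressed by modes
    on [u] and by [v_(k-i) w_(n+i) u] with [i > 0]. The induction stops where [w_n u = 0]. *)
Lemma left_ideal_mode u v (k : int) x : left_ideal u x -> left_ideal u (mode v k x).
Proof.
have sI : is_subspace (left_ideal u) by exact: span_subspace.
move: x; apply: (span_moder sI) => _ [w [n ->]].
have [N NP] := mode_trunc v u; have [N' NP'] := mode_trunc w u.
have [d Hd] : exists d : nat, N'%:Z <= n + d%:Z by exists `|N'%:Z - n|%N; lia.
elim: d n k Hd => [|d IHd] n k Hd.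
  by rewrite NP' ?mode0r; [exact: (subspace0 sI)|lia].
have [J H] := borcherds v w u (k - N%:Z) N%:Z n.
have := H J.+1 (leqnSn _); rewrite [RHS]big_ord_recl /= expr0 mul1r zbinom0 scale1r.
rewrite NP ?mode0r ?scaler0 ?subr0; last by lia.
rewrite !subrK ?subr0 ?addr0.
set S := \sum_(i < J) _ => E; rewrite -(addrK S (mode v k _)) -E.
apply: (subspaceB sI).
  by apply: (subspace_sum sI) => i _; apply: (subspaceZ _ sI); apply: span_incl; eexists _, _.
apply: (subspace_sum sI) => i _; apply: (subspaceZ _ sI).
rewrite NP ?mode0r ?scaler0 ?subr0; last by lia.
by apply: IHd; rewrite /bump; lia.
Qed.

Lemma mode_vacuum_mem (I : set V) x (k : nat) : is_subspace I ->
  (forall y, I y -> I (Lm1 y)) -> I x -> I (mode x (- k.+1%:Z) vacuum).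
Proof.
move=> sI IL Ix; elim: k => [|k IHk]; first by rewrite mode_creation.
have k0 : (k.+1%:R : K) != 0 by rewrite pnatr_eq0.
have := IL _ IHk; rewrite -mode_vacuum_Lm1 => /(subspaceZ (k.+1%:R)^-1 sI).
by rewrite scalerA mulVf // scale1r.
Qed.

(** Borcherds identity on the vacuum with [m = -1], [n = 0]. The usual [L(-1)^i x / i!] is kept in
    the form [x_(-i-1) 1], and [zbinom (-1) i] is the sign [(-1)^i]. *)
Lemma skew_symmetry u v (l : int) : exists J0 : nat, forall J, (J0 <= J)%N ->
  mode v l u = \sum_(i < J) (- (-1) ^ l * zbinom (-1) i) *:
    mode (mode u (l + i%:Z) v) (- i.+1%:Z) vacuum.
Proof.
have [J0 H] := borcherds u v vacuum l (-1) 0; exists J0.+1 => J J0J.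
have := H J (ltnW J0J).
case: J J0J => // J J0J; rewrite [RHS]big_ord_recl [X in _ = _ + X]big1 => [|i _]; last first.
  rewrite (mode_creation_ge0 v) ?(mode_creation_ge0 u) ?mode0r ?scaler0 ?subr0 ?scaler0 //.
rewrite /= expr0 mul1r zbinom0 scale1r !addr0.
rewrite mode_creation mode_creation_ge0 // mode0r sub0r => E.
have s2 : (-1) ^ l * (-1) ^ l = 1 :> K by rewrite -expfzMl mulN1r opprK exp1rz.
transitivity (- (-1) ^ l *: - ((-1) ^ l *: mode v l u)).
  by rewrite scaleNr scalerN opprK scalerA s2 scale1r.
rewrite -E scaler_sumr; apply: eq_bigr => i _; rewrite scalerA.
by rewrite (_ : -1 - i%:Z = - i.+1%:Z) //; lia.
Qed.

(** Skew symmetry turns right multiplication into left multiplication followed by powers of [L(-1)],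
    itself a mode. *)
Lemma left_ideal_ideal u : is_ideal (left_ideal u).
Proof.
have sI : is_subspace (left_ideal u) by exact: span_subspace.
split=> // v m x Ix; split; first exact: left_ideal_mode.
have [J H] := skew_symmetry v x m; rewrite (H J) //.
apply: (subspace_sum sI) => i _; apply: (subspaceZ _ sI).
apply: (@mode_vacuum_mem (left_ideal u)) => // [y|]; first exact: left_ideal_mode.
exact: left_ideal_mode.
Qed.

Hypotheses (p_gt0 : (0 < p)%N) (sigmap : iter p sigma =1 id).

(** [V] being simple, some [w_n u] has a nonzero component along the vacuum. *)
Lemma vacuum_pair u h lam : lam ^+ p = 1 -> hom (sigma := sigma) h lam u -> u != 0 ->
  exists a n, sigma a = lam^-1 *: a /\ mode a n u = vacuum.
Proof.
move=> lp [hu su] u0; apply: contrapT => none.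
have Iu : left_ideal u u.
  apply: span_incl; exists vacuum, (-1); by rewrite mode_vacuum eqxx.
have IT : left_ideal u vacuum.
  have [E|->//] := simpleV.2 _ (left_ideal_ideal u).
  by move: Iu; rewrite E => /eqP; rewrite (negbTE u0).
suff : [set 0 : V] (wproj 0 vacuum).
  by rewrite (wproj_id weight_vacuum) => /eqP; rewrite (negbTE vacuum_neq0).
have s0 : is_subspace [set 0 : V].
  by split=> // a x y -> ->; rewrite scaler0 addr0.
move: vacuum IT; apply: (span_image (f := wproj 0) s0) => _ [w [n ->]].
change (wproj 0 (mode w n u) = 0).
have sP := preim_subspace (wproj 0) s0.
move: w (homs_span p_gt0 sigmap w).
apply: (span_model (U := wproj 0 @^-1` [set 0]) sP) => w [k [mu [mp [kw sw]]]].
rewrite /preimage /= (wproj_hom _ (weight_mode n kw hu)).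
case: eqP => // E; have := weight_mode n kw hu; rewrite -E => /(weight_zero cft)[c Ec].
have [c0|c0] := eqVneq c 0; first by rewrite Ec c0 scale0r.
exfalso; apply: none; exists (c^-1 *: w), n.
split; last by rewrite modeZl Ec scalerA mulVf // scale1r.
rewrite linearZ /= sw.
(* As [sigma] fixes the vacuum, a nonzero multiple of it has eigenvalue [mu * lam = 1]. *)
have := congr1 sigma Ec; rewrite (sigma_mode _ sw su) linearZ /= aut_vacuum Ec scalerA.
move=> /eqP; rewrite -subr_eq0 -scalerBl scaler_eq0 (negbTE vacuum_neq0) orbF.
rewrite -{2}[c]mul1r -mulrBl mulf_eq0 (negbTE c0) orbF subr_eq0 => /eqP ml.
have l0 := root_neq0 p_gt0 lp.
have -> : mu = lam^-1 by rewrite -[mu](mulfK l0) ml mul1r.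
by rewrite !scalerA mulrC.
Qed.

End VacuumPair.

(** * The eigenspaces as modules over the fixed points *)

Section Absorption.
Context {R : realType} {V : voa R} {sigma : voa_aut V} {p : nat}.
Local Notation K := (R[i]).
Local Notation Hom := (@hom R V sigma).
Implicit Types (u v w x y : V) (h k : int) (lam mu : K).

(** [C_2] of the eigenspace of [mu], as a module over the fixed points *)
Definition C2T mu : set V := span [set x | exists h k a y,
  [/\ 0 < h, Hom h 1 a, Hom k mu y & x = mode a (-2) y]].

Definition C1T mu : set V := span [set x |
  (exists h k a y, [/\ 0 < h, Hom h 1 a, Hom k mu y & x = mode a (-1) y]) \/
  (exists k y, Hom k mu y /\ x = Lm1 y)].

Lemma C2T_subspace mu : is_subspace (C2T mu).
Proof. exact: span_subspace. Qed.

Lemma C1T_subspace mu : is_subspace (C1T mu).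
Proof. exact: span_subspace. Qed.

Lemma C2T_C1T mu : C2T mu `<=` C1T mu.
Proof.
apply: span_min; first exact: C1T_subspace.
move=> _ [h [k [a [y [h0 ha ky ->]]]]]; apply: span_incl; left.
exists (h + 1), k, (Lm1 a), y; split=> //; [by lia|exact: hom_Lm1|].
by rewrite mode_Lm1 scaleN1r opprK.
Qed.

Hypotheses (cft : cft_type V) (simpleV : voa_simple V).
Hypotheses (p_gt0 : (0 < p)%N) (sigmap : iter p sigma =1 id).

Lemma hom_weight_le0 h a : h <= 0 -> weight_space V h a -> exists c, a = c *: vacuum.
Proof.
move=> h0 ha; have [hn|hp|E] := ltrgtP h 0.
- by exists 0; rewrite scale0r (weight_neg cft hn ha).
- by lia.
- by apply: (weight_zero cft); rewrite -E.
Qed.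

(** Homogeneous components reduce to generators; indices below [-2] come from [L(-1)]-derivatives,
    and weights at most [0] only give multiples of the vacuum. *)
Lemma C2T_absorbing mu : mu ^+ p = 1 -> absorbing (sigma := sigma) mu (C2T mu).
Proof.
move=> mp x n y sx sy n2; have sU := C2T_subspace mu.
have {}sx : sigma x = 1 *: x by rewrite scale1r.
have one : (1 : K) ^+ p = 1 by rewrite expr1n.
move: sx => /(eigen_homs_span p_gt0 sigmap one).
move: x; apply: (span_model sU) => x [h hx].
move: sy => /(eigen_homs_span p_gt0 sigmap mp).
move: y; apply: (span_moder sU) => y [k ky].
have [m -> {n n2}] : exists m : nat, n = - m.+2%:Z by exists (`|n|.-2); lia.
elim: m h x hx => [|m IHm] h x hx.
  have [h0|h0] := ltP 0 h; first by apply: span_incl; exists h, k, x, y.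
  have [c ->] := hom_weight_le0 h0 hx.1.
  by rewrite modeZl mode_vacuum scaler0; exact: (subspace0 sU).
have := IHm _ _ (hom_Lm1 hx); rewrite mode_Lm1 mulrNz scaleNr opprK.
rewrite (_ : - m.+2%:Z - 1 = - m.+3%:Z); last by lia.
have c0 : (m.+2%:Z%:~R : K) != 0 by rewrite intr_eq0.
by move=> /(subspaceZ (m.+2%:Z%:~R)^-1 sU); rewrite scalerA mulVf // scale1r.
Qed.

Definition word (s : seq (V * int)) : V :=
  foldr (fun q => mode q.1 q.2) vacuum s.

(** For each [u_j], [p] pairs of labels [a_j], [u_j] with [(a_j)_m u_j = 1] are appended. With
    indices [m] and [-1] such a pair fixes the vacuum, and its eigenvalues cancel, so neither the
    word nor [mu] changes; but every label now has the companions required by [words_plus_span]. *)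
Theorem words_finite (us : seq (V * K)) :
  {in us, forall q, [/\ q.2 ^+ p = 1, q.1 != 0 & exists h, Hom h q.2 q.1]} ->
  exists F, forall ns : seq int, size ns = size us ->
    plus_span (C2T (\prod_(q <- us) q.2)) F (word (zip (map fst us) ns)).
Proof.
move=> Hus; pose r := size us; set mu := \prod_(q <- us) q.2.
pose vc j := (nth (0, 1) us j).1; pose ev j := (nth (0, 1) us j).2.
have Hj j : (j < r)%N -> [/\ ev j ^+ p = 1, vc j != 0 & exists h, Hom h (ev j) (vc j)].
  by move=> jr; apply: Hus; apply: mem_nth.
have ev0 j : (j < r)%N -> ev j != 0 by move=> /Hj[/(root_neq0 p_gt0)].
have mup : mu ^+ p = 1.
  by rewrite /mu -prodrXl big_seq big1 // => q /Hus[].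
have pairs j : exists am : V * int, (j < r)%N ->
    sigma am.1 = (ev j)^-1 *: am.1 /\ mode am.1 am.2 (vc j) = vacuum.
  have [jr|jr] := boolP (j < r)%N; last by exists (0, 0).
  have [evp vc0 [h hv]] := Hj j jr.
  have [a [n [sa an]]] := vacuum_pair cft simpleV p_gt0 sigmap evp hv vc0.
  by exists (a, n).
have [am amP] := choice pairs.
(* [None] marks the original letter; [Some (q, b)] is in the [q]-th spare pair, with [b = false] for
   [a_j] and [b = true] for [u_j]. *)
pose L := (nat * option (nat * bool))%type.
pose uL (i : L) := if i.2 is Some (_, false) then (am i.1).1 else vc i.1.
pose chi (i : L) := if i.2 is Some (_, false) then (ev i.1)^-1 else ev i.1.
pose nL (ns : seq int) (i : L) : int := match i.2 with
  | Some (_, false) => (am i.1).2 | Some _ => -1 | None => nth 0 ns i.1 end.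
pose l1 : seq L := [seq (j, None) | j <- iota 0 r].
pose jq := [seq (j, q) | j <- iota 0 r, q <- iota 0 p].
pose l2 : seq L := [seq (z.1, Some (z.2, b)) | z <- jq, b <- [:: false; true]].
have jqP (z : nat * nat) : (z \in jq) = (z.1 < r)%N && (z.2 < p)%N.
  apply/allpairsP/andP => [[[a b] /= [ar bp ->]]|[xr xp]].
    by move: ar bp; rewrite !mem_iota.
  by exists z; rewrite !mem_iota; case: z xr xp.
have l1P i : (i \in l1) = (i.1 < r)%N && (i.2 == None).
  apply/mapP/andP => [[j + ->]|[ir /eqP i2]]; first by rewrite mem_iota.
  by exists i.1; rewrite ?mem_iota //; case: i i2 {ir} => ? ? /= ->.
have l2P i : (i \in l2) = (i.1 < r)%N && (if i.2 is Some (q, _) then q < p else false)%N.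
  apply/allpairsP/andP => [[[x b] /= [xjq _ ->]]|[ir i2]].
    by move: xjq; rewrite jqP => /andP[].
  case: i ir i2 => j [[q b]|] //= jr qp; exists ((j, q), b).
  by rewrite /= jqP jr qp; split=> //; case: b.
have lr i : i \in l1 ++ l2 -> (i.1 < r)%N.
  by rewrite mem_cat l1P l2P => /orP[]/andP[].
have ul : uniq (l1 ++ l2).
  rewrite cat_uniq; apply/and3P; split.
  - by rewrite map_inj_uniq ?iota_uniq // => i j [].
  - by apply/hasPn => -[j [[q b]|]]; rewrite /= l1P l2P /= ?andbF.
  - apply: allpairs_uniq => //; last by move=> [[? ?] ?] [[? ?] ?] _ _ /= [-> -> ->].
    by apply: allpairs_uniq; rewrite ?iota_uniq // => -[? ?] [? ?] _ _ /= [-> ->].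
have prodl : \prod_(i <- l1 ++ l2) chi i = mu.
  rewrite big_cat /= [X in _ * X](_ : _ = 1).
    rewrite mulr1 big_map /mu (big_nth (0, 1)) -/r.
    by rewrite -[iota 0 r]/(iota 0 r) -[X in iota 0 X]subn0.
  rewrite big_allpairs_dep /= big_seq big1 // => x; rewrite jqP => /andP[xr _].
  by rewrite big_cons big_seq1 /chi /= mulVf // ev0.
have [F FP] : exists F, forall n,
    plus_span (C2T mu) F (apply_word uL (l1 ++ l2) n vacuum).
  apply: (@words_plus_span _ _ _ sigma _ _ _ chi) (C2T_subspace mu) _ ul _ prodl _.
  - exact: C2T_absorbing.
  - move=> i il; have ir := lr _ il; have [_ _ [h [_ sv]]] := Hj _ ir.
    have [sa _] := amP _ ir.
    by rewrite /uL /chi; case: (i.2) => [[q []]|].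
  - move=> i il; have ir := lr _ il; have [evp _ _] := Hj _ ir.
    (* [b] tells whether the label [i] carries a [u_j]; the block consists of the [p] spare labels
       of the same kind, and [j] is a spare label of the opposite kind. *)
    pose b := if i.2 is Some (_, false) then false else true.
    have chib : chi i = if b then ev i.1 else (ev i.1)^-1.
      by rewrite /chi /b; case: (i.2) => [[q []]|].
    exists (i.1, Some (0%N, ~~ b)), [seq (i.1, Some (q, b)) | q <- iota 0 p].
    split.
    + by rewrite -size_eq0 size_map size_iota -lt0n.
    + by rewrite map_inj_uniq ?iota_uniq // => q q' [].
    + move=> h /mapP[q]; rewrite mem_iota => /andP[_ qp] ->.
      by rewrite mem_cat l2P /= ir qp orbT.
    + split.
      * by rewrite mem_cat l2P /= ir p_gt0 orbT.
      * by apply/mapP => -[q _ [_]]; case: (b).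
      * by rewrite /b; case: i {il ir evp b chib} => j [[q []]|] //=; apply/eqP => -[].
      * split.
        - move=> h /mapP[q _ ->]; rewrite chib /chi /=; by case: (b).
        - rewrite chib /chi /=; case: (b) => /=; first by rewrite mulVf // ev0.
          by rewrite mulfV // ev0.
        - rewrite size_map size_iota chib; case: (b) => //.
          by rewrite exprVn evp invr1.
exists F => ns sns; have := FP (nL ns).
(* In each pair [u_j] acts first with index [-1] and creates [u_j], which [a_j] sends back to the
   vacuum. *)
rewrite apply_word_cat (_ : apply_word uL l2 _ _ = vacuum); last first.
  have : {in jq, forall z : nat * nat, (z.1 < r)%N} by move=> z; rewrite jqP => /andP[].
  rewrite /l2; elim: (jq) => // z s IHs zr.
  rewrite /= /apply_word /= -/(apply_word uL (flatten _) (nL ns) vacuum) IHs.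
    rewrite /uL /nL /= mode_creation.
    by have [] := amP z.1 (zr z (mem_head _ _)).
  by move=> y ys; apply: zr; rewrite inE ys orbT.
congr (plus_span _ _ _).
have E (s : seq nat) : {subset s <= iota 0 r} -> apply_word uL [seq (j, None) | j <- s] (nL ns) vacuum =
    word [seq (vc j, nth 0 ns j) | j <- s].
  by elim: s => // j s IHs sr; rewrite /apply_word /= -/(apply_word _ _ _ _) IHs // => i si; apply: sr; rewrite inE si orbT.
rewrite E //; congr word.
apply: (@eq_from_nth _ (0, 0)) => [|j].
  by rewrite size_map size_iota size_zip size_map sns minnn.
rewrite size_map size_iota => jr.
rewrite (nth_map 0%N) ?size_iota // nth_iota // nth_zip ?size_map // (nth_map (0, 1)) //.
Qed.

End Absorption.

(** * The weight filtration and [C_1]-cofiniteness of the eigenspaces *)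

Section Filtration.
Context {R : realType} {V : voa R} {sigma : voa_aut V} {p : nat}.
Hypotheses (cft : cft_type V).
Local Notation K := (R[i]).
Local Notation Hom := (@hom R V sigma).
Implicit Types (u v w x y : V) (h k n d e : int) (lam mu nu : K).

(** [lmode = m] encodes the index [-m-1], so letters are always negative modes. *)
Record letter := Letter { lvec : V; lmode : nat; lwt : int; leig : K }.
HB.instance Definition _ := gen_eqMixin letter.
Implicit Types (a b : letter) (s t : seq letter).

Definition valid a :=
  [/\ 0 < lwt a, Hom (lwt a) (leig a) (lvec a) & leig a ^+ p = 1].

Definition letter_op a y := mode (lvec a) (- (lmode a).+1%:Z) y.
Definition sapp s y := foldr letter_op y s.
(** Only the weights of the vectors count, not the mode indices, so [swt s] is in general smaller
    than the weight of the element [s] creates. *)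
Definition swt s : int := \sum_(a <- s) lwt a.
Definition seig s : K := \prod_(a <- s) leig a.

Lemma swt_cons a s : swt (a :: s) = lwt a + swt s.
Proof. exact: big_cons. Qed.

Lemma seig_cons a s : seig (a :: s) = leig a * seig s.
Proof. exact: big_cons. Qed.

(** The graded space associated with this filtration is commutative. *)
Definition G d mu : set V := span [set x | exists s,
  [/\ {in s, forall a, valid a}, swt s <= d, seig s = mu & x = sapp s vacuum]].

Lemma G_subspace d mu : is_subspace (G d mu).
Proof. exact: span_subspace. Qed.

Lemma G_mono d e mu : d <= e -> G d mu `<=` G e mu.
Proof.
move=> de; apply: span_mono => _ [s [vs sd se ->]]; exists s; split=> //.
exact: le_trans de.
Qed.

Lemma swt_ge0 s : {in s, forall a, valid a} -> 0 <= swt s.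
Proof.
by move=> vs; rewrite /swt big_seq sumr_ge0 // => a /vs[/ltW].
Qed.

Lemma G_neg d mu : d < 0 -> G d mu `<=` [set 0].
Proof.
move=> d0; apply: span_min.
  by split=> // c u v -> ->; rewrite scaler0 addr0.
by move=> x [s [vs sd _ _]]; exfalso; have := swt_ge0 vs; lia.
Qed.

Lemma G_mode_lt0 u h lam d mu y n : lam ^+ p = 1 -> Hom h lam u -> G d mu y ->
  n < 0 -> G (d + h) (lam * mu) (mode u n y).
Proof.
move=> lp hu Gy n0; have sG := G_subspace (d + h) (lam * mu).
have [h0|h0] := ltP 0 h.
  move: y Gy; apply: (span_moder sG) => _ [s [vs sd <- ->]].
  have [m nm] : exists m : nat, n = - m.+1%:Z by exists `|n|.-1; lia.
  apply: span_incl; exists (Letter u m h lam :: s); split.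
  - by move=> a; rewrite inE => /orP[/eqP ->|/vs].
  - by rewrite swt_cons /= addrC lerD2r.
  - by rewrite seig_cons.
  - by rewrite nm.
have [u0|u0] := eqVneq u 0; first by rewrite u0 mode0l; exact: (subspace0 sG).
have hE : h = 0.
  apply/eqP; rewrite eq_le h0 leNgt; apply/negP => hn.
  by move: u0; rewrite (weight_neg cft hn hu.1) eqxx.
move: hu; rewrite hE => -[hu su]; have [c Ec] := weight_zero cft hu.
have c0 : c *: (vacuum : V) != 0 by rewrite -Ec.
have l1 : lam = 1.
  move: su; rewrite Ec linearZ /= aut_vacuum scalerA => /eqP.
  rewrite -subr_eq0 -scalerBl -{1}[c]mul1r -mulrBl -scalerA scaler_eq0 (negbTE c0) orbF.
  by rewrite subr_eq0 => /eqP.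
rewrite l1 addr0 mul1r Ec modeZl mode_vacuum.
apply: (subspaceZ _ (G_subspace _ _)); case: eqP => // _.
exact: (subspace0 (G_subspace _ _)).
Qed.

Lemma rootM lam mu : lam ^+ p = 1 -> mu ^+ p = 1 -> (lam * mu) ^+ p = 1.
Proof. by move=> lp mp; rewrite exprMn lp mp mulr1. Qed.

(** Moving [u_n] to the vacuum, which it kills, produces commutators with [u_i a] for [i >= 0], of
    weight at most [h + wt a - 1]: one degree is lost. *)
Lemma G_mode_ge0 u h lam d mu y n : lam ^+ p = 1 -> Hom h lam u -> G d mu y ->
  0 <= n -> G (d + h - 1) (lam * mu) (mode u n y).
Proof.
move=> lp hu Gy n0; have sG := G_subspace (d + h - 1) (lam * mu).
move: y Gy; apply: (span_moder sG) => _ [s [vs sd smu ->]].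
suff : G (swt s + h - 1) (lam * seig s) (mode u n (sapp s vacuum)).
  by rewrite smu; apply: G_mono; lia.
clear sG sd smu d mu.
elim: s vs u h lam lp hu n n0 => [|a s IHs] vs u h lam lp hu n n0.
  by rewrite mode_creation_ge0 //; exact: (subspace0 (G_subspace _ _)).
have va : valid a by apply: vs; rewrite mem_head.
have {}vs : {in s, forall a, valid a} by move=> b bs; apply: vs; rewrite inE bs orbT.
have [a0 ha ap] := va.
set sE := seig _; have sEE : sE = leig a * seig s by rewrite /sE seig_cons.
set sW := swt _; have sWE : sW = lwt a + swt s by rewrite /sW swt_cons.
have sG := G_subspace (sW + h - 1) (lam * sE).
rewrite [sapp _ _]/= /letter_op -/(sapp _ _).
have [J H] := borcherds_commutator u (lvec a) (sapp s vacuum) n (- (lmode a).+1%:Z).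
rewrite -(subrK (mode (lvec a) (- (lmode a).+1%:Z) (mode u n (sapp s vacuum)))
  (mode u n _)) (H J) //; apply: (subspaceD sG); last first.
  have := G_mode_lt0 ap ha (IHs vs _ _ _ lp hu _ n0) (n := - (lmode a).+1%:Z) isT.
  by rewrite sEE sWE mulrCA; apply: G_mono; lia.
apply: (subspace_sum sG) => i _; apply: (subspaceZ _ sG).
have hi := hom_mode i%:Z hu ha; have ip := rootM lp ap.
have Gs : G (swt s) (seig s) (sapp s vacuum) by apply: span_incl; exists s.
rewrite sEE mulrA sWE; set m := n + _ - _; have [m0|m0] := ltP m 0.
  by apply: G_mono (G_mode_lt0 ip hi Gs m0); lia.
by apply: G_mono (IHs vs _ _ _ ip hi _ m0); lia.
Qed.

Lemma G_mode_any u h lam d mu y n : lam ^+ p = 1 -> Hom h lam u -> G d mu y ->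
  G (d + h) (lam * mu) (mode u n y).
Proof.
move=> lp hu Gy; have [n0|n0] := ltP n 0; first exact: G_mode_lt0.
by apply: G_mono (G_mode_ge0 lp hu Gy n0); lia.
Qed.

Lemma G_vacuum : G 0 1 vacuum.
Proof.
apply: span_incl; exists [::]; split=> //; first by rewrite /swt big_nil.
by rewrite /seig big_nil.
Qed.

Lemma G_hom h lam u : lam ^+ p = 1 -> Hom h lam u -> G h lam u.
Proof.
move=> lp hu; have := G_mode_lt0 lp hu G_vacuum (n := -1) isT.
by rewrite add0r mulr1 mode_creation.
Qed.

Lemma sapp_cat s t y : sapp (s ++ t) y = sapp s (sapp t y).
Proof. exact: foldr_cat. Qed.

Lemma sapp_G s d mu y : {in s, forall a, valid a} -> G d mu y ->
  G (swt s + d) (seig s * mu) (sapp s y).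
Proof.
elim: s => [|a s IHs] vs Gy; first by rewrite /swt /seig !big_nil add0r mul1r.
have [_ ha ap] : valid a by apply: vs; rewrite mem_head.
have {}IHs := IHs (fun b bs => vs b (mem_behead (s := a :: s) bs)) Gy.
rewrite swt_cons seig_cons -mulrA.
by apply: G_mono (G_mode_any _ ap ha IHs); lia.
Qed.

Lemma sapp_is_linear s : linear (sapp s).
Proof.
elim: s => // a s IHs c u v; rewrite /sapp /= -!/(sapp s _) IHs /letter_op.
exact: linearP.
Qed.
HB.instance Definition _ s := GRing.isLinear.Build K V V _ (sapp s) (sapp_is_linear s).

(** Extends the previous bounds from homogeneous vectors to elements of the filtration, by the
    iterate formula and induction on the word creating [x]. *)
Lemma G_mode x d mu y e nu n : G d mu x -> G e nu y ->
  G (d + e) (mu * nu) (mode x n y) /\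
  (0 <= n -> G (d + e - 1) (mu * nu) (mode x n y)).
Proof.
move=> Gx Gy.
suff H s : {in s, forall a, valid a} -> forall e nu y n, G e nu y ->
    G (swt s + e) (seig s * nu) (mode (sapp s vacuum) n y) /\
    (0 <= n -> G (swt s + e - 1) (seig s * nu) (mode (sapp s vacuum) n y)).
  split=> [|n0]; (move: x Gx; apply: (span_model (G_subspace _ _)) =>
    _ [s [vs sd <- ->]]).
    by apply: G_mono (H s vs e nu y n Gy).1; lia.
  by apply: G_mono ((H s vs e nu y n Gy).2 n0); lia.
elim: s {d mu x e nu y n Gx Gy} => [|a s IHs] vs e nu y n Gy.
  rewrite /swt /seig !big_nil add0r mul1r mode_vacuum.
  split=> [|n0]; case: eqP => // E; try exact: (subspace0 (G_subspace _ _)); lia.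
have [_ ha ap] : valid a by apply: vs; rewrite mem_head.
have {}IHs := IHs (fun b bs => vs b (mem_behead (s := a :: s) bs)).
set sE := seig _; have sEE : sE = leig a * seig s by rewrite /sE seig_cons.
set sW := swt _; have sWE : sW = lwt a + swt s by rewrite /sW swt_cons.
rewrite [sapp _ _]/= /letter_op -/(sapp _ _).
have [J H] := borcherds_iterate (lvec a) (sapp s vacuum) y (- (lmode a).+1%:Z) n.
rewrite (H J) //.
have tail (i : nat) m : G (sW + e - 1) (sE * nu)
    (mode (sapp s vacuum) m (mode (lvec a) i%:Z y)).
  have Gi := G_mode_ge0 ap ha Gy (isT : 0 <= i%:Z).
  rewrite sEE mulrAC -mulrA mulrC -mulrA mulrCA [nu * _]mulrC.
  by apply: G_mono (IHs _ _ _ m Gi).1; lia.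
have head (i : nat) d : G d (seig s * nu) (mode (sapp s vacuum) (n + i%:Z) y) ->
    G (d + lwt a) (sE * nu) (mode (lvec a) (- (lmode a).+1%:Z - i%:Z)
      (mode (sapp s vacuum) (n + i%:Z) y)).
  by move=> Gi; rewrite sEE -mulrA; apply: G_mode_lt0 => //; lia.
split=> [|n0]; apply: (subspace_sum (G_subspace _ _)) => i _;
  apply: (subspaceZ _ (G_subspace _ _)); apply: (subspaceB (G_subspace _ _));
  try (apply: (subspaceZ _ (G_subspace _ _))).
- by apply: G_mono (head i _ (IHs _ _ _ _ Gy).1); lia.
- by apply: G_mono (tail i _); lia.
- by apply: G_mono (head i _ ((IHs _ _ _ _ Gy).2 _)); lia.
- by apply: G_mono (tail i _); lia.
Qed.

Lemma sapp_cons a s y : sapp (a :: s) y = letter_op a (sapp s y).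
Proof. by []. Qed.

Lemma valid_cons a s : {in a :: s, forall b, valid b} ->
  valid a /\ {in s, forall b, valid b}.
Proof.
move=> vs; split=> [|b bs]; first by apply: vs; rewrite mem_head.
by apply: vs; rewrite inE bs orbT.
Qed.

Lemma valid_cat s t : {in s ++ t, forall b, valid b} ->
  {in s, forall b, valid b} /\ {in t, forall b, valid b}.
Proof. by move=> vs; split=> b bs; apply: vs; rewrite mem_cat bs ?orbT. Qed.

(** In the iterate formula every term but the leading one contains a nonnegative mode and so drops
    in degree. *)
Lemma sapp_fuse s e nu y : {in s, forall a, valid a} -> G e nu y ->
  G (swt s + e - 1) (seig s * nu) (mode (sapp s vacuum) (-1) y - sapp s y).
Proof.
move=> vs Gy; elim: s vs => [|a s IHs] vs.
  by rewrite mode_vacuum eqxx subrr; exact: (subspace0 (G_subspace _ _)).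
have [[_ ha ap] vs'] := valid_cons vs; have {}IHs := IHs vs'.
have sG := G_subspace (swt (a :: s) + e - 1) (seig (a :: s) * nu).
rewrite swt_cons seig_cons in sG *.
have Gs : G (swt s) (seig s) (sapp s vacuum) by apply: span_incl; exists s.
rewrite !sapp_cons /letter_op.
set m := - (lmode a).+1%:Z.
have [J H] := borcherds_iterate (lvec a) (sapp s vacuum) y m (-1).
rewrite (H J.+1) // big_ord_recl /= expr0 mul1r zbinom0 scale1r subr0 addr0.
set X := (_ ^ m *: _); set S := \sum_(i < J) _.
have tail (i : nat) q : G (lwt a + swt s + e - 1) (leig a * seig s * nu)
    (mode (sapp s vacuum) q (mode (lvec a) i%:Z y)).
  have Gi := G_mode_ge0 ap ha Gy (isT : 0 <= i%:Z).
  rewrite mulrAC -mulrA mulrC -mulrA mulrCA [nu * _]mulrC.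
  by apply: G_mono (G_mode q Gs Gi).1; lia.
have E (a1 x1 s1 c1 : V) : a1 - x1 + s1 - c1 = (a1 - c1) + (s1 - x1).
  by rewrite addrAC [a1 - x1 - c1]addrAC -addrA [- x1 + s1]addrC.
rewrite E -linearB; apply: (subspaceD sG); last apply: (subspaceB sG).
- by rewrite -mulrA; apply: G_mono (G_mode_lt0 ap ha IHs _); lia.
- apply: (subspace_sum sG) => i _; apply: (subspaceZ _ sG); apply: (subspaceB sG).
    rewrite -mulrA; have Gi := (G_mode (-1 + (bump 0 i)%:Z) Gs Gy).2 isT.
    by apply: G_mono (G_mode_lt0 ap ha Gi _); rewrite /bump; lia.
  by apply: (subspaceZ _ sG); apply: tail.
- by rewrite /X; apply: (subspaceZ _ sG); apply: tail.
Qed.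

(** Each exchange of letters costs modes of [a_i b] with [i >= 0], of weight below [wt a + wt b]. *)
Lemma letter_op_sapp a s e nu y : valid a -> {in s, forall b, valid b} -> G e nu y ->
  G (lwt a + swt s + e - 1) (leig a * seig s * nu)
    (letter_op a (sapp s y) - sapp s (letter_op a y)).
Proof.
move=> va; have [_ ha ap] := va; elim: s => [|b s IHs] vs Gy.
  by rewrite subrr; exact: (subspace0 (G_subspace _ _)).
have [vb vs'] := valid_cons vs; have {}IHs := IHs vs' Gy.
have [_ hb bp] := vb.
rewrite swt_cons seig_cons; set U := G _ _.
have sU : is_subspace U by apply: G_subspace.
rewrite !sapp_cons.
rewrite -(subrK (letter_op b (letter_op a (sapp s y))) (letter_op a _)) -addrA.
apply: (subspaceD sU).
  rewrite /letter_op.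
  have [J H] := borcherds_commutator (lvec a) (lvec b) (sapp s y)
    (- (lmode a).+1%:Z) (- (lmode b).+1%:Z).
  rewrite (H J) //; apply: (subspace_sum sU) => i _; apply: (subspaceZ _ sU).
  have Gsy := sapp_G vs' Gy.
  have Gi := G_mode_lt0 (rootM ap bp) (hom_mode i%:Z ha hb) Gsy.
  rewrite /U -!mulrA [leig a * (leig b * _)]mulrA.
  by apply: G_mono (Gi _ _); lia.
rewrite /letter_op -linearB -!/(letter_op _ _) /U mulrCA -!mulrA mulrCA.
rewrite [leig a * (leig b * _)]mulrCA in sU *.
have := G_mode_lt0 bp hb IHs (n := - (lmode b).+1%:Z) isT.
by rewrite -!mulrA; apply: G_mono; lia.
Qed.

Lemma sapp_catC s t e nu y : {in s ++ t, forall b, valid b} -> G e nu y ->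
  G (swt s + swt t + e - 1) (seig s * seig t * nu)
    (sapp (s ++ t) y - sapp (t ++ s) y).
Proof.
elim: s => [|a s IHs] vst Gy.
  by rewrite cats0 subrr; exact: (subspace0 (G_subspace _ _)).
have [va vst'] := valid_cons vst; have {}IHs := IHs vst' Gy.
have [vs vt] := valid_cat vst'; have [_ ha ap] := va.
rewrite swt_cons seig_cons; set U := G _ _.
have sU : is_subspace U by apply: G_subspace.
rewrite cat_cons sapp_cons.
rewrite -(subrK (letter_op a (sapp (t ++ s) y)) (letter_op a _)) -addrA.
apply: (subspaceD sU).
  rewrite /letter_op -linearB /U.
  have := G_mode_lt0 ap ha IHs (n := - (lmode a).+1%:Z) isT.
  by rewrite !mulrA; apply: G_mono; lia.
rewrite !sapp_cat; have := letter_op_sapp va vt (sapp_G vs Gy).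
rewrite /U sapp_cons !mulrA [leig a * seig t * seig s]mulrAC.
by apply: G_mono; lia.
Qed.

Hypotheses (simpleV : voa_simple V) (C2V : C2_cofinite V).
Hypotheses (p_gt0 : (0 < p)%N) (sigmap : iter p sigma =1 id).
Local Notation C1 := (@C1T R V sigma).
Local Notation C2 := (@C2T R V sigma).

Lemma seig_root s : {in s, forall a, valid a} -> seig s ^+ p = 1.
Proof.
by move=> vs; rewrite /seig -prodrXl big_seq big1 // => a /vs[].
Qed.

Lemma seig_cat s t : seig (s ++ t) = seig s * seig t.
Proof. exact: big_cat. Qed.

Lemma swt_cat s t : swt (s ++ t) = swt s + swt t.
Proof. exact: big_cat. Qed.

(** Pigeonhole on the products of the prefixes, which are [p]-th roots of unity. *)
Lemma neutral_block s : {in s, forall a, valid a} -> (p <= size s)%N ->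
  exists s1 t s2, [/\ s = s1 ++ t ++ s2, t != [::] & seig t = 1].
Proof.
move=> vs ps; pose q := [seq seig (take j s) | j <- iota 0 p.+1].
have vtake j : {in take j s, forall a, valid a} by move=> a /mem_take/vs.
have : ~~ uniq q.
  apply/negP => uq; have : (size q <= p)%N.
    apply: max_unity_roots => //; apply/allP => _ /mapP[j _ ->].
    by apply/unity_rootP; apply: seig_root.
  by rewrite size_map size_iota ltnn.
move=> /(uniqPn 0)[i [j []]]; rewrite size_map size_iota => ij jp.
have ip := ltn_trans ij jp.
rewrite !(nth_map 0%N) ?size_iota // !nth_iota // !add0n => E.
have js : (j <= size s)%N by apply: leq_trans ps; rewrite -ltnS.
have Ej : take j s = take i s ++ drop i (take j s).
  by rewrite -{1}(cat_take_drop i (take j s)) take_takel // ltnW.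
exists (take i s), (drop i (take j s)), (drop j s); split.
- by rewrite catA -Ej cat_take_drop.
- by rewrite -size_eq0 size_drop size_takel // subn_eq0 -ltnNge.
have i0 := root_neq0 p_gt0 (seig_root (vtake i)).
by apply: (mulfI i0); rewrite -seig_cat -Ej mulr1.
Qed.

Lemma hom_sapp s k mu y : {in s, forall a, valid a} -> Hom k mu y ->
  exists2 h, swt s + k <= h & Hom h (seig s * mu) (sapp s y).
Proof.
elim: s => [|a s IHs] vs ky.
  by exists k; rewrite /swt /seig !big_nil ?add0r ?mul1r.
have [[_ ha _] vs'] := valid_cons vs; have [h hs hh] := IHs vs' ky.
exists (lwt a + h - - (lmode a).+1%:Z - 1); first by rewrite swt_cons; lia.
by rewrite seig_cons -mulrA; apply: hom_mode.
Qed.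

Lemma hom_split h u : weight_space V h u ->
  span [set x | exists2 lam, lam ^+ p = 1 & Hom h lam x] u.
Proof. exact: (hom_span p_gt0 sigmap). Qed.

Lemma eigen_eq x lam mu : sigma x = lam *: x -> sigma x = mu *: x -> x != 0 -> lam = mu.
Proof.
move=> -> /eqP; rewrite -subr_eq0 -scalerBl scaler_eq0 subr_eq0.
by move=> /orP[/eqP //|->].
Qed.

(** A product [v_(-2) w] has weight [wt v + wt w + 1] but filtration degree [wt v + wt w]; in large
    weight, [C_2]-cofiniteness makes every vector a sum of such products. *)
Lemma G_big_weight : exists N : nat, forall h lam u, N%:Z < h -> lam ^+ p = 1 ->
  Hom h lam u -> G (h - 1) lam u.
Proof.
have [N NP] := Cn_cofinite cft C2V (leqnn 2); exists N => h lam u Nh lp [hu su].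
have sG := G_subspace (h - 1) lam.
pose S : set V := [set x | exists k l la lb v w, [/\ la ^+ p = 1 /\ lb ^+ p = 1,
  Hom k la v, Hom l lb w, k + l + 1 = h & x = mode v (-2) w]].
have Su : span S u.
  have sS := @span_subspace K V S.
  have := Cn_weight hu (NP h u Nh hu).
  apply: span_min => // _ [k [l [v [w [k0 kv lw E ->]]]]].
  have := hom_split kv; move: v {kv}; apply: (span_model sS) => v [la lap kv].
  have := hom_split lw; move: w {lw}; apply: (span_moder sS) => w [lb lbp lw].
  by apply: span_incl; exists k, l, la, lb, v, w; split=> //; lia.
have Sh g : S g -> exists2 mu, mu ^+ p = 1 & sigma g = mu *: g.
  move=> [k [l [la [lb [v [w [[lap lbp] [_ sv] [_ sw] _ ->]]]]]]].
  by exists (la * lb); [apply: rootM|apply: sigma_mode].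
have := eigen_span p_gt0 Sh lp su Su.
apply: span_min => // _ [[k [l [la [lb [v [w [[lap lbp] kv lw E ->]]]]]]] /= sg].
have [->|g0] := eqVneq (mode v (-2) w) 0; first exact: (subspace0 sG).
have <- : la * lb = lam.
  by apply: eigen_eq sg g0; apply: sigma_mode; [case: kv|case: lw].
by apply: G_mono (G_mode_lt0 lap kv (G_hom lbp lw) _); lia.
Qed.

Lemma roots_seq : exists rts : seq K, forall lam, (lam \in rts) = (lam ^+ p == 1).
Proof.
have [z zp] := closed_prim_root_exists (complex R) p_gt0.
exists [seq z ^+ j | j <- iota 0 p] => lam; apply/mapP/eqP => [[j _ ->]|lp].
  by rewrite exprAC (prim_expr_order zp) expr1n.
by have [i ->] := prim_rootP zp lp; exists (i : nat); rewrite ?mem_iota ?add0n /=.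
Qed.

(** Zero is filtered out of the list because [words_finite] pairs every letter with a partner
    producing the vacuum. *)
Lemma small_letters (N : nat) : exists S : seq (V * K),
  {in S, forall q, [/\ q.2 ^+ p = 1, q.1 != 0 & exists h, Hom h q.2 q.1]} /\
  forall h lam u, 0 <= h -> h <= N%:Z -> lam ^+ p = 1 -> Hom h lam u ->
    span [set x | (x, lam) \in S] u.
Proof.
have [rts rtsP] := roots_seq.
have H (hl : nat * K) : exists t : seq V, Hom hl.1%:Z hl.2 = span [set` t].
  have [s sE] := voa_grading_fin (voaP V) hl.1%:Z.
  apply: (@finite_dim_sub _ _ s); first exact: hom_subspace.
  by move=> x [hx _]; rewrite -sE.
have [f fP] := choice H.
pose S := flatten [seq flatten [seq [seq (x, lam) | x <- f (m, lam) & x != 0]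
  | lam <- rts] | m : nat <- iota 0 N.+1].
have SP x lam : ((x, lam) \in S) =
    [exists h : 'I_N.+1, (x \in f (h : nat, lam)) && (x != 0)] && (lam ^+ p == 1).
  apply/flattenP/andP.
    move=> [_ /mapP[h hN ->]] /flattenP[_ /mapP[mu mrts ->]] /mapP[y].
    rewrite mem_filter => /andP[y0 yf] [-> ->]; rewrite -rtsP; split=> //.
    move: hN; rewrite mem_iota add0n /= => hN.
    by apply/existsP; exists (Ordinal hN); rewrite /= yf y0.
  move=> [/existsP[h /andP[xf x0]] lp].
  eexists; first by apply: map_f; rewrite mem_iota add0n /=; apply: (ltn_ord h).
  apply/flattenP; eexists; first by apply: map_f; rewrite rtsP; exact: lp.
  by apply: map_f; rewrite mem_filter x0.
exists S; split.
  move=> [x lam]; rewrite SP => /andP[/existsP[h /andP[xf x0]] /eqP lp].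
  split=> //=; exists (h : nat)%:Z.
  by rewrite -/((h : nat, lam).1) -[lam]/((h : nat, lam).2) fP; apply: span_incl.
move=> h lam u h0 hN lp hu.
have [m hm] : exists m : nat, h = m%:Z by exists `|h|%N; lia.
have mN : (m < N.+1)%N by lia.
have sS := @span_subspace K V.
have : span [set` f (m, lam)] u by rewrite -fP /= -hm.
apply: span_min => // x /= xf.
have [->|x0] := eqVneq x 0; first exact: (subspace0 (sS _)).
apply: span_incl; rewrite /= SP lp eqxx andbT.
by apply/existsP; exists (Ordinal mN); rewrite /= xf x0.
Qed.

Lemma small_words (S : seq (V * K)) (N : nat) s :
  (forall h lam u, 0 <= h -> h <= N%:Z -> lam ^+ p = 1 -> Hom h lam u ->
    span [set x | (x, lam) \in S] u) ->
  {in s, forall a, valid a} -> {in s, forall a, lwt a <= N%:Z} ->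
  span [set x | exists us ns, [/\ size us = size s, {subset us <= S},
    map snd us = map leig s, size ns = size us & x = word (zip (map fst us) ns)]]
    (sapp s vacuum).
Proof.
move=> SP; elim: s => [|a s IHs] vs sN.
  by apply: span_incl; exists [::], [::].
have [[a0 ha ap] vs'] := valid_cons vs.
have sN' : {in s, forall a, lwt a <= N%:Z}.
  by move=> b bs; apply: sN; rewrite inE bs orbT.
have {}IHs := IHs vs' sN'.
set Y := span _; have sY : is_subspace Y by apply: span_subspace.
rewrite sapp_cons /letter_op.
have := SP _ _ _ (ltW a0) (sN a (mem_head _ _)) ap ha; move: (lvec a) => v.
move: v; apply: (span_model sY) => v /= vS.
move: (sapp s vacuum) IHs; apply: (span_moder sY) => _ [us [ns [sz us_S e zn ->]]].
apply: span_incl; exists ((v, leig a) :: us), (- (lmode a).+1%:Z :: ns).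
split=> //=; [by rewrite sz| |by rewrite e|by rewrite zn].
by move=> q; rewrite inE => /orP[/eqP ->|/us_S].
Qed.

Definition lists (S : seq (V * K)) (k : nat) : seq (seq (V * K)) :=
  iter k (fun ls => [seq q :: l | q <- S, l <- ls]) [:: [::]].

Lemma mem_lists (S : seq (V * K)) us : {subset us <= S} -> us \in lists S (size us).
Proof.
elim: us => // q us IHus sub; apply/allpairsP; exists (q, us); split=> //=.
  by apply: sub; rewrite mem_head.
by apply: IHus => x xus; apply: sub; rewrite inE xus orbT.
Qed.

(** Induction on the degree. A letter of weight above [N] lowers the degree. Among [p] letters there
    is a neutral block; moved to the front and fused, it gives [a_(-1) y] with [a] in [T], up to
    lower degree. What remains are words of fewer than [p] letters from a finite list, with
    arbitrary indices, and [words_finite] handles each list of vectors. *)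
Theorem G_C1T : exists F : seq V, forall d mu, mu ^+ p = 1 ->
  G d mu `<=` plus_span (C1 mu) F.
Proof.
have [N NP] := G_big_weight; have [S [Sh SP]] := small_letters N.
have H (us : seq (V * K)) : exists F : seq V, {subset us <= S} ->
    forall ns : seq int, size ns = size us ->
      plus_span (C2 (\prod_(q <- us) q.2)) F (word (zip (map fst us) ns)).
  have [usS|usS] := pselect {subset us <= S}; last by exists [::].
  have [F FP] := words_finite cft simpleV p_gt0 sigmap
    (fun q qus => Sh q (usS q qus)).
  by exists F.
have [f fP] := choice H.
pose F := flatten [seq f us | us <- flatten [seq lists S m | m : nat <- iota 0 p]].
exists F => d mu mp.
have sY := plus_span_subspace F (@C1T_subspace R V sigma mu).
suff IH (m : nat) e : e < m%:Z -> G e mu `<=` plus_span (C1 mu) F.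
  by apply: (IH `|d|.+1); lia.
elim: m e => [|m IHm] e em.
  by move=> x /(G_neg em) ->; exact: (subspace0 sY).
apply: span_min => // _ [s [vs se smu ->]].
have step e' x : e' < m%:Z -> G e' mu x -> plus_span (C1 mu) F x.
  by move=> em'; apply: IHm.
have [/hasP[a sa aN]|] := boolP (has (fun a => N%:Z < lwt a) s).
  case/splitPr: s / sa vs se smu => s1 s2 vs se smu.
  have [vs1 vas2] := valid_cat vs; have [[_ ha ap] vs2] := valid_cons vas2.
  apply: (step (swt (s1 ++ a :: s2) - 1)); first by lia.
  have Gs2 : G (swt s2) (seig s2) (sapp s2 vacuum) by apply: span_incl; exists s2.
  have Ga := (G_mode (- (lmode a).+1%:Z) (NP _ _ _ aN ap ha) Gs2).1.
  have := sapp_G vs1 Ga.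
  rewrite sapp_cat sapp_cons -smu seig_cat seig_cons; apply: G_mono.
  by rewrite swt_cat swt_cons; lia.
move=> /hasPn small; have [ps|sp] := leqP p (size s).
  have [s1 [t [s2 [sE t0 t1]]]] := neutral_block vs ps.
  subst s.
  have [vs1 vts2] := valid_cat vs; have [vt vs2] := valid_cat vts2.
  have Gs2 : G (swt s2) (seig s2) (sapp s2 vacuum) by apply: span_incl; exists s2.
  have vst : {in s1 ++ t, forall a, valid a}.
    by move=> a; rewrite mem_cat => /orP[/vs1|/vt].
  have Gy := sapp_G vs1 Gs2; set y := sapp s1 (sapp s2 vacuum) in Gy.
  have E1 := sapp_catC vst Gs2; have E2 := sapp_fuse vt Gy.
  have smu' : seig s1 * seig s2 = mu by rewrite -smu !seig_cat t1 mul1r.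
  rewrite t1 mulr1 smu' in E1; rewrite t1 mul1r smu' in E2.
  rewrite catA sapp_cat.
  rewrite -(subrK (sapp (t ++ s1) (sapp s2 vacuum)) (sapp (s1 ++ t) _)).
  apply: (subspaceD sY).
    by apply: step E1; rewrite !swt_cat in se; lia.
  rewrite [sapp (t ++ s1) _]sapp_cat -/y.
  rewrite -(subKr (mode (sapp t vacuum) (-1) y) (sapp t y)).
  apply: (subspaceB sY); last first.
    by apply: step E2; rewrite !swt_cat in se; lia.
  apply: plus_spanl; apply: span_incl; left.
  have [h1 hs1 Ht] := hom_sapp vt (@hom_vacuum R V sigma).
  have [h2 _ Hs2] := hom_sapp vs2 (@hom_vacuum R V sigma).
  have [h3 _ Hy] := hom_sapp vs1 Hs2.
  exists h1, h3, (sapp t vacuum), y; split=> //.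
  (* The block is nonempty and its letters have positive weight, as [C_1] demands of [a]. *)
  - apply: lt_le_trans hs1; rewrite addr0.
    case: t t0 vt {vts2 vs vst t1 se smu small ps E1 E2 Ht} => // a t _ vt.
    have [[a0 _ _] vt'] := valid_cons vt; have := swt_ge0 vt'.
    by rewrite swt_cons; lia.
  - by move: Ht; rewrite t1 mulr1.
  - by move: Hy; rewrite mulr1 smu'.
have sN : {in s, forall a, lwt a <= N%:Z}.
  by move=> a /small; rewrite -leNgt.
move: (small_words SP vs sN); move: (sapp s vacuum).
apply: span_min => // _ [us [ns [sus usS e1 sns ->]]].
have Emu : \prod_(q <- us) q.2 = mu.
  have : \prod_(x <- map snd us) x = \prod_(x <- map leig s) x by rewrite e1.
  by rewrite !big_map -smu.
have := fP us usS ns sns; rewrite Emu; apply: plus_span_mono; first exact: C2T_C1T.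
move=> v vf; apply/flatten_mapP; exists us => //.
apply/flatten_mapP; exists (size us); last exact: mem_lists.
by rewrite mem_iota add0n sus.
Qed.

End Filtration.

(** * The uniform bound and the cofiniteness of the fixed points *)

Section UniformBound.
Context {R : realType} {V : voa R} {sigma : voa_aut V} {p : nat}.
Hypotheses (cft : cft_type V) (simpleV : voa_simple V) (C2V : C2_cofinite V).
Hypotheses (p_gt0 : (0 < p)%N) (sigmap : iter p sigma =1 id).
Local Notation K := (R[i]).
Local Notation Hom := (@hom R V sigma).
Local Notation C1 := (@C1T R V sigma).
Local Notation C2 := (@C2T R V sigma).
Implicit Types (u v w x y : V) (h k : int) (lam mu : K).

Lemma span_wproj (S : set V) h x : (forall g, S g -> exists m, weight_space V m g) ->
  span S x -> span S (wproj h x).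
Proof.
move=> Sh; move: x; apply: span_image; first exact: span_subspace.
move=> g Sg; have [m mg] := Sh g Sg; rewrite /= (wproj_hom _ mg).
case: eqP => _; [exact: span_incl | exact: (subspace0 (span_subspace _))].
Qed.

Lemma weight_plus_span (S : set V) (F : seq V) :
  (forall g, S g -> exists m, weight_space V m g) ->
  exists N : nat, forall h x, N%:Z < h -> weight_space V h x ->
    plus_span (span S) F x -> span S x.
Proof.
move=> Sh; have [N NP] := wproj_far F; exists N => h x Nh hx [y Sy Fxy].
have E : wproj h x = wproj h y + wproj h (x - y) by rewrite -linearD addrC subrK.
by rewrite -(wproj_id hx) E (NP h _ Nh Fxy) addr0; apply: span_wproj.
Qed.

Lemma C1T_gens_weight mu x :
  (exists h k a y, [/\ 0 < h, Hom h 1 a, Hom k mu y & x = mode a (-1) y]) \/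
  (exists k y, Hom k mu y /\ x = Lm1 y) -> exists m, weight_space V m x.
Proof.
case=> [[h [k [a [y [_ [ha _] [ky _] ->]]]]]|[k [y [[ky _] ->]]]].
  by exists (h + k - -1 - 1); apply: weight_mode.
by exists (k + 1); apply: weight_Lm1.
Qed.

Lemma C2T_gens_weight mu x :
  (exists h k a y, [/\ 0 < h, Hom h 1 a, Hom k mu y & x = mode a (-2) y]) ->
  exists m, weight_space V m x.
Proof.
move=> [h [k [a [y [_ [ha _] [ky _] ->]]]]].
by exists (h + k - -2 - 1); apply: weight_mode.
Qed.

Lemma C1T_cofinite : exists N : nat, forall h lam x, N%:Z < h -> lam ^+ p = 1 ->
  Hom h lam x -> C1 lam x.
Proof.
have [F FP] := G_C1T cft simpleV C2V p_gt0 sigmap.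
have H lam : exists N : nat, forall h x, N%:Z < h -> weight_space V h x ->
    plus_span (C1 lam) F x -> C1 lam x.
  by apply: weight_plus_span; apply: C1T_gens_weight.
have [N NP] := choice H; have [rts rtsP] := @roots_seq R p p_gt0.
exists (\sum_(lam <- rts) N lam)%N => h lam x Nh lp hx.
apply: (NP lam h) => //; last by apply: (FP h) => //; apply: G_hom.
  apply: le_lt_trans Nh; rewrite lez_nat (big_rem lam) /= ?leq_addr //.
  by rewrite rtsP lp.
by case: hx.
Qed.

Lemma mode_C2T h k lam mu u v (n : int) : lam * mu = 1 -> Hom h lam u ->
  Hom k mu v -> sigma (mode u n v) = 1 *: mode u n v.
Proof. by move=> lm [_ su] [_ sv]; rewrite (sigma_mode _ su sv) lm. Qed.

Lemma fixed1 x : sigma x = 1 *: x -> sigma x = x.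
Proof. by rewrite scale1r. Qed.

Let abs1 := @C2T_absorbing R V sigma p cft p_gt0 sigmap 1 (expr1n _ _).

(** The commutator of [a_(-1)] with [b_(-2)] consists of modes [(a_i b)_(-3-i)], which are
    absorbed. *)
Lemma C2T_mode_m1 h a x : Hom h 1 a -> C2 1 x -> C2 1 (mode a (-1) x).
Proof.
move=> ha; have sC := @C2T_subspace R V sigma 1.
move: x; apply: (span_moder sC) => _ [k [l [b [c [_ kb lc ->]]]]].
have [J H] := borcherds_commutator a b c (-1) (-2).
rewrite -(subrK (mode b (-2) (mode a (-1) c)) (mode a _ _)) (H J) //.
apply: (subspaceD sC).
  apply: (subspace_sum sC) => i _; apply: (subspaceZ _ sC); apply: abs1; last by lia.
    by apply: fixed1; apply: mode_C2T ha kb; rewrite mulr1.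
  by case: lc.
apply: abs1 => //; first by apply: fixed1; case: kb.
by apply: mode_C2T ha lc; rewrite mulr1.
Qed.

(** [u_(-n) v] is the word [u_(-n) v_(-1) 1]. Its weight [h + k + n - 1] grows with [n] and leaves
    the finite exceptional list. *)
Lemma pair_bound h k lam mu u v : lam ^+ p = 1 -> mu ^+ p = 1 -> lam * mu = 1 ->
  u != 0 -> v != 0 -> Hom h lam u -> Hom k mu v ->
  exists N : nat, forall n : nat, (N <= n)%N -> C2 1 (mode u (- n%:Z) v).
Proof.
move=> lp mp lm u0 v0 hu kv.
have Hus : {in [:: (u, lam); (v, mu)], forall q : V * K,
    [/\ q.2 ^+ p = 1, q.1 != 0 & exists h, Hom h q.2 q.1]}.
  by move=> q; rewrite !inE => /orP[]/eqP -> /=; split=> //; [exists h|exists k].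
have [F FP] := words_finite cft simpleV p_gt0 sigmap Hus.
rewrite big_cons big_seq1 /= lm in FP.
have [N NP] := @weight_plus_span _ F (@C2T_gens_weight 1).
exists (`|(h + k)%R|.+2 + N)%N => n nN.
have uv := weight_mode (- n%:Z) hu.1 kv.1.
apply: (NP _ _ _ uv); first by lia.
by have := FP [:: - n%:Z; -1] erefl; rewrite /word /= mode_creation.
Qed.

(** Induction on [h + k]. A factor of weight above [N] lies in [C_1]; expanding [a_(-1) y] or
    [L(-1) y] leaves absorbed terms and pairs of smaller total weight whose index is still at most
    [-n], so [n0] never has to grow. Otherwise both factors come from the finite list [S]. *)
Theorem C2T_uniform : exists n0 : nat, (2 <= n0)%N /\
  forall h k lam mu u v, lam ^+ p = 1 -> mu ^+ p = 1 -> lam * mu = 1 ->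
  Hom h lam u -> Hom k mu v ->
  forall n : nat, (n0 <= n)%N -> C2 1 (mode u (- n%:Z) v).
Proof.
have sC := @C2T_subspace R V sigma 1.
have [N NP] := C1T_cofinite; have [S [Sh SP]] := @small_letters R V sigma p p_gt0 N.
have H (xy : (V * K) * (V * K)) : exists m : nat,
    xy.1 \in S -> xy.2 \in S -> xy.1.2 * xy.2.2 = 1 ->
    forall n : nat, (m <= n)%N -> C2 1 (mode xy.1.1 (- n%:Z) xy.2.1).
  case: xy => -[x lam] [y mu] /=.
  have [[xS yS lm]|no] := pselect [/\ (x, lam) \in S, (y, mu) \in S & lam * mu = 1]; last first.
    by exists 0%N => ? ? ?; exfalso; apply: no.
  have [lp x0 [h hx]] := Sh _ xS; have [mp y0 [k ky]] := Sh _ yS.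
  by have [m mP] := pair_bound lp mp lm x0 y0 hx ky; exists m.
have [m mP] := choice H.
pose n0 := (\sum_(x <- S) \sum_(y <- S) m (x, y)).+2.
exists n0; split=> //.
suff IH (r : nat) h k : h + k < r%:Z -> forall lam mu u v, lam ^+ p = 1 ->
    mu ^+ p = 1 -> lam * mu = 1 -> Hom h lam u -> Hom k mu v ->
    forall n : nat, (n0 <= n)%N -> C2 1 (mode u (- n%:Z) v).
  by move=> h k; apply: (IH `|(h + k)%R|.+1); lia.
elim: r h k => [|r IHr] h k hkr lam mu u v lp mp lm hu kv n nn0.
  have [h0|h0] := ltP h 0.
    by rewrite (weight_neg cft h0 hu.1) mode0l; exact: (subspace0 sC).
  have k0 : k < 0 by lia.
  by rewrite (weight_neg cft k0 kv.1) mode0r; exact: (subspace0 sC).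
(* Stated for arbitrary data because it is also applied with the two factors exchanged. *)
have big h' k' lam' mu' u' v' : h' + k' < r.+1%:Z -> N%:Z < h' -> lam' ^+ p = 1 ->
    mu' ^+ p = 1 -> lam' * mu' = 1 -> Hom h' lam' u' -> Hom k' mu' v' ->
    C2 1 (mode u' (- n%:Z) v').
  move=> {hkr lp mp lm hu kv h k lam mu u v} hkr Nh lp mp lm hu kv.
  have := weight_span (@C1T_gens_weight lam') hu.1 (NP _ _ _ Nh lp hu).
  move: u' {hu}; apply: (span_model sC) => u [gu hu].
  have [->|u0] := eqVneq u 0; first by rewrite mode0l; exact: (subspace0 sC).
  have wt l : weight_space V l u -> l = h'.
    move=> lu; apply/eqP/negP => /negP lh.
    by move: u0; rewrite (weight_uniq lu hu lh) eqxx.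
  case: gu => [[i [j [a [y [i0 ia jy uE]]]]]|[j [y [jy uE]]]]; last first.
    rewrite uE mode_Lm1; apply: (subspaceN sC); apply: (subspaceZ _ sC).
    rewrite (_ : - n%:Z - 1 = - n.+1%:Z); last by lia.
    have E : j + 1 = h' by apply: wt; rewrite uE; apply: weight_Lm1; case: jy.
    by apply: (IHr j k' _ lam' mu') => //; lia.
  have E : i + j - -1 - 1 = h'.
    by apply: wt; rewrite uE; apply: weight_mode; [case: ia|case: jy].
  rewrite uE; have [J HJ] := borcherds_iterate a y v' (-1) (- n%:Z).
  rewrite (HJ J) //; apply: (subspace_sum sC) => q _; apply: (subspaceZ _ sC).
  apply: (subspaceB sC).
    case: (nat_of_ord q) => [|q'].
      rewrite subr0 addr0; apply: (C2T_mode_m1 ia).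
      by apply: (IHr j k' _ lam' mu') => //; lia.
    apply: abs1; [by apply: fixed1; case: ia| |by lia].
    by apply: mode_C2T jy kv.
  apply: (subspaceZ _ sC).
  rewrite (_ : -1 - n%:Z - q%:Z = - (n + q).+1%:Z); last by lia.
  have hay := hom_mode q%:Z ia kv; rewrite mul1r in hay.
  by apply: (IHr _ _ _ lam' mu' _ _ lp mp lm jy hay); lia.
have [Nh|hN] := ltP N%:Z h; first exact: big hu kv.
have [Nk|kN] := ltP N%:Z k.
  (* The term [i = 0] is [v_(-n) u], up to sign; for [i > 0] a fixed vector acts on the vacuum with
     index [-i-1 <= -2]. *)
  have [J HJ] := skew_symmetry v u (- n%:Z).
  rewrite (HJ J) //; apply: (subspace_sum sC) => i _; apply: (subspaceZ _ sC).
  case: (nat_of_ord i) => [|i'].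
    rewrite addr0 mode_creation; apply: (big k h mu lam) => //; last by rewrite mulrC.
    by rewrite addrC.
  apply: abs1; [|by rewrite aut_vacuum scale1r|by lia].
  by apply: fixed1; apply: mode_C2T kv hu; rewrite mulrC.
have [h0|h0] := ltP h 0.
  by rewrite (weight_neg cft h0 hu.1) mode0l; exact: (subspace0 sC).
have [k0|k0] := ltP k 0.
  by rewrite (weight_neg cft k0 kv.1) mode0r; exact: (subspace0 sC).
have := SP _ _ _ h0 hN lp hu; move: u {hu big}; apply: (span_model sC) => x /= xS.
have := SP _ _ _ k0 kN mp kv; move: v {kv}; apply: (span_moder sC) => y /= yS.
apply: (mP ((x, lam), (y, mu))) => //=; apply: leq_trans nn0.
by rewrite /n0 (big_rem _ xS) /= (big_rem _ yS) /= -!addnS -!addnA leq_addr.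
Qed.

Theorem fixed_C2T : exists N : nat, forall h x, N%:Z < h -> Hom h 1 x -> C2 1 x.
Proof.
have sC := @C2T_subspace R V sigma 1.
have [n0 [n02 n0P]] := C2T_uniform.
have [N NP] := Cn_cofinite cft C2V n02; exists N => h x Nh [hx sx].
pose S : set V := [set x | exists k l la lb v w, [/\ la ^+ p = 1 /\ lb ^+ p = 1,
  Hom k la v, Hom l lb w & x = mode v (- n0%:Z) w]].
have Sx : span S x.
  have sS := @span_subspace K V S.
  have := Cn_weight hx (NP h x Nh hx).
  apply: span_min => // _ [k [l [v [w [k0 kv lw E ->]]]]].
  have := hom_span p_gt0 sigmap kv; move: v {kv}; apply: (span_model sS) => v [la lap kv].
  have := hom_span p_gt0 sigmap lw; move: w {lw}; apply: (span_moder sS) => w [lb lbp lw].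
  by apply: span_incl; exists k, l, la, lb, v, w.
have Sh g : S g -> exists2 mu, mu ^+ p = 1 & sigma g = mu *: g.
  move=> [k [l [la [lb [v [w [[lap lbp] [_ sv] [_ sw] ->]]]]]]].
  by exists (la * lb); [apply: rootM|apply: sigma_mode].
have := eigen_span p_gt0 Sh (expr1n _ _) sx Sx.
apply: span_min => // _ [[k [l [la [lb [v [w [[lap lbp] kv lw ->]]]]]]] /= sg].
have [->|g0] := eqVneq (mode v (- n0%:Z) w) 0; first exact: (subspace0 sC).
have lab : la * lb = 1.
  by apply: eigen_eq sg g0; apply: sigma_mode; [case: kv|case: lw].
exact: (n0P _ _ _ _ _ _ lap lbp lab kv lw).
Qed.

(** [C2T 1] lies in [V], the other [C_2] in the subtype of fixed vectors; generators lift, and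
    [fixed_val] is injective. *)
Lemma C2T_fixed (x : fixed_voa sigma) : C2 1 (fixed_val x) -> Defs.C2 (fixed_voa sigma) x.
Proof.
pose fv : {linear fixed_points sigma -> V} := \val.
have sD : is_subspace (Defs.C2 (fixed_voa sigma)) by exact: span_subspace.
suff H z : C2 1 z -> exists2 y : fixed_voa sigma, Defs.C2 (fixed_voa sigma) y & fv y = z.
  by move=> /H[y Cy] /fixed_val_inj <-.
apply: (@span_min _ _ _ [set z | exists2 y : fixed_voa sigma,
  Defs.C2 (fixed_voa sigma) y & fv y = z]) => [|_ [h [k [a [y [h0 [ha sa] [ky sy] ->]]]]]].
  split; first by exists 0; [exact: (subspace0 sD)|rewrite linear0].
  move=> c _ _ [y Cy <-] [y' Cy' <-]; exists (c *: y + y'); first exact: sD.2.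
  by rewrite linearP.
have fa : a \in fixed_pred sigma by rewrite unfold_in; apply/eqP/fixed1.
have fy : y \in fixed_pred sigma by rewrite unfold_in; apply/eqP/fixed1.
exists (@mode R (fixed_voa sigma) (FixedPoint fa) (-2) (FixedPoint fy)) => //.
apply: span_incl; exists h, (FixedPoint fa), (FixedPoint fy); split=> //.
exact/fixed_weightP.
Qed.

Theorem fixed_C2_cofinite : C2_cofinite (fixed_voa sigma).
Proof.
have [N NP] := fixed_C2T; pose T := fixed_voa sigma.
have H (m : nat) := voa_grading_fin (voaP T) m%:Z.
have [s sP] := choice H; pose F := flatten [seq s m | m <- iota 0 N.+1].
exists F => x; have sD : is_subspace (Defs.C2 T) by exact: span_subspace.
have sY := plus_span_subspace F sD.
suff : plus_span (Defs.C2 T) F x by [].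
have [t _ ->] := wproj_sum (x : T); apply: (subspace_sum sY) => h _.
have := wproj_weight h (x : T); move: (wproj h _) => {t}x hx.
have hvx : weight_space V h (fixed_val x) by apply/fixed_weightP.
have [h0|h0] := ltP h 0.
  have -> : x = 0 by apply: fixed_val_inj; rewrite (weight_neg cft h0 hvx).
  exact: (subspace0 sY).
have [Nh|hN] := ltP N%:Z h.
  apply: plus_spanl; apply: C2T_fixed; apply: (NP h) => //.
  by split=> //; rewrite scale1r fixedE.
have [m mh] : exists m : nat, h = m%:Z by exists `|h|%N; lia.
apply: plus_spanr => //; have : span [set` s m] x by rewrite -sP -mh.
apply: span_mono => y /= ys; apply/flatten_mapP; exists m => //.
by rewrite mem_iota add0n; lia.
Qed.

End UniformBound.

Theorem mainTheorem1 (R : realType) (V : voa R) (sigma : voa_aut V) (p : nat)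
    (hC2 : C2_cofinite V) (hsimple : voa_simple V) (hcft : cft_type V)
    (hsigma : aut_has_order sigma p) :
  C2_cofinite (fixed_voa sigma).
Proof.
have [p_gt0 sigmap _] := hsigma.
exact: (fixed_C2_cofinite hcft hsimple hC2 p_gt0 sigmap).
Qed.
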